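(* Let $\Omega$ be a compact metric space, let $\alpha>0$, and let $\nu_0$ be a Borel probability measure on $\Omega$ with support equal to $\Omega$. Let $f:\Omega\to\mathbb{R}$ be continuous, $f_{\max}=\max_\Omega f$, $f_{\min}=\min_\Omega f$, and let $u\in[f_{\min},f_{\max})$. Let $\eta_0$ be a finite non-negative Borel measure on $f^{-1}((u,\infty))$ (regarded as a measure on $\Omega$ by giving zero mass to the complement) such that $\eta_0\le\alpha\nu_0$. Assume that $\min_{\mathrm{supp}(\eta_0)}f-u+(u-f_{\min})^+>0$, and let $m\ge 0$ be such that $$m\le S\left(\eta_0(\Omega),\ \alpha-\eta_0(\Omega),\ \frac{(u-f_{\min})^+}{\min_{\mathrm{supp}(\eta_0)}f-u+(u-f_{\min})^+}\right).$$ Let $\eta$ be a minimizer of $\mu\mapsto\int f\,d\mu$ over the finite non-negative Borel measures $\mu$ on $\Omega$ satisfying $\mu\le\eta_0$ and $\mu(\Omega)=m$. Then, for $X\sim\mathrm{DP}(\alpha\nu_0)$, $$\log\mathbb{P}\left(\int f\,dX\ge u\right)\le -(\alpha-m)\,\mathcal{K}_{\inf}\left(\frac{\alpha\nu_0-\eta}{\alpha-m},\,u,\,f\right).$$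
   Context: $\mathcal{M}_1(\Omega)$ is the set of Borel probability measures on $\Omega$. $\mathrm{DP}(\alpha\nu_0)$ is the law of the Dirichlet process: the random probability measure $X$ on $\Omega$ such that for every finite measurable partition $A_1\sqcup\dots\sqcup A_k=\Omega$, $(X(A_1),\dots,X(A_k))\sim\mathrm{Dir}(\alpha\nu_0(A_1),\dots,\alpha\nu_0(A_k))$ (a Dirichlet distribution, with coordinates of zero parameter equal to $0$). For $\nu,\mu\in\mathcal{M}_1(\Omega)$, $\mathrm{KL}(\nu,\mu)=\int\log\left(\frac{d\nu}{d\mu}\right)d\nu$ if $\nu\ll\mu$, and $\infty$ otherwise. For $f$ continuous on $\Omega$ and $u\in\mathbb{R}$, $$\mathcal{K}_{\inf}(\nu,u,f)=\inf\left\{\mathrm{KL}(\nu,\mu):\ \mu\in\mathcal{M}_1(\Omega),\ \int f\,d\mu\ge u\right\},\qquad \inf\emptyset=\infty.$$ Inequalities between measures are setwise; $x^+=\max(x,0)$; $\mathrm{supp}$ denotes the support (closed in $\Omega$); by convention $\min_{\emptyset}f=f_{\max}$ and $\log 0=-\infty$. $W_0$ denotes the principal branch of the Lambert W function. For $u\in[0,1]$, the function $S$ is defined by $$S(a,b,u)=\begin{cases} a & \text{if } a\le 1 \text{ or } u=0,\\[2pt] a-b\,\frac{a-1}{b+1} & \text{if } a>1,\ u=1,\\[4pt] a-b\,\frac{u}{1-u}+\dfrac{W_0\left(\frac{b\,u^{a-b\frac{u}{1-u}}}{1-u}\log\frac1u\right)}{\log\frac1u} & \text{if } a>1,\ u\in(0,1)\end{cases}$$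 (in particular $S(0,b,u)=0$). *)

(* Defs.v *)
From HB Require Import structures.
From mathcomp Require Import all_boot all_order all_algebra.
From mathcomp Require Import all_classical all_reals all_analysis.

Set Implicit Arguments.
Unset Strict Implicit.
Unset Printing Implicit Defensive.

Import Order.TTheory GRing.Theory Num.Theory.
Import numFieldNormedType.Exports.

Local Open Scope classical_set_scope.
Local Open Scope ring_scope.

(* MathComp-Analysis measurable types are pointed, so the spaces considered are
   nonempty; this loses nothing for a space carrying a probability measure. *)
#[short(type="pmetricType")]
HB.structure Definition PointedMetric (K : numDomainType) :=
  {M of Metric K M & isPointed M}.

Definition borelType (T : ptopologicalType) :
    measurableType (@open T).-sigma :=
  g_sigma_algebraType (@open T).

Section Extrema.
Context {R : realType} {T : Type}.
Implicit Types (f : T -> R) (A : set T).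

(* [sup], [inf] are attained, hence are a max and a min, in every use below:
   [f] is continuous on a compact nonempty space and [A] is closed. *)
Definition fmax f : R := sup (range f).
Definition fmin f : R := inf (range f).
Definition min_on A f : R := if A == set0 then fmax f else inf (f @` A).

End Extrema.

Definition msupport {R : realType} {T : ptopologicalType}
    (mu : set (borelType T) -> \bar R) : set T :=
  [set x | forall U : set T, open_nbhs x U -> (0 < mu U)%E].

Section LambertW.
Context {R : realType}.
Implicit Types a b u x : R.

(* The principal branch is valued in [-1, +oo[; outside of its domain
   [-1/e, +oo[, the value is 0. *)
Definition lambertW0 x : R := xget 0 [set w : R | -1 <= w /\ w * expR w = x].

Definition Sfun a b u : R :=
  if (a <= 1) || (u == 0) then a
  else if u == 1 then a - b * ((a - 1) / (b + 1))
  else a - b * (u / (1 - u))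
       + lambertW0 (b * u `^ (a - b * (u / (1 - u))) / (1 - u) * ln (1 / u))
         / ln (1 / u).

End LambertW.

Section GammaLaw.
Context {R : realType}.
Implicit Types a : R.

Definition gamma_fun a : R :=
  (\int[lebesgue_measure]_(x in `]0, +oo[) (x `^ (a - 1) * expR (- x)))%R.

(* Gamma distribution of shape [a] and scale 1, the Dirac mass at 0 if
   [a = 0]. *)
Definition gamma_law a (B : set R) : \bar R :=
  if 0 < a then
    (\int[lebesgue_measure]_(x in B `&` `]0%R, +oo[)
       (x `^ (a - 1) * expR (- x) / gamma_fun a)%:E)%E
  else (\d_(0%R : R) B)%E.

End GammaLaw.

Definition independent_RVs {d} {V : measurableType d} {R : realType}
    (Q : probability V R) (k : nat) (Z : 'I_k -> {RV Q >-> R}) : Prop :=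
  forall B : 'I_k -> set R, (forall i, measurable (B i)) ->
    Q (\bigcap_i (Z i @^-1` B i)) = (\prod_(i < k) Q (Z i @^-1` B i))%E.

(* Ferguson's definition of the Dirichlet distribution, which allows zero
   parameters: the law of (Z_i / sum_j Z_j)_i for independent
   Z_i ~ Gamma(a_i, 1). *)
Definition is_Dirichlet {d} {W : measurableType d} {R : realType}
    (P : probability W R) (k : nat) (Y : 'I_k -> W -> R) (a : 'I_k -> R)
    : Prop :=
  exists (d' : measure_display) (V : measurableType d') (Q : probability V R)
    (Z : 'I_k -> {RV Q >-> R}),
  [/\ independent_RVs Z,
      (forall i (B : set R), measurable B ->
         Q (Z i @^-1` B) = gamma_law (a i) B) &
      (forall B : set (k.-tuple (measurableTypeR R)), measurable B ->
         P [set w | B [tuple Y i w | i < k]]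
         = Q [set v | B [tuple Z i v / \sum_(j < k) Z j v | i < k]])].

(* [X ~ DP(alpha nu0)]; [pprobability T R] is the space of probability measures
   on [T] with the sigma-algebra generated by the evaluations [mu |-> mu A]. *)
Definition is_DirichletProcess {d} {W : measurableType d} {R : realType}
    (P : probability W R) {d'} {T : measurableType d'}
    (X : {RV P >-> pprobability T R}) (alpha : R) (nu0 : probability T R)
    : Prop :=
  forall (k : nat) (A : 'I_k -> set T),
    (forall i, measurable (A i)) -> trivIset setT A ->
    \bigcup_i A i = setT ->
    is_Dirichlet P (fun i w => fine ((X w : probability T R) (A i)))
                 (fun i => alpha * fine (nu0 (A i))).

Section KullbackLeibler.
Context {R : realType} {d} {T : measurableType d}.
Local Open Scope ereal_scope.
Local Open Scope charge_scope.

Definition KL (nu mu : probability T R) : \bar R :=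
  if `[< nu `<< mu >] then
    \int[nu]_x lne (('d (charge_of_finite_measure nu) '/d mu) x)
  else +oo.

Definition Kinf (nu : probability T R) (u : R) (f : T -> R) : \bar R :=
  ereal_inf [set KL nu mu | mu in
    [set mu : probability T R | u%:E <= \int[mu]_x (f x)%:E]].

End KullbackLeibler.

Definition mle {R : realType} {d} {T : measurableType d}
    (mu1 mu2 : set T -> \bar R) : Prop :=
  forall A, measurable A -> (mu1 A <= mu2 A)%E.

(* Main.v *)
Require Import Defs.
From HB Require Import structures.
From mathcomp Require Import all_boot all_order all_algebra.
From mathcomp Require Import all_classical all_reals all_analysis.
From mathcomp Require Import measurable_realfun.
From mathcomp Require Import ring lra.

(** Write a = eta0(Omega), b = alpha - a, and nu = (alpha nu0 - eta) / (alpha - m).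
    The theorem is the combination, over all la in [0, 1 / (fmax f - u)[, of an
    exponential bound for the Dirichlet process ([lne_random_integral_tail_le])
      log P (int f dX >= u) <= - (alpha - m) int log (1 - la (f - u)) dnu
    and of the duality estimate ([Kinf_le_dual]), which says that for some la the
    integral on the right is, up to any eps > 0, at least Kinf nu u f.

    The exponential bound. On a partition of Omega into level sets of f, X is a
    Dirichlet vector, that is, a normalised vector of independent gamma
    variables; so int f dX >= u implies that a sum of th_i Z_i is nonnegative,
    where th_i is an upper bound of f - u on the i-th cell and Z_i ~ Gamma(alpha nu0(A_i)).
    Chernoff's inequality would give the bound with alpha nu0 in place of
    alpha nu0 - eta. To save the mass m of eta, each Z_i is split into independent
    gamma variables with parameters the masses of eta, eta0 - eta and
    alpha nu0 - eta0, and three facts are used.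
    - Monotonicity. As eta minimizes int f, it fills the lowest levels of eta0
      ([bathtub_minimizer_level]); hence every weight of the eta group may be
      raised to any weight of the eta0 - eta group.
    - Merging. The quotient of two independent gamma variables is independent of
      their sum ([gamma_mean_merge]), so that a bound of the form
      K (1 - la t)^(- shape), uniform in the weight t, passes from one variable
      to families of variables with a product in place of the power
      ([gamma_means_merge_le]). This leaves only two variables: G1 of shape a and weight
      t1 > 0, which contains the eta group, and G2 of shape b and weight t2.
    - Two variables. For t2 < 0, P (t1 G1 + t2 G2 >= 0) is a value of the beta prime
      distribution function. It is at most
      (1 - la t1)^(- (a - m)) (1 - la t2)^(- b) ([gamma_mean2_step_le]), by comparison of
      derivatives, as soon as m satisfies the elementary inequality [tail_cond], whose
      extremal solution is the function S ([Sfun_tail_cond]).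

    Duality. The competitor in Kinf is a reweighting of nu by
    s / (1 - la (f - u)), completed by a Dirac mass at a maximum point of f, where
    la is nearly stationary for int log (1 - la (f - u)) dnu. *)

Import Order.TTheory GRing.Theory Num.Theory.
Import numFieldNormedType.Exports.

Set Implicit Arguments.
Unset Strict Implicit.
Unset Printing Implicit Defensive.

Local Open Scope classical_set_scope.
Local Open Scope ring_scope.

(** * Gamma densities *)

Section Gamma.
Context {R : realType}.
Local Notation mu := (@lebesgue_measure R).
Implicit Types (F : R -> \bar R) (a b c t x : R).

Lemma measurable_EFinS (D : set (measurableTypeR R)) (g : R -> R) :
  measurable_fun [set: R] g -> measurable_fun D (fun x => (g x)%:E).
Proof. by move=> mg; apply: measurable_funTS; apply/measurable_EFinP. Qed.

(** On half-open intervals, the push-forward along the dilation of c times Lebesgue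
    measure is Lebesgue measure. *)
Lemma ge0_integral_scale c F : 0 < c -> measurable_fun [set: R] F ->
  (forall x, 0 <= F x)%E ->
  (\int[mu]_x F x = c%:E * \int[mu]_x F (c * x)%R)%E.
Proof.
move=> c0 mF F0.
have mc : measurable_fun [set: measurableTypeR R] ( *%R c : _ -> measurableTypeR R).
  exact: measurable_funM.
have -> : (\int[mu]_x F (c * x)%R =
    \int[pushforward mu ( *%R c : _ -> measurableTypeR R)]_x F x)%E.
  by rewrite (ge0_integral_pushforward mc).
rewrite -[c]/((NngNum (ltW c0))%:num).
rewrite -ge0_integral_mscale//.
apply: eq_measure_integral => A mA _.
apply: lebesgue_measure_unique => //= _ [[p q]] _ <-.
rewrite /= /mscale /= /pushforward.
have -> : *%R c @^-1` `]p, q] = `](p / c), (q / c)]%classic.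
  apply/seteqP; split => [x/=|x/=];
    by rewrite !in_itv/= ltr_pdivrMr// ler_pdivlMr// mulrC.
rewrite !lebesgue_measure_itv/= !lte_fin ltr_pM2r ?invr_gt0//.
case: ifPn => _; last by rewrite mule0.
by rewrite -!EFinD -EFinM mulrBr !(mulrC c) !divfK// gt_eqF.
Qed.

(** The density of Gamma(a, 1), extended by 0 so that integrals are over the whole line. *)
Definition gamma_density a x : R :=
  if 0 < x then x `^ (a - 1) * expR (- x) / gamma_fun a else 0.

Let gamma_kernel a x : R := x `^ (a - 1) * expR (- x).

Let measurable_gamma_kernel a : measurable_fun [set: R] (gamma_kernel a).
Proof.
apply: measurable_funM; first exact: measurable_powR.
by apply: measurableT_comp => //; exact: measurableT_comp.
Qed.

Let gamma_kernel_ge0 a x : 0 <= gamma_kernel a x.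
Proof. by rewrite mulr_ge0 ?powR_ge0 ?expR_ge0. Qed.

Lemma continuous_powRl a x : 0 < x -> {for x, continuous (fun y : R => y `^ a)}.
Proof.
move=> x0; apply: differentiable_continuous; apply/derivable1_diffP.
exact: (@ex_derive _ _ _ _ _ _ _ (is_derive1_powR a x0)).
Qed.

(** The fundamental theorem of calculus applies on [1 / (n + 1), 1] only, since the
    primitive need not be differentiable at 0. *)
Let integral_powR_near0 a : 0 < a ->
  (\int[mu]_(x in `]0%R, 1%R]) (x `^ (a - 1))%:E <= (a^-1)%:E)%E.
Proof.
move=> a0.
have H n : (\int[mu]_(x in `[(0 + n.+1%:R^-1)%R, 1%R]) (x `^ (a - 1))%:E <= (a^-1)%:E)%E.
  have [->|n0] := eqVneq n 0.
    by rewrite invr1 add0r set_itv1 integral_set1 lee_fin invr_ge0 ltW.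
  have n1 : 0 + (n.+1%:R^-1 : R) < 1 by rewrite add0r invf_lt1// ltr1n ltnS lt0n.
  have n2 : 0 < 0 + (n.+1%:R^-1 : R) by rewrite add0r invr_gt0.
  have dF x : 0 < x -> is_derive x 1 (fun y => a^-1 * y `^ a) (x `^ (a - 1)).
    move=> x0; have := is_deriveZ a^-1 (is_derive1_powR a x0).
    by rewrite scalerA mulVf ?gt_eqF// scale1r.
  have cF x : 0 < x -> {for x, continuous (fun y => a^-1 * y `^ a)}.
    move=> x0; apply: differentiable_continuous; apply/derivable1_diffP.
    exact: (@ex_derive _ _ _ _ _ _ _ (dF _ x0)).
  rewrite (@continuous_FTC2 _ _ (fun x => a^-1 * x `^ a))//.
  - rewrite powR1 mulr1 -EFinB lee_fin gerBl.
    by rewrite mulr_ge0 ?powR_ge0// invr_ge0 ltW.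
  - apply: continuous_in_subspaceT => x; rewrite inE/= in_itv/= => /andP[x0 _].
    by apply: continuous_powRl; exact: lt_le_trans x0.
  - split.
    + move=> x; rewrite in_itv/= => /andP[x0 _].
      by apply: ex_derive; exact: (dF _ (lt_trans n2 x0)).
    + by apply: cvg_at_right_filter; exact: cF.
    + by apply: cvg_at_left_filter; exact: cF.
  - move=> x; rewrite in_itv/= => /andP[x0 _].
    by rewrite derive1E; apply: derive_val; exact: (dF _ (lt_trans n2 x0)).
rewrite itv_open_bnd_bigcup.
pose I n : set (measurableTypeR R) := `[(0 + n.+1%:R^-1 : R), 1]%classic.
have ndI : nondecreasing_seq I.
  move=> i j ij; rewrite subsetEset => x; rewrite /I/= !in_itv/= => /andP[h ->].
  by rewrite andbT (le_trans _ h)// lerD2l lef_pV2 ?posrE ?ltr0n// ler_nat ltnS.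
have mI i : measurable (I i) by exact: measurable_itv.
have mpow i : measurable_fun (I i) (fun x : R => (x `^ (a - 1))%:E).
  by apply: measurable_EFinS; exact: measurable_powR.
have pow0 i (x : R) : I i x -> (0 <= (x `^ (a - 1))%:E)%E.
  by move=> _; rewrite lee_fin powR_ge0.
have C := @ge0_nondecreasing_set_cvg_integral _ _ _ I
  (fun x => (x `^ (a - 1))%:E) mu ndI mI mpow pow0.
rewrite -(cvg_lim _ C)//; apply: lime_le; last by near=> n; exact: H.
by apply/cvg_ex; eexists; exact: C.
Unshelve. all: by end_near. Qed.

(** Half of the exponential absorbs the power: ln y <= y at y = x / (2 (p + 1)) gives
    x^p <= C e^(x / 2), and a multiple of the exponential density of rate 1/2 is left. *)
Let integral_gamma_kernel_tail a : (\int[mu]_(x in `]1%R, +oo[) (gamma_kernel a x)%:E < +oo)%E.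
Proof.
pose p := Num.max (a - 1) 0.
have p0 : 0 <= p by rewrite le_max lexx orbT.
pose C := expR (p * ln (2 * (p + 1))).
have H x : 1 < x -> gamma_kernel a x <= (C * 2) * exponential_pdf 2^-1 x.
  move=> x1; have x0 : 0 < x by exact: lt_trans x1.
  rewrite exponential_pdfE ?(ltW x0)// mulrA mulfK ?gt_eqF//.
  rewrite /gamma_kernel (le_trans (y := x `^ p * expR (- x)))//.
    rewrite ler_wpM2r ?expR_ge0// ler_powR ?(ltW x1)// /p le_max lexx//.
  rewrite /powR gt_eqF// /C -!expRD ler_expR.
  have : ln (x / (2 * (p + 1))) <= x / (2 * (p + 1)).
    by apply/ltW/ln_sublinear; rewrite divr_gt0// mulr_gt0// ltr_wpDl.
  rewrite lnM ?posrE ?invr_gt0//; last by rewrite mulr_gt0// ltr_wpDl.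
  rewrite lnV ?posrE; last by rewrite mulr_gt0// ltr_wpDl.
  move=> /(ler_wpM2l p0) h.
  have h2 : p * (x / (2 * (p + 1))) <= x / 2.
    have -> : p * (x / (2 * (p + 1))) = p / (p + 1) * (x / 2).
      by field; rewrite gt_eqF// ltr_wpDl.
    rewrite ler_piMl ?divr_ge0 ?(ltW x0)// ler_pdivrMr ?ltr_wpDl//; lra.
  lra.
have C0 : 0 <= C * 2 by rewrite mulr_ge0 ?expR_ge0.
have mexp := @measurable_exponential_pdf R 2^-1.
have exp0 x : 0 <= (exponential_pdf 2^-1 x : R).
  by rewrite exponential_pdf_ge0// ltW.
apply: (@le_lt_trans _ _ (\int[mu]_x (C * 2 * exponential_pdf 2^-1 x)%:E)%E).
  apply: (@le_trans _ _ (\int[mu]_(x in `]1%R, +oo[) (C * 2 * exponential_pdf 2^-1 x)%:E)%E).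
    apply: ge0_le_integral => //=.
    - by move=> x _; rewrite lee_fin.
    - exact: measurable_EFinS.
    - by apply: measurable_EFinS; exact: measurable_funM.
    - by move=> x; rewrite in_itv/= andbT lee_fin => /H.
  apply: ge0_subset_integral => //=.
  - apply: measurable_EFinS; exact: measurable_funM.
  - by move=> x _; rewrite lee_fin mulr_ge0.
under eq_integral do rewrite EFinM.
rewrite ge0_integralZl//=.
- by rewrite integral_exponential_pdf// mule1 ltry.
- exact: measurable_EFinS.
- by move=> x _; rewrite lee_fin.
Qed.

Let integral_gamma_kernel_lty a : 0 < a ->
  (\int[mu]_(x in `]0%R, +oo[) (gamma_kernel a x)%:E < +oo)%E.
Proof.
move=> a0.
have mg D : measurable_fun D (EFin \o gamma_kernel a).
  exact: measurable_EFinS.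
have -> : `]0%R, +oo[%classic = `]0%R, 1%R] `|` `]1%R, +oo[ :> set R.
  by rewrite -itv_bndbnd_setU// bnd_simp.
rewrite ge0_integral_setU//=; last 3 first.
- exact: measurable_EFinS.
- by move=> x _; rewrite lee_fin.
- apply/disj_setPLR => x/=; rewrite !in_itv/= => /andP[_ x1].
  by apply/negP; rewrite negb_and -leNgt x1.
rewrite lte_add_pinfty//.
apply: (@le_lt_trans _ _ (a^-1)%:E); last exact: ltry.
apply: (@le_trans _ _ (\int[mu]_(x in `]0%R, 1%R]) (x `^ (a - 1))%:E)%E);
  last exact: integral_powR_near0.
apply: ge0_le_integral => //=.
- by move=> x _; rewrite lee_fin.
- exact: measurable_EFinS.
- by apply: measurable_EFinS; exact: measurable_powR.
- move=> x; rewrite in_itv/= => /andP[x0 _].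
  by rewrite lee_fin ler_piMr ?powR_ge0// -[leRHS]expR0 ler_expR oppr_le0 ltW.
Qed.

Lemma gamma_fun_gt0 a : 0 < a -> 0 < gamma_fun a :> R.
Proof.
move=> a0; rewrite /gamma_fun /Rintegral fine_gt0// integral_gamma_kernel_lty// andbT.
(* c bounds the integrand from below on ]1, 2] *)
pose c := expR (- (`|a - 1| * ln 2) - 2).
apply: (@lt_le_trans _ _ (\int[mu]_(x in `]1%R, 2%R]) (cst c%:E x))%E).
  rewrite integral_cst//= lebesgue_measure_itv/= lte_fin ltr1n.
  by rewrite mule_gt0// ?lte_fin ?expR_gt0// -EFinB lte_fin subr_gt0 ltr1n.
apply: (@le_trans _ _ (\int[mu]_(x in `]1%R, 2%R]) (gamma_kernel a x)%:E)%E).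
  apply: ge0_le_integral => //=.
  - by move=> x _; rewrite lee_fin expR_ge0.
  - exact: measurable_EFinS.
  - move=> x; rewrite in_itv/= lee_fin => /andP[x1 x2].
    have x0 : 0 < x by exact: lt_trans x1.
    rewrite /gamma_kernel /powR gt_eqF// -expRD ler_expR lerD ?lerN2//.
    have lnx : 0 <= ln x by rewrite ln_ge0// ltW.
    have ln2 : ln x <= ln 2 by rewrite ler_ln ?posrE.
    rewrite (le_trans (y := - (`|a - 1| * ln x)))//.
      by rewrite lerN2 ler_wpM2l.
    by rewrite -mulNr ler_wpM2r// lerNl -normrN ler_norm.
apply: ge0_subset_integral => //=.
- exact: measurable_EFinS.
- by move=> x _; rewrite lee_fin.
- by move=> x /=; rewrite !in_itv/= andbT => /andP[x1 _]; exact: lt_trans x1.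
Qed.

Let integral_gamma_kernelE a : 0 < a ->
  (\int[mu]_(x in `]0%R, +oo[) (gamma_kernel a x)%:E = (gamma_fun a)%:E)%E.
Proof.
move=> a0; rewrite /gamma_fun /Rintegral fineK// ge0_fin_numE ?integral_gamma_kernel_lty//.
by apply: integral_ge0 => x _; rewrite lee_fin gamma_kernel_ge0.
Qed.

Lemma gamma_density_ge0 a x : 0 <= gamma_density a x.
Proof.
rewrite /gamma_density; case: ifPn => // _.
rewrite divr_ge0 ?gamma_kernel_ge0// /gamma_fun /Rintegral fine_ge0// integral_ge0//.
by move=> y _; rewrite lee_fin gamma_kernel_ge0.
Qed.

Lemma measurable_gamma_density a : measurable_fun [set: R] (gamma_density a).
Proof.
apply: measurable_fun_ifT => //; first exact: measurable_fun_ltr.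
exact: (measurable_funM (measurable_gamma_kernel a) (measurable_cst _)).
Qed.

Lemma integral_gamma_density_set a (A : set R) : measurable A ->
  (\int[mu]_(x in A) (gamma_density a x)%:E =
   \int[mu]_(x in A `&` `]0%R, +oo[)
     (x `^ (a - 1) * expR (- x) / gamma_fun a)%:E)%E.
Proof.
move=> mA; rewrite [RHS]integral_mkcondr.
apply: eq_integral => x _; rewrite /gamma_density patchE.
have -> : (x \in `]0%R, +oo[%classic) = (0 < x).
  by apply/idP/idP; rewrite inE/= in_itv/= andbT.
by case: ifPn.
Qed.

Lemma integral_gamma_density a : 0 < a -> (\int[mu]_x (gamma_density a x)%:E = 1)%E.
Proof.
move=> a0; rewrite integral_gamma_density_set// setTI.
under eq_integral do rewrite mulrC EFinM.
rewrite ge0_integralZl//=.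
- by rewrite integral_gamma_kernelE// -EFinM mulVf// gt_eqF// gamma_fun_gt0.
- by apply: measurable_EFinS; exact: measurable_gamma_kernel.
- by move=> x _; rewrite lee_fin gamma_kernel_ge0.
- by rewrite lee_fin invr_ge0 ltW// gamma_fun_gt0.
Qed.

End Gamma.

(** * Expectations of functions of a scaled gamma variable *)

Section GammaOperator.
Context {R : realType}.
Local Notation mu := (@lebesgue_measure R).
Implicit Types (F H : R -> \bar R) (a b c t x : R).

(** On these functions expectations make sense, possibly infinite, and Tonelli's
    theorem applies. *)
Definition nneg_meas F := measurable_fun [set: R] F /\ forall x, (0 <= F x)%E.

(** The expectation of F (x + t G) for G ~ Gamma(a, 1), where a <= 0 stands for the
    Dirac mass at 0 as in [gamma_law]. A sum of independent weighted gamma variables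
    is a composition of these operators in F. *)
Definition gamma_mean t a F x : \bar R :=
  if 0 < a then (\int[mu]_z ((gamma_density a z)%:E * F (x + t * z)%R))%E else F x.

Lemma gamma_meanE t a F : 0 < a ->
  gamma_mean t a F = fun x => (\int[mu]_z ((gamma_density a z)%:E * F (x + t * z)%R))%E.
Proof. by move=> a0; apply/funext => x; rewrite /gamma_mean a0. Qed.

Lemma gamma_mean_id t a F : ~~ (0 < a) -> gamma_mean t a F = F.
Proof. by move=> /negbTE a0; apply/funext => x; rewrite /gamma_mean a0. Qed.

Let measurable_shift F t :
  nneg_meas F -> measurable_fun [set: R * measurableTypeR R] (fun p => F (p.1 + t * p.2)%R).
Proof.
move=> [mF _]; apply: (measurableT_comp mF).
apply: measurable_funD => //; exact: measurable_funM.
Qed.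

Let measurable_gamma_density2 a :
  measurable_fun [set: R * measurableTypeR R] (fun p => (gamma_density a p.2)%:E).
Proof.
apply/measurable_EFinP.
exact: (measurableT_comp (measurable_gamma_density a) measurable_snd).
Qed.

Let measurable_integrand F t a : nneg_meas F ->
  measurable_fun [set: R * measurableTypeR R]
    (fun p => ((gamma_density a p.2)%:E * F (p.1 + t * p.2)%R)%E).
Proof.
by move=> nF; apply: emeasurable_funM; [exact: measurable_gamma_density2|exact: measurable_shift].
Qed.

Lemma measurable_affine_comp F x t : nneg_meas F ->
  measurable_fun [set: measurableTypeR R] (fun z => F (x + t * z)%R).
Proof.
move=> [mF _]; apply: (measurableT_comp mF).
apply: measurable_funD => //; exact: measurable_funM.
Qed.

Lemma nneg_meas_gamma_mean t a F : nneg_meas F -> nneg_meas (gamma_mean t a F).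
Proof.
move=> nF; have [a0|a0] := boolP (0 < a); last first.
  by rewrite gamma_mean_id.
rewrite gamma_meanE//; split.
  have := @measurable_fun_fubini_tonelli_F _ _ R (measurableTypeR R) R mu
    (fun p => ((gamma_density a p.2)%:E * F (p.1 + t * p.2)%R)%E).
  apply; first exact: measurable_integrand.
  by move=> p; rewrite mule_ge0// ?lee_fin ?gamma_density_ge0//; exact: nF.2.
move=> x; apply: integral_ge0 => z _; rewrite mule_ge0// ?lee_fin ?gamma_density_ge0//.
exact: nF.2.
Qed.

Lemma measurable_gamma_mean_integrand F x t a : nneg_meas F ->
  measurable_fun [set: measurableTypeR R]
    (fun z => ((gamma_density a z)%:E * F (x + t * z)%R)%E).
Proof.
move=> nF; apply: emeasurable_funM; last exact: measurable_affine_comp.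
by apply: measurable_EFinS; exact: measurable_gamma_density.
Qed.

Lemma gamma_mean_integrand_ge0 F x t a z : nneg_meas F ->
  (0 <= (gamma_density a z)%:E * F (x + t * z)%R)%E.
Proof. by move=> nF; rewrite mule_ge0// ?lee_fin ?gamma_density_ge0//; exact: nF.2. Qed.

Lemma gamma_mean0 t F : gamma_mean t 0 F = F.
Proof. by apply/funext => x; rewrite /gamma_mean ltxx. Qed.

Lemma gamma_mean_comm t a t' a' F : nneg_meas F ->
  gamma_mean t a (gamma_mean t' a' F) = gamma_mean t' a' (gamma_mean t a F).
Proof.
move=> nF; have [a0|a0] := boolP (0 < a); last by rewrite !(gamma_mean_id _ _ a0).
have [a'0|a'0] := boolP (0 < a'); last by rewrite !(gamma_mean_id _ _ a'0).
rewrite !(gamma_meanE _ _ a0) !(gamma_meanE _ _ a'0); apply/funext => x.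
pose K (p : measurableTypeR R * measurableTypeR R) :=
  ((gamma_density a p.1)%:E * ((gamma_density a' p.2)%:E * F (x + t * p.1 + t' * p.2)%R))%E.
have K0 p : (0 <= K p)%E.
  by rewrite !mule_ge0// ?lee_fin ?gamma_density_ge0//; exact: nF.2.
have mK : measurable_fun [set: measurableTypeR R * measurableTypeR R] K.
  apply: emeasurable_funM.
    apply/measurable_EFinP.
    exact: (measurableT_comp (measurable_gamma_density a) measurable_fst).
  apply: emeasurable_funM.
    apply/measurable_EFinP.
    exact: (measurableT_comp (measurable_gamma_density a') measurable_snd).
  apply: (measurableT_comp nF.1); apply: measurable_funD.
    by apply: measurable_funD => //; exact: measurable_funM.
  exact: measurable_funM.
transitivity (\int[mu]_z \int[mu]_y K (z, y))%E.
  apply: eq_integral => z _; rewrite -ge0_integralZl//.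
  - exact: measurable_gamma_mean_integrand.
  - by move=> y _; exact: gamma_mean_integrand_ge0.
  - by rewrite lee_fin gamma_density_ge0.
rewrite (fubini_tonelli K)//.
apply: eq_integral => y _; apply/esym; rewrite -ge0_integralZl.
- by apply: eq_integral => z _; rewrite muleCA addrAC.
- exact: measurableT.
- exact: measurable_gamma_mean_integrand.
- by move=> z _; exact: gamma_mean_integrand_ge0.
- by rewrite lee_fin gamma_density_ge0.
Qed.

Lemma le_gamma_mean t a F H x : nneg_meas F -> nneg_meas H -> (forall y, F y <= H y)%E ->
  (gamma_mean t a F x <= gamma_mean t a H x)%E.
Proof.
move=> nF nH FH; rewrite /gamma_mean; case: ifPn => // a0.
apply: ge0_le_integral => //.
- by move=> z _; exact: gamma_mean_integrand_ge0.
- exact: measurable_gamma_mean_integrand.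
- exact: measurable_gamma_mean_integrand.
- by move=> z _; rewrite lee_wpmul2l// lee_fin gamma_density_ge0.
Qed.

Lemma gamma_meanZ t a k F x : nneg_meas F -> 0 <= k ->
  gamma_mean t a (fun y => k%:E * F y)%E x = (k%:E * gamma_mean t a F x)%E.
Proof.
move=> nF k0; rewrite /gamma_mean; case: ifPn => // a0.
under eq_integral do rewrite muleCA.
rewrite ge0_integralZl//.
- exact: measurable_gamma_mean_integrand.
- by move=> z _; exact: gamma_mean_integrand_ge0.
Qed.

Lemma nneg_meas_cst k : 0 <= k -> nneg_meas (cst k%:E).
Proof. by move=> k0; split => // x; rewrite lee_fin. Qed.

Lemma gamma_mean_cst t a k : 0 <= k -> gamma_mean t a (cst k%:E) = cst k%:E.
Proof.
move=> k0; apply/funext => x; rewrite /gamma_mean; case: ifPn => // a0.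
rewrite ge0_integralZr//.
- by rewrite integral_gamma_density// mul1e.
- by apply: measurable_EFinS; exact: measurable_gamma_density.
- by move=> z _; rewrite lee_fin gamma_density_ge0.
Qed.

Lemma gamma_mean_le1 t a F x : nneg_meas F -> (forall y, F y <= 1)%E -> (gamma_mean t a F x <= 1)%E.
Proof.
move=> nF F1; have := @gamma_mean_cst t a 1 ler01 => /(congr1 (fun h => h x))/= <-.
exact: le_gamma_mean (nneg_meas_cst ler01) _.
Qed.

Lemma gamma_mean_nd t a F : nneg_meas F -> {homo F : x y / (x <= y)%R >-> (x <= y)%E} ->
  {homo gamma_mean t a F : x y / (x <= y)%R >-> (x <= y)%E}.
Proof.
move=> nF ndF x y xy; rewrite /gamma_mean; case: ifPn => a0; last exact: ndF.
apply: ge0_le_integral => //.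
- by move=> z _; exact: gamma_mean_integrand_ge0.
- exact: measurable_gamma_mean_integrand.
- exact: measurable_gamma_mean_integrand.
- by move=> z _; rewrite lee_wpmul2l ?lee_fin ?gamma_density_ge0// ndF// lerD2r.
Qed.

(** Gamma variables are nonnegative, so a larger weight moves the argument of F to the
    right. *)
Lemma le_gamma_mean_scale t t' a F x : nneg_meas F ->
  {homo F : x y / (x <= y)%R >-> (x <= y)%E} -> t <= t' ->
  (gamma_mean t a F x <= gamma_mean t' a F x)%E.
Proof.
move=> nF ndF tt'; rewrite /gamma_mean; case: ifPn => // a0.
apply: ge0_le_integral => //.
- by move=> z _; exact: gamma_mean_integrand_ge0.
- exact: measurable_gamma_mean_integrand.
- exact: measurable_gamma_mean_integrand.
- move=> z _; rewrite /gamma_density; case: ifPn => z0; last by rewrite !mul0e.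
  rewrite lee_wpmul2l//.
    by have := gamma_density_ge0 a z; rewrite /gamma_density z0 lee_fin.
  by rewrite ndF// lerD2l ler_wpM2r// ltW.
Qed.

End GammaOperator.

(** * Merging two gamma variables *)

Section GammaBeta.
Context {R : realType}.
Local Notation mu := (@lebesgue_measure R).
Implicit Types (F H : R -> \bar R) (a b c t x w : R).

(** The density of G2 / G1 for independent G1 ~ Gamma(a, 1) and G2 ~ Gamma(b, 1). *)
Definition beta_prime_density a b w : R :=
  if 0 < w then w `^ (b - 1) * (1 + w) `^ (- (a + b)) *
    (gamma_fun (a + b) / (gamma_fun a * gamma_fun b)) else 0.

Lemma beta_prime_density_ge0 a b w : 0 < a -> 0 < b -> 0 <= beta_prime_density a b w.
Proof.
move=> a0 b0; rewrite /beta_prime_density; case: ifPn => // w0.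
by rewrite !mulr_ge0 ?powR_ge0 ?invr_ge0 ?mulr_ge0 ?ltW ?gamma_fun_gt0 ?addr_gt0.
Qed.

Lemma measurable_beta_prime_density a b : measurable_fun [set: R] (beta_prime_density a b).
Proof.
apply: measurable_fun_ifT => //; first exact: measurable_fun_ltr.
apply: measurable_funM => //; apply: measurable_funM; first exact: measurable_powR.
apply: (measurableT_comp (measurable_powR _)); exact: measurable_funD.
Qed.

(** The substitution (z1, z2) = (z, z w) turns the product of two gamma densities into
    the density of the quotient w times that of the total (1 + w) z; the factors z and
    1 + w are Jacobians. *)
Let gamma_densityM a b z w : 0 < a -> 0 < b -> 0 < w ->
  gamma_density a z * (z * gamma_density b (z * w)) =
  beta_prime_density a b w * ((1 + w) * gamma_density (a + b) ((1 + w) * z)).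
Proof.
move=> a0 b0 w0; rewrite /gamma_density /beta_prime_density w0.
have := gamma_fun_gt0 a0; have := gamma_fun_gt0 b0.
have := gamma_fun_gt0 (addr_gt0 a0 b0).
move: (gamma_fun a) (gamma_fun b) (gamma_fun (a + b)) => Ga Gb Gab Gab0 Gb0 Ga0.
have w1 : 0 < 1 + w by rewrite addr_gt0.
rewrite !(pmulr_rgt0 _ w1); case: ifPn => z0; last by rewrite !(mulr0,mul0r).
rewrite mulr_gt0//.
rewrite !powRM ?ltW//.
have -> : (1 + w) `^ (- (a + b)) = ((1 + w) * (1 + w) `^ (a + b - 1))^-1.
  by rewrite powRN mulr_powRB1 ?ltW ?addr_gt0.
have -> : z `^ (a + b - 1) = z `^ (a - 1) * z * z `^ (b - 1).
  rewrite -[X in _ = _ * X * _](powRr1 (ltW z0)) -!powRD ?(gt_eqF z0) ?implybT//.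
  by congr (_ `^ _); ring.
have -> : expR (- ((1 + w) * z)) = expR (- z) * expR (- (z * w)).
  by rewrite -expRD; congr expR; ring.
have : (1 + w) `^ (a + b - 1) != 0 by rewrite gt_eqF// powR_gt0.
move: ((1 + w) `^ _) => W W0.
by field; rewrite W0 !gt_eqF.
Qed.

(** The quotient w = G2 / G1 and the total G1 + G2 are independent, and t1 G1 + t2 G2 is
    (t1 + t2 w) / (1 + w) times the total. Two weighted gamma variables thus become one
    with a random weight. *)
Lemma gamma_mean_merge t1 a t2 b F x : 0 < a -> 0 < b -> nneg_meas F ->
  gamma_mean t1 a (gamma_mean t2 b F) x =
  (\int[mu]_w ((beta_prime_density a b w)%:E * gamma_mean ((t1 + t2 * w) / (1 + w))%R (a + b) F x))%E.
Proof.
move=> a0 b0 nF; have ab0 := addr_gt0 a0 b0.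
have nG := nneg_meas_gamma_mean t2 b nF.
rewrite (gamma_meanE _ _ a0) (gamma_meanE _ _ b0).
pose K (p : measurableTypeR R * measurableTypeR R) :=
  ((gamma_density a p.1 * (p.1 * gamma_density b (p.1 * p.2)))%:E *
   F (x + (p.1 * (t1 + t2 * p.2)))%R)%E.
have K0 p : (0 <= K p)%E.
  rewrite /K mule_ge0//; last exact: nF.2.
  rewrite lee_fin; have [p0|p0] := ltP 0 p.1.
    by rewrite !mulr_ge0 ?gamma_density_ge0// ltW.
  by rewrite {1}/gamma_density ltNge p0 mul0r.
have mK : measurable_fun [set: measurableTypeR R * measurableTypeR R] K.
  have mp12 : measurable_fun [set: measurableTypeR R * measurableTypeR R]
    (fun p => p.1 * p.2 : R) by exact: measurable_funM.
  apply: emeasurable_funM.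
    apply/measurable_EFinP; apply: measurable_funM.
      exact: (measurableT_comp (measurable_gamma_density a) measurable_fst).
    apply: measurable_funM => //.
    exact: (measurableT_comp (measurable_gamma_density b) mp12).
  apply: (measurableT_comp nF.1); apply: measurable_funD => //.
  apply: measurable_funM => //; apply: measurable_funD => //.
  exact: measurable_funM.
have msc c a' t : measurable_fun [set: measurableTypeR R]
    (fun z => ((gamma_density a' (c * z))%:E * F (x + t * (c * z))%R)%E).
  have mc : measurable_fun [set: measurableTypeR R]
    ( *%R c : _ -> measurableTypeR R) by exact: measurable_funM.
  exact: (measurableT_comp (measurable_gamma_mean_integrand x t a' nF) mc).
have msc' z : measurable_fun [set: measurableTypeR R]
    (fun w => ((gamma_density b (z * w))%:E * F (x + t1 * z + t2 * (z * w))%R)%E).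
  have mc : measurable_fun [set: measurableTypeR R]
    ( *%R z : _ -> measurableTypeR R) by exact: measurable_funM.
  exact: (measurableT_comp (measurable_gamma_mean_integrand _ t2 b nF) mc).
transitivity (\int[mu]_z \int[mu]_w K (z, w))%E.
  apply: eq_integral => z _; have [z0|z0] := ltP 0 z; last first.
    rewrite [in LHS]/gamma_density ltNge z0 mul0e integral0_eq// => w _.
    by rewrite /K /gamma_density/= ltNge z0 mul0r mul0e.
  rewrite (ge0_integral_scale z0); last 2 first.
  - exact: measurable_gamma_mean_integrand.
  - by move=> y; exact: gamma_mean_integrand_ge0.
  rewrite -ge0_integralZl; last 4 first.
  - exact: measurableT.
  - exact: msc'.
  - by move=> y _; exact: gamma_mean_integrand_ge0.
  - by rewrite lee_fin ltW.
  rewrite -ge0_integralZl; last 4 first.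
  - exact: measurableT.
  - by apply: measurable_funeM; exact: msc'.
  - by move=> y _; rewrite mule_ge0 ?gamma_mean_integrand_ge0// lee_fin ltW.
  - by rewrite lee_fin gamma_density_ge0.
  apply: eq_integral => w _; rewrite /K/= !EFinM !muleA; congr (_ * F _)%E.
  by rewrite mulrDr [in RHS]addrA (mulrC z t1) mulrCA.
rewrite (fubini_tonelli K)//.
apply: eq_integral => w _; have [w0|w0] := ltP 0 w; last first.
  rewrite /beta_prime_density ltNge w0 mul0e integral0_eq// => z _; rewrite /K/=.
  rewrite /gamma_density; case: ifPn => z0; last by rewrite mul0r mul0e.
  by rewrite pmulr_rgt0// ltNge w0/= !mulr0 mul0e.
have w1 : 0 < 1 + w by rewrite addr_gt0.
rewrite (gamma_meanE _ _ ab0) (ge0_integral_scale w1); last 2 first.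
- exact: measurable_gamma_mean_integrand.
- by move=> y; exact: gamma_mean_integrand_ge0.
rewrite -ge0_integralZl; last 4 first.
- exact: measurableT.
- exact: msc.
- by move=> y _; exact: gamma_mean_integrand_ge0.
- by rewrite lee_fin ltW.
rewrite -ge0_integralZl; last 4 first.
- exact: measurableT.
- by apply: measurable_funeM; exact: msc.
- by move=> y _; rewrite mule_ge0 ?gamma_mean_integrand_ge0// lee_fin ltW.
- by rewrite lee_fin beta_prime_density_ge0.
apply: eq_integral => z _; rewrite /K/= gamma_densityM// !EFinM !muleA; congr (_ * F _)%E.
by rewrite mulrA divfK ?gt_eqF// mulrC.
Qed.

(** This is the merging identity for a constant function. *)
Lemma integral_beta_prime_density a b : 0 < a -> 0 < b ->
  (\int[mu]_w (beta_prime_density a b w)%:E = 1)%E.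
Proof.
move=> a0 b0.
have := @gamma_mean_merge 0 a 0 b (cst 1%E) 0 a0 b0 (nneg_meas_cst ler01).
rewrite !gamma_mean_cst// => /= E; rewrite [RHS]E; apply: eq_integral => w _.
by rewrite gamma_mean_cst// mule1.
Qed.

(** With equal weights, the merged weight (t + t w) / (1 + w) is t again. *)
Lemma gamma_mean_split t a b F : 0 <= a -> 0 <= b -> nneg_meas F ->
  gamma_mean t a (gamma_mean t b F) = gamma_mean t (a + b) F.
Proof.
rewrite !le_eqVlt => /predU1P[<- _ nF|a0]; first by rewrite gamma_mean0 add0r.
move=> /predU1P[<- nF|b0 nF]; first by rewrite gamma_mean0 addr0.
apply/funext => x; rewrite gamma_mean_merge//.
transitivity (\int[mu]_w ((beta_prime_density a b w)%:E * gamma_mean t (a + b) F x))%E.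
  apply: eq_integral => w _; rewrite /beta_prime_density; case: ifPn => w0; last by rewrite !mul0e.
  have w1 : 0 < 1 + w by rewrite addr_gt0.
  by rewrite (_ : (t + t * w) / (1 + w) = t)//; field; rewrite gt_eqF.
rewrite ge0_integralZr; last 4 first.
- exact: measurableT.
- by apply: measurable_EFinS; exact: measurable_beta_prime_density.
- by move=> w _; rewrite lee_fin beta_prime_density_ge0.
- exact: (nneg_meas_gamma_mean _ _ nF).2.
by rewrite integral_beta_prime_density// mul1e.
Qed.

Lemma nneg_meas_expR c : nneg_meas (fun x => (expR (c * x))%:E).
Proof.
split => [|x]; last by rewrite lee_fin expR_ge0.
apply/measurable_EFinP; apply: measurableT_comp => //; exact: measurable_funM.
Qed.

(** The Laplace transform: multiplying the gamma density by an exponential amounts to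
    a dilation. *)
Lemma gamma_mean_expR c t a x : 0 <= a -> c * t < 1 ->
  gamma_mean t a (fun x => (expR (c * x))%:E) x =
  (expR (c * x) * (1 - c * t) `^ (- a))%:E.
Proof.
rewrite le_eqVlt => /predU1P[<- _|a0 ct]; first by rewrite gamma_mean0 oppr0 powRr0 mulr1.
have d0 : 0 < 1 - c * t by rewrite subr_gt0.
rewrite (gamma_meanE _ _ a0).
transitivity (\int[mu]_z ((expR (c * x) * (1 - c * t) `^ (- a) *
  (1 - c * t))%:E * (gamma_density a ((1 - c * t) * z))%:E))%E.
  apply: eq_integral => z _; rewrite -!EFinM; congr EFin.
  rewrite /gamma_density pmulr_rgt0//; case: ifPn => z0; last by rewrite mul0r mulr0.
  rewrite powRM ?ltW// powRN.
  have -> : (1 - c * t) `^ a = (1 - c * t) * (1 - c * t) `^ (a - 1).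
    by rewrite mulr_powRB1 ?ltW.
  have -> : expR (c * (x + t * z)) = expR (c * x) * expR (c * t * z).
    by rewrite -expRD; congr expR; ring.
  have -> : expR (- ((1 - c * t) * z)) = expR (- z) * expR (c * t * z).
    by rewrite -expRD; congr expR; ring.
  have : (1 - c * t) `^ (a - 1) != 0 by rewrite gt_eqF// powR_gt0.
  move: ((1 - c * t) `^ (a - 1)) => W W0.
  field. rewrite W0 !gt_eqF ?gamma_fun_gt0//.
rewrite ge0_integralZl; last 4 first.
- exact: measurableT.
- apply: measurable_EFinS; apply: (measurableT_comp (measurable_gamma_density a)).
  exact: measurable_funM.
- by move=> y _; rewrite lee_fin gamma_density_ge0.
- by rewrite lee_fin !mulr_ge0 ?expR_ge0 ?powR_ge0 ?ltW.
rewrite EFinM -muleA -(ge0_integral_scale (F := fun z => (gamma_density a z)%:E))//.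
- by rewrite integral_gamma_density// mule1.
- by apply/measurable_EFinP; exact: measurable_gamma_density.
- by move=> z; rewrite lee_fin gamma_density_ge0.
Qed.

End GammaBeta.

(** * Merging families of gamma variables *)

Section GammaSums.
Context {R : realType}.
Local Notation mu := (@lebesgue_measure R).
Implicit Types (F H : R -> \bar R) (a b c t x w : R) (l : seq (R * R)).

(** The pairs in l are (weight, shape). *)
Definition gamma_means l F := foldr (fun p => gamma_mean p.1 p.2) F l.

Lemma nneg_meas_gamma_means l F : nneg_meas F -> nneg_meas (gamma_means l F).
Proof. by move=> nF; elim: l => //= p l ih; exact: nneg_meas_gamma_mean. Qed.

Lemma gamma_means_cat l1 l2 F : gamma_means (l1 ++ l2) F = gamma_means l1 (gamma_means l2 F).
Proof. by rewrite /gamma_means foldr_cat. Qed.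

Lemma gamma_mean_gamma_meansC t a l F : nneg_meas F ->
  gamma_mean t a (gamma_means l F) = gamma_means l (gamma_mean t a F).
Proof.
move=> nF; elim: l => //= p l <-.
by rewrite gamma_mean_comm//; exact: nneg_meas_gamma_means.
Qed.

Lemma le_gamma_means l F H x : nneg_meas F -> nneg_meas H -> (forall y, F y <= H y)%E ->
  (gamma_means l F x <= gamma_means l H x)%E.
Proof.
move=> nF nH FH; elim: l x => //= p l ih x.
by apply: le_gamma_mean => //; exact: nneg_meas_gamma_means.
Qed.

Lemma gamma_means_filter_pos l F : gamma_means [seq p <- l | 0 < p.2] F = gamma_means l F.
Proof.
by elim: l => //= p l <-; case: ifPn => //= p0; rewrite gamma_mean_id.
Qed.

Lemma measurable_gamma_mean_scale (T : R -> R) a F x : nneg_meas F ->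
  measurable_fun [set: R] T ->
  measurable_fun [set: measurableTypeR R] (fun w => gamma_mean (T w) a F x).
Proof.
move=> nF mT; have [a0|a0] := boolP (0 < a); last first.
  by under eq_fun do rewrite (gamma_mean_id _ _ a0); exact: measurable_cst.
under eq_fun do rewrite (gamma_meanE _ _ a0).
apply: (measurable_fun_fubini_tonelli_F (m2 := mu)
  (fun p : measurableTypeR R * measurableTypeR R =>
    ((gamma_density a p.2)%:E * F (x + T p.1 * p.2)%R)%E)) => [|p].
  apply: emeasurable_funM.
    apply/measurable_EFinP.
    exact: (measurableT_comp (measurable_gamma_density a) measurable_snd).
  apply: (measurableT_comp nF.1); apply: measurable_funD => //.
  apply: measurable_funM => //; exact: (measurableT_comp mT measurable_fst).
by rewrite mule_ge0 ?lee_fin ?gamma_density_ge0//; exact: nF.2.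
Qed.

Lemma measurable_invr : measurable_fun [set: R] (fun x => x^-1).
Proof.
rewrite (_ : (fun x => x^-1) = (fun x => x * (x ^+ 2) `^ (-1))).
  apply: measurable_funM => //.
  by apply: (measurableT_comp (measurable_powR _)); exact: measurable_funX.
apply/funext => x; rewrite powR_inv1 ?sqr_ge0//.
by have [->|x0] := eqVneq x 0; [rewrite invr0 mul0r|field].
Qed.

Lemma measurable_mobius t1 t2 :
  measurable_fun [set: R] (fun w => (t1 + t2 * w) / (1 + w)).
Proof.
apply: measurable_funM.
  by apply: measurable_funD => //; exact: measurable_funM.
apply: (measurableT_comp measurable_invr); exact: measurable_funD.
Qed.

Let convex_comb lo hi t1 t2 w : 0 < w -> lo <= t1 <= hi -> lo <= t2 <= hi ->
  lo <= (t1 + t2 * w) / (1 + w) <= hi.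
Proof.
move=> w0 /andP[lo1 hi1] /andP[lo2 hi2].
have w1 : 0 < 1 + w by rewrite addr_gt0.
rewrite ler_pdivlMr// ler_pdivrMr// !mulrDr !mulr1.
by rewrite !lerD// ler_wpM2r// ltW.
Qed.

(** Induction on l: merging the first two variables replaces them by one of random
    weight T w in [lo, hi], and no loss occurs because the mean over w of
    (1 - c (T w))^(- (p.2 + q.2)) is exactly the product of the two factors; this is the
    merging identity for an exponential function. *)
Lemma gamma_means_merge_le lo hi c K l F x : nneg_meas F -> 0 <= K ->
  (forall t, lo <= t <= hi -> c * t < 1) ->
  (forall p, p \in l -> 0 < p.2 /\ lo <= p.1 <= hi) -> l != [::] ->
  (forall t, lo <= t <= hi ->
     (gamma_mean t (\sum_(p <- l) p.2) F x <=
      (K * (1 - c * t) `^ (- \sum_(p <- l) p.2))%:E)%E) ->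
  (gamma_means l F x <= (K * \prod_(p <- l) (1 - c * p.1) `^ (- p.2))%:E)%E.
Proof.
move=> nF K0 hc; case: l => // p l hl _.
elim: l p hl => [|q l ih] p hl H.
  have /hl[p0 hp] : p \in [:: p] by rewrite mem_seq1.
  by have := H _ hp; rewrite !big_seq1.
have /hl[p0 hp] : p \in [:: p, q & l] by rewrite mem_head.
have /hl[q0 hq] : q \in [:: p, q & l] by rewrite !inE eqxx orbT.
have pq0 : 0 < p.2 + q.2 by rewrite addr_gt0.
pose T w := (p.1 + q.1 * w) / (1 + w).
pose P := \prod_(r <- l) (1 - c * r.1) `^ (- r.2).
have P0 : 0 <= P by apply: prodr_ge0 => r _; exact: powR_ge0.
rewrite -[gamma_means _ _]/(gamma_mean p.1 p.2 (gamma_mean q.1 q.2 (gamma_means l F))).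
have nl := nneg_meas_gamma_means l nF.
rewrite gamma_mean_merge//.
have E : (\int[mu]_w ((beta_prime_density p.2 q.2 w)%:E * ((1 - c * T w) `^ (- (p.2 + q.2)))%:E) =
   ((1 - c * p.1) `^ (- p.2) * (1 - c * q.1) `^ (- q.2))%:E)%E.
  transitivity (gamma_mean p.1 p.2 (gamma_mean q.1 q.2 (fun x => (expR (c * x))%:E)) 0).
    rewrite gamma_mean_merge//; last exact: nneg_meas_expR.
    apply: eq_integral => w _; rewrite /beta_prime_density; case: ifPn => w0; last by rewrite !mul0e.
    rewrite gamma_mean_expR ?ltW//; last by apply: hc; exact: convex_comb.
    by rewrite mulr0 expR0 mul1r.
  rewrite (_ : gamma_mean q.1 q.2 _ =
    fun x => (((1 - c * q.1) `^ (- q.2))%:E * (expR (c * x))%:E)%E); last first.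
    apply/funext => y; rewrite gamma_mean_expR ?ltW//; last exact: hc.
    by rewrite -EFinM mulrC.
  rewrite gamma_meanZ ?powR_ge0//; last exact: nneg_meas_expR.
  rewrite gamma_mean_expR ?ltW//; last exact: hc.
  by rewrite mulr0 expR0 mul1r -EFinM mulrC.
rewrite !big_cons -/P [X in (K * X)%R](_ : _ =
  P * ((1 - c * p.1) `^ (- p.2) * (1 - c * q.1) `^ (- q.2))); last by ring.
rewrite [X in (_ <= X%:E)%E]mulrA [X in (_ <= X)%E]EFinM -E -ge0_integralZl;
  last 4 first.
- exact: measurableT.
- apply: emeasurable_funM.
    by apply: measurable_EFinS; exact: measurable_beta_prime_density.
  apply: measurable_EFinS; apply: (measurableT_comp (measurable_powR _)).
  apply: measurable_funB => //; apply: measurable_funM => //.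
  exact: measurable_mobius.
- by move=> w _; rewrite mule_ge0// lee_fin ?beta_prime_density_ge0 ?powR_ge0.
- by rewrite lee_fin mulr_ge0.
apply: ge0_le_integral => //.
- move=> w _; rewrite mule_ge0 ?lee_fin ?beta_prime_density_ge0//.
  exact: (nneg_meas_gamma_mean _ _ nl).2.
- apply: emeasurable_funM.
    by apply: measurable_EFinS; exact: measurable_beta_prime_density.
  apply: measurable_gamma_mean_scale => //; exact: measurable_mobius.
- apply: measurable_funeM; apply: emeasurable_funM.
    by apply: measurable_EFinS; exact: measurable_beta_prime_density.
  apply: measurable_EFinS; apply: (measurableT_comp (measurable_powR _)).
  apply: measurable_funB => //; apply: measurable_funM => //.
  exact: measurable_mobius.
- move=> w _; rewrite muleCA /beta_prime_density; case: ifPn => w0; last by rewrite !mul0e.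
  rewrite lee_wpmul2l//.
    by have := beta_prime_density_ge0 w p0 q0; rewrite /beta_prime_density w0 lee_fin.
  rewrite -EFinM.
  have := ih (T w, p.2 + q.2); rewrite !big_cons/= -/P.
  rewrite -mulrA [P * _]mulrC; apply.
    move=> r; rewrite inE => /orP[/eqP->/=|rl]; last first.
      by apply: hl; rewrite !inE rl !orbT.
    by split => //; exact: convex_comb.
  by move=> t ht; have := H t ht; rewrite !big_cons !addrA.
Qed.

End GammaSums.

(** * An estimate for the beta prime distribution *)

Section BetaTail.
Context {R : realType}.
Local Notation mu := (@lebesgue_measure R).
Implicit Types (a b c m t x w y : R).

Lemma is_derive_nondecreasing (f df : R -> R) lo hi : 0 < lo <= hi ->
  (forall x, 0 < x -> is_derive x 1 f (df x)) ->
  (forall x, lo < x < hi -> 0 <= df x) -> f lo <= f hi.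
Proof.
move=> /andP[lo0 lohi] dfE df0.
have pos x : lo <= x -> 0 < x by exact: lt_le_trans.
apply: (@ger0_derive1_le_cc _ f lo hi) => //.
- move=> x; rewrite in_itv/= => /andP[x0 _].
  by apply: ex_derive; apply: dfE; exact/pos/ltW.
- move=> x; rewrite in_itv/= => x0; rewrite derive1E.
  have xp : 0 < x by case/andP: x0 => x0 _; exact/pos/ltW.
  by rewrite (@derive_val _ _ _ _ _ _ _ (dfE _ xp)) df0.
- apply: continuous_in_subspaceT => x; rewrite inE/= in_itv/= => /andP[x0 _].
  apply: differentiable_continuous; apply/derivable1_diffP.
  by apply: ex_derive; apply: dfE; exact/pos.
- by rewrite in_itv/= lexx.
- by rewrite in_itv/= lexx andbT.
Qed.

Definition beta_prime_cdf a b y : R := (\int[mu]_(w in `[0, y]) beta_prime_density a b w).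

(** The comparison function for [beta_prime_cdf], with y the quotient of the two weights. Its
    derivative is [beta_prime_density] times phi / kap, so the comparison rests on monotonicity
    properties of phi. *)
Let Nfun a b m y := y `^ b * (1 + y) `^ (- (a + b - m)).
Let phi a b m y := (1 + y) `^ (m - 1) * (b - (a - m) * y).
Let kap a b : R := gamma_fun (a + b) / (gamma_fun a * gamma_fun b).

Let kap_gt0 a b : 0 < a -> 0 < b -> 0 < kap a b.
Proof.
by move=> a0 b0; rewrite divr_gt0 ?mulr_gt0 ?gamma_fun_gt0// addr_gt0.
Qed.

Let is_derive_powR1 s y : 0 < 1 + y ->
  is_derive y 1 (fun z => (1 + z) `^ s) (s * (1 + y) `^ (s - 1)).
Proof.
move=> y1.
have d1 : is_derive y 1 (fun z : R => 1 + z) 1.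
  by have := is_deriveD (is_derive_cst (1 : R) y 1) (is_derive_id y 1); rewrite add0r.
by have := is_derive1_comp (is_derive1_powR s y1) d1; rewrite mulr1.
Qed.

Let is_derive_Nfun a b m y : 0 < a -> 0 < b -> 0 < y ->
  is_derive y 1 (Nfun a b m) (beta_prime_density a b y * phi a b m y / kap a b).
Proof.
move=> a0 b0 y0; have y1 : 0 < 1 + y by rewrite addr_gt0.
have := is_deriveM (is_derive1_powR b y0) (is_derive_powR1 (- (a + b - m)) y1).
rewrite -/(Nfun a b m) => /is_derive_eq; apply.
rewrite /beta_prime_density y0 -/(kap a b) /phi [in RHS]mulrAC mulfK ?gt_eqF ?kap_gt0//.
rewrite -(@mulr_powRB1 _ y b) ?ltW//.
have -> : - (a + b - m) - 1 = - (a + b) + (m - 1) by ring.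
have -> : - (a + b - m) = - (a + b) + (m - 1) + 1 by ring.
have E s r : (1 + y) `^ (s + r) = (1 + y) `^ s * (1 + y) `^ r.
  by rewrite powRD// (gt_eqF y1) implybT.
rewrite [_ `^ (_ + 1)]E powRr1 ?ltW// !E /GRing.scale/=; ring.
Qed.

Let integrable_beta_prime_density a b : 0 < a -> 0 < b ->
  mu.-integrable [set: R] (EFin \o beta_prime_density a b).
Proof.
move=> a0 b0; apply/integrableP; split.
  by apply: measurable_EFinS; exact: measurable_beta_prime_density.
under eq_integral do rewrite /= ger0_norm ?beta_prime_density_ge0//.
by rewrite integral_beta_prime_density// ltry.
Qed.

Let is_derive_beta_prime_cdf a b y : 0 < a -> 0 < b -> 0 < y ->
  is_derive y 1 (beta_prime_cdf a b) (beta_prime_density a b y).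
Proof.
move=> a0 b0 y0.
have cb : {for y, continuous (beta_prime_density a b)}.
  have c1 : {for y, continuous (fun w => w `^ (b - 1) * (1 + w) `^ (- (a + b)) * kap a b)}.
    have y1 : 0 < 1 + y by rewrite addr_gt0.
    apply: differentiable_continuous; apply/derivable1_diffP.
    apply: derivableM => //; apply: derivableM.
      by apply: ex_derive; exact: is_derive1_powR.
    by apply: ex_derive; exact: is_derive_powR1.
  rewrite /prop_for /continuous_at.
  have -> : beta_prime_density a b y = y `^ (b - 1) * (1 + y) `^ (- (a + b)) * kap a b.
    by rewrite /beta_prime_density y0.
  apply: cvg_trans c1; apply: near_eq_cvg; near=> z.
  by rewrite /beta_prime_density (_ : 0 < z)//; near: z; exact: lt_nbhsr.
have [||d1 d2] := @continuous_FTC1_closed R (beta_prime_density a b) 0 y (y + 1) _ _ y0 cb.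
- by rewrite ltrDl.
- by apply: integrableS (integrable_beta_prime_density a0 b0).
by apply: DeriveDef; [exact: d1|rewrite -derive1E; exact: d2].
Unshelve. all: by end_near. Qed.

Let beta_prime_cdf_ge0 a b y : 0 < a -> 0 < b -> 0 <= beta_prime_cdf a b y.
Proof. by move=> a0 b0; apply: Rintegral_ge0 => x _; exact: beta_prime_density_ge0. Qed.

Lemma EFin_beta_prime_cdf a b y : 0 < a -> 0 < b ->
  (\int[mu]_(w in `[0%R, y]) (beta_prime_density a b w)%:E = (beta_prime_cdf a b y)%:E)%E.
Proof.
move=> a0 b0; rewrite /beta_prime_cdf /Rintegral fineK//.
apply: integrable_fin_num => //.
by apply: integrableS (integrable_beta_prime_density a0 b0).
Qed.

Let beta_prime_cdf_le1 a b y : 0 < a -> 0 < b -> beta_prime_cdf a b y <= 1.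
Proof.
move=> a0 b0; rewrite -lee_fin -EFin_beta_prime_cdf// -(integral_beta_prime_density a0 b0).
apply: ge0_subset_integral => //.
- by apply: measurable_EFinS; exact: measurable_beta_prime_density.
- by move=> x _; rewrite lee_fin beta_prime_density_ge0.
Qed.

(** The derivative of the difference of the two sides is a nonnegative multiple of
    phi y - phi w for y < w, and the cdf vanishes at 0. The comparison starts at e > 0,
    with e sent to 0, since the functions need not be differentiable at 0. *)
Let beta_prime_cdf_le_Nfun a b m w : 0 < a -> 0 < b -> 0 < w ->
  (forall y, 0 < y < w -> phi a b m w <= phi a b m y) ->
  phi a b m w * beta_prime_cdf a b w <= kap a b * Nfun a b m w.
Proof.
move=> a0 b0 w0 H; have k0 := kap_gt0 a0 b0.
have N0 y : 0 <= Nfun a b m y by rewrite mulr_ge0 ?powR_ge0.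
have [p0|p0] := leP (phi a b m w) 0.
  rewrite (le_trans (y := 0))//; first by rewrite mulr_le0_ge0 ?beta_prime_cdf_ge0.
  by rewrite mulr_ge0// ltW.
pose D y := kap a b * Nfun a b m y - phi a b m w * beta_prime_cdf a b y.
have H1 e : 0 < e <= w -> - (phi a b m w * beta_prime_cdf a b e) <= D w.
  move=> ew; apply: (@le_trans _ _ (D e)).
    by rewrite /D lerDr mulr_ge0// ltW.
  apply: (@is_derive_nondecreasing D
    (fun y => beta_prime_density a b y * (phi a b m y - phi a b m w))) => // [x x0|x /andP[ex xw]].
    have := is_deriveB (is_deriveZ (kap a b) (is_derive_Nfun m a0 b0 x0))
                       (is_deriveZ (phi a b m w) (is_derive_beta_prime_cdf a0 b0 x0)).
    move=> /is_derive_eq; apply; rewrite /GRing.scale/=.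
    by field; rewrite gt_eqF.
  case/andP: ew => e0 _.
  by rewrite mulr_ge0 ?beta_prime_density_ge0// subr_ge0 H// xw (lt_trans e0).
rewrite -subr_ge0 -/(D w); apply/ler_addgt0Pl => e e0.
have : (phi a b m w * beta_prime_cdf a b x) @[x --> (0:R)] --> (phi a b m w * 0).
  apply: cvgMr.
  apply: (@parameterized_integral_cvg_left _ 0 w _ w0).
  by apply: integrableS (integrable_beta_prime_density a0 b0).
rewrite mulr0 => /cvgrPdist_le/(_ _ e0) [r /= r0 hr].
pose z := Num.min w (r / 2).
have z0 : 0 < z by rewrite lt_min w0 divr_gt0.
have zr : z < r.
  by rewrite (@le_lt_trans _ _ (r / 2)) ?ge_min ?lexx ?orbT// ltr_pdivrMr// ltr_pMr// ltr1n.
have := hr z; rewrite /ball_/= !sub0r !normrN gtr0_norm// => /(_ zr).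
rewrite ger0_norm; last by apply: mulr_ge0; [exact: ltW|exact: beta_prime_cdf_ge0].
move=> h.
have := @H1 z; rewrite z0 ge_min lexx => /(_ isT); lra.
Qed.

(** The quotient of the cdf by Nfun has a nonnegative derivative to the right of w, by
    the comparison at every such point, and the cdf is at most 1. *)
Lemma beta_prime_cdf_ratio_le a b m w v : 0 < a -> 0 < b -> 0 < w <= v ->
  (forall x y, w <= x -> 0 < y < x -> phi a b m x <= phi a b m y) ->
  beta_prime_cdf a b w * Nfun a b m v <= Nfun a b m w.
Proof.
move=> a0 b0 /andP[w0 wv] H; have k0 := kap_gt0 a0 b0.
have N0 y : 0 < y -> 0 < Nfun a b m y.
  by move=> y0; rewrite mulr_gt0 ?powR_gt0// addr_gt0.
pose Q y := beta_prime_cdf a b y / Nfun a b m y.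
have : Q w <= Q v.
  apply: (@is_derive_nondecreasing Q (fun y => beta_prime_density a b y / Nfun a b m y ^+ 2 / kap a b *
     (kap a b * Nfun a b m y - phi a b m y * beta_prime_cdf a b y))).
  - by rewrite w0.
  - move=> x x0; have Nx := N0 _ x0.
    have := is_deriveM (is_derive_beta_prime_cdf a0 b0 x0)
      (is_deriveV (lt0r_neq0 Nx) (is_derive_Nfun m a0 b0 x0)).
    move=> /is_derive_eq; apply; rewrite /GRing.scale/=.
    by field; rewrite !gt_eqF.
  - move=> x /andP[wx xv]; have x0 : 0 < x by exact: lt_trans wx.
    have Nx := N0 _ x0.
    apply: mulr_ge0.
      apply: divr_ge0 (ltW k0); apply: divr_ge0 (sqr_ge0 _).
      exact: beta_prime_density_ge0.
    by rewrite subr_ge0 beta_prime_cdf_le_Nfun// => y yx; apply: H => //; exact: ltW.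
rewrite /Q ler_pdivrMr ?N0// => h.
have v0 : 0 < v by exact: lt_le_trans wv.
rewrite -ler_pdivlMr ?N0// (le_trans h)// mulrC ler_wpM2l ?(ltW (N0 _ _))//.
rewrite -[leRHS]mul1r ler_wpM2r ?invr_ge0 ?(ltW (N0 _ _))//.
exact: beta_prime_cdf_le1.
Qed.

Lemma powR_convexP m s x y : 1 <= m -> 0 <= s <= 1 -> 0 <= x -> 0 <= y ->
  (s * x + (1 - s) * y) `^ m <= s * x `^ m + (1 - s) * y `^ m.
Proof.
move=> m1 /andP[s0 s1] x0 y0.
have := @convex_powR R m m1 (Itv01 s0 s1) x y.
by rewrite !convRE/=; apply; rewrite inE/= in_itv/= andbT.
Qed.

(** For v = 1 / (1 + w), this is the inequality phi w <= phi 0 = b. *)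
Definition tail_cond a b m v := b * (v - v `^ m) <= (a - m) * (1 - v).

(** For m > 1, the left-hand side is concave in v and vanishes at 1, where the
    right-hand side, which is affine, vanishes too; so the quotient of the left-hand
    side by 1 - v is nondecreasing. For m <= 1, the left-hand side is nonpositive. *)
Lemma tail_cond_le a b m v x : 0 < b -> m <= a ->
  v < 1 -> 0 < x <= v -> tail_cond a b m v -> tail_cond a b m x.
Proof.
move=> b0 ma v1 /andP[x0 xv] cv; rewrite /tail_cond.
have x1 : x < 1 by exact: le_lt_trans v1.
have [m1|m1] := leP m 1.
  rewrite (le_trans (y := 0))//; last by rewrite mulr_ge0 ?subr_ge0// ltW.
  rewrite pmulr_rle0// subr_le0.
  by rewrite ger1_powR// x0 ltW.
pose s := (1 - v) / (1 - x).
have s01 : 0 <= s <= 1.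
  by rewrite /s divr_ge0 ?subr_ge0 ?(ltW x1) ?(ltW v1)//= ler_pdivrMr ?subr_gt0// mul1r lerB.
have s0 : 0 < s by rewrite divr_gt0 ?subr_gt0.
have vE : v = s * x + (1 - s) * 1 by rewrite /s; field; rewrite subr_eq0 gt_eqF.
have := @powR_convexP m s x 1 (ltW m1) s01 (ltW x0) ler01; rewrite -vE powR1 mulr1.
move: cv; rewrite /tail_cond; move: (x `^ m) (v `^ m) => X V cv XV.
rewrite -(ler_pM2l s0).
have : b * (s * (x - X)) <= b * (v - V).
  by rewrite ler_pM2l// [in leRHS]vE; lra.
have -> : s * ((a - m) * (1 - x)) = (a - m) * (1 - v) by rewrite vE; ring.
rewrite (mulrCA s); lra.
Qed.

(** In the variable Z = 1 / (1 + y), phi is Z^(-m) times the affine function L, and phi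
    has to be shown nondecreasing in Z. For m <= 1 both terms of the product, expanded
    in powers of Z, are. For m > 1, Y is a barycentre of X and 1; convexity of the power
    m bounds Y^m from above, and L X <= b X^m, which is the condition at X, compares the
    remaining terms. *)
Lemma phi_le a b m w : 0 < b -> 0 <= m <= a -> 0 < w ->
  (forall v, 0 < v <= (1 + w)^-1 -> tail_cond a b m v) ->
  forall x y, w <= x -> 0 < y < x -> phi a b m x <= phi a b m y.
Proof.
move=> b0 /andP[m0 ma] w0 H x y wx /andP[y0 yx].
have x0 : 0 < x by exact: lt_trans yx.
have x1 : 0 < 1 + x by rewrite addr_gt0.
have y1 : 0 < 1 + y by rewrite addr_gt0.
pose X := (1 + x)^-1; pose Y := (1 + y)^-1.
have X0 : 0 < X by rewrite invr_gt0.
have Y0 : 0 < Y by rewrite invr_gt0.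
have XY : X < Y by rewrite ltf_pV2 ?posrE// ltrD2l.
have Y1 : Y < 1 by rewrite invf_lt1// ltrDl.
pose L Z := b * Z - (a - m) * (1 - Z).
have phiE z : 0 < 1 + z -> phi a b m z = (1 + z)^-1 `^ (- m) * L (1 + z)^-1.
  move=> z1; rewrite -{1}(powR_inv1 (ltW z1)) -powRrM mulN1r opprK.
  have -> : (1 + z) `^ m = (1 + z) * (1 + z) `^ (m - 1).
    rewrite -{2}(powRr1 (ltW z1)) -powRD; first by congr (_ `^ _); ring.
    by rewrite (gt_eqF z1) implybT.
  by rewrite /phi /L; field; rewrite gt_eqF.
rewrite !phiE// -/X -/Y.
have cX : tail_cond a b m X.
  by apply: H; rewrite X0 lef_pV2 ?posrE ?lerD2l// addr_gt0.
have [m1|m1] := leP m 1.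
  have E Z : 0 < Z -> Z `^ (- m) * L Z = (b + a - m) * Z `^ (1 - m) - (a - m) * Z `^ (- m).
    move=> Z0; rewrite powRD ?(gt_eqF Z0) ?implybT// powRr1 ?ltW// /L; ring.
  rewrite !E//; apply: lerB.
    rewrite ler_wpM2l//; first by lra.
    by apply: ge0_ler_powR; rewrite ?nnegrE ?subr_ge0 ?(ltW X0) ?(ltW Y0) ?(ltW XY).
  rewrite ler_wpM2l ?subr_ge0// !powRN lef_pV2 ?posrE ?powR_gt0//.
  by apply: ge0_ler_powR; rewrite ?nnegrE ?(ltW X0) ?(ltW Y0) ?(ltW XY).
have Xm0 : 0 < X `^ m by rewrite powR_gt0.
have Ym0 : 0 < Y `^ m by rewrite powR_gt0.
rewrite !powRN mulrC [leRHS]mulrC ler_pdivlMr// mulrAC.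
have XmYm : X `^ m <= Y `^ m.
  by apply: ge0_ler_powR; rewrite ?nnegrE ?(ltW X0) ?(ltW Y0) ?(ltW XY).
have [K0|K0] := leP (L X) 0.
  rewrite (le_trans (y := L X))//; last first.
    by rewrite /L lerB// ?ler_wpM2l ?subr_ge0 ?(ltW b0) ?(ltW XY)// lerB// ltW.
  rewrite ler_pdivrMr//.
  by rewrite ler_wnM2l.
have LXb : L X <= b * X `^ m by move: cX; rewrite /tail_cond /L; lra.
have X1 : X < 1 by exact: lt_trans Y1.
pose s := (1 - Y) / (1 - X).
have s01 : 0 <= s <= 1.
  by rewrite /s divr_ge0 ?subr_ge0 ?(ltW X1) ?(ltW Y1)//= ler_pdivrMr ?subr_gt0// mul1r lerB// ltW.
have YE : Y = s * X + (1 - s) * 1 by rewrite /s; field; rewrite subr_eq0 gt_eqF.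
have := @powR_convexP m s X 1 (ltW m1) s01 (ltW X0) ler01; rewrite -YE powR1 mulr1 => YmX.
rewrite ler_pdivrMr// (le_trans (ler_wpM2l (ltW K0) YmX))//.
have -> : L Y = s * L X + (1 - s) * b by rewrite /L YE; ring.
have := ler_wpM2l _ LXb; move=> /(_ (1 - s)); rewrite subr_ge0.
by case/andP: s01 => _ -> /(_ isT); lra.
Qed.

(** This is the bound by Nfun w / Nfun v at v = w B / A, where that quotient is the
    product on the right-hand side. *)
Lemma beta_prime_cdf_le a b m w A B : 0 < a -> 0 < b -> 0 <= m <= a -> 0 < w ->
  (forall v, 0 < v <= (1 + w)^-1 -> tail_cond a b m v) ->
  0 < A -> A <= B -> A + w * B = 1 + w ->
  beta_prime_cdf a b w <= A `^ (- (a - m)) * B `^ (- b).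
Proof.
move=> a0 b0 ma w0 H A0 AB AwB.
have B0 : 0 < B by exact: lt_le_trans AB.
pose v := w * B / A.
have v0 : 0 < v by rewrite divr_gt0// mulr_gt0.
have wv : w <= v by rewrite ler_pdivlMr// ler_pM2l.
have v1 : 1 + v = (1 + w) / A by rewrite /v -AwB; field; rewrite gt_eqF.
have w1 : 0 < 1 + w by rewrite addr_gt0.
have := @beta_prime_cdf_ratio_le a b m w v a0 b0; rewrite w0 wv => /(_ isT (phi_le b0 ma w0 H)).
have -> : Nfun a b m v = Nfun a b m w * (A `^ (a - m) * B `^ b).
  rewrite /Nfun v1 !powRM ?invr_ge0 ?mulr_ge0 ?(ltW w0) ?(ltW B0) ?(ltW A0) ?(ltW w1)//.
  have AE s : A^-1 `^ s = A `^ (- s).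
    by rewrite -(powR_inv1 (ltW A0)) -powRrM mulN1r.
  rewrite !AE opprK.
  have -> : A `^ (a + b - m) = A `^ b * A `^ (a - m).
    by rewrite -powRD; [congr (_ `^ _); ring|rewrite (gt_eqF A0) implybT].
  by rewrite (powRN A b); field; rewrite gt_eqF// powR_gt0.
have N0 : 0 < Nfun a b m w by rewrite mulr_gt0 ?powR_gt0.
rewrite mulrCA -[leRHS]mulr1 ler_pM2l// => h.
rewrite !powRN -invfM -[_^-1]mul1r ler_pdivlMr//.
by rewrite mulr_gt0 ?powR_gt0.
Qed.

End BetaTail.

(** * The function S *)

Section SCondition.
Context {R : realType}.
Implicit Types (a b c m t x w y v : R).

(** Any solution w >= -1 would do: on nonnegative x one exists in [0, x] by the
    intermediate value theorem. *)
Lemma lambertW0E x : 0 <= x -> lambertW0 x * expR (lambertW0 x) = x.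
Proof.
move=> x0; suff [w [w0 wE]] : exists w, -1 <= w /\ w * expR w = x.
  by rewrite /lambertW0; case: xgetP => [w' _ []//|/(_ w)]; case.
have cf : {within `[0, x], continuous (fun w => w * expR w)}.
  apply: continuous_subspaceT => w; apply: (@continuousM _ _ id) => //.
  exact: continuous_expR.
have : Num.min (0 * expR 0) (x * expR x) <= x <= Num.max (0 * expR 0) (x * expR x).
  rewrite mul0r min_l ?max_r ?mulr_ge0 ?expR_ge0// x0/=.
  by rewrite ler_peMr// -[leLHS]expR0 ler_expR.
case/(IVT x0 cf) => w; rewrite in_itv/= => /andP[w0 _] wE.
by exists w; split => //; rewrite (le_trans _ w0)// lerN10.
Qed.

(** Young's inequality for x and 1 with exponents m and m / (m - 1). *)
Lemma bernoulli_powR m x : 1 < m -> 0 <= x -> 1 + m * (x - 1) <= x `^ m.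
Proof.
move=> m1 x0; have m0 : 0 < m by exact: lt_trans m1.
have q0 : 0 < m / (m - 1) by rewrite divr_gt0// subr_gt0.
have := @conjugate_powR R x 1 m (m / (m - 1)) x0 ler01 m0 q0.
have h : m^-1 + (m / (m - 1))^-1 = 1 by field; rewrite gt_eqF ?subr_gt0//= gt_eqF.
move=> /(_ h); rewrite powR1 mulr1 mul1r.
have -> : (m / (m - 1))^-1 = 1 - m^-1 by move: h; lra.
move=> H; have : m * x <= m * (x `^ m / m + (1 - m^-1)) by rewrite ler_wpM2l// ltW.
rewrite mulrDr mulrCA divff ?gt_eqF// mulr1 mulrBr divff ?gt_eqF//; lra.
Qed.

(** With c = a - b v / (1 - v), the condition at v < 1 reads (m - c) (1 - v) <= b v^m.
    The left-hand side increases in m and the right-hand side decreases, and S is the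
    solution of the equation, in terms of the Lambert function. At v = 1 the condition
    degenerates, and S is given by the comparison of slopes b (m - 1) <= a - m, which
    yields the condition at all x < 1 by Bernoulli's inequality. *)
Lemma Sfun_tail_cond a b m v : 0 < b -> 0 <= m -> 0 <= v <= 1 ->
  m <= Sfun a b v ->
  m <= a /\ (forall x, 0 < x <= v -> x < 1 -> tail_cond a b m x).
Proof.
move=> b0 m0 /andP[v0 v1].
have small x : m <= a -> m <= 1 -> 0 < x -> x < 1 -> tail_cond a b m x.
  move=> ma m1 x0 x1; rewrite /tail_cond.
  rewrite (le_trans (y := 0))//; last by rewrite mulr_ge0 ?subr_ge0// ltW.
  by rewrite pmulr_rle0// subr_le0 ger1_powR// x0 ltW.
rewrite /Sfun; have [a1 /= ma|a1 /=] := leP a 1.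
  by split => // x /andP[x0 _] x1; apply: small => //; exact: le_trans a1.
have [-> ma|vn0] := eqVneq v 0.
  by split => // x /andP[/lt_le_trans/[apply]]; rewrite ltxx.
have vp : 0 < v by rewrite lt_neqAle eq_sym vn0.
have [-> ma|vn1] := eqVneq v 1.
  have ma' : m <= a.
    rewrite (le_trans ma)// gerBl mulr_ge0 ?(ltW b0)// divr_ge0 ?subr_ge0 ?(ltW a1)//.
    by rewrite addr_ge0 ?(ltW b0).
  split => // x /andP[x0 _] x1; have [m1|m1] := leP m 1; first exact: small.
  have := bernoulli_powR m1 (ltW x0); rewrite /tail_cond => h.
  have : b * (m - 1) <= a - m.
    move: ma; have -> : a - b * ((a - 1) / (b + 1)) = (a + b) / (b + 1).
      by field; rewrite gt_eqF// addr_gt0.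
    by rewrite ler_pdivlMr ?addr_gt0//; lra.
  move: (x `^ m) h => X h h2.
  have h3 : b * (x - X) <= b * ((m - 1) * (1 - x)) by rewrite ler_pM2l//; lra.
  rewrite (le_trans h3)// mulrA ler_wpM2r// subr_ge0 ltW//.
have v1' : v < 1 by rewrite lt_neqAle vn1.
have L0 : 0 < ln (1 / v) by rewrite ln_gt0// div1r invf_gt1.
set L := ln (1 / v) in L0 *; set c := a - b * (v / (1 - v)).
set W := lambertW0 _ => mS.
have W1 : W * expR W = b * v `^ c / (1 - v) * L.
  rewrite lambertW0E// !mulr_ge0 ?powR_ge0 ?(ltW b0) ?(ltW L0)//.
  by rewrite invr_ge0 subr_ge0 ltW.
pose S := c + W / L.
have LE : L = - ln v by rewrite /L div1r lnV ?posrE.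
have vc r : v `^ r = expR (- r * L).
  by rewrite /powR gt_eqF// LE mulrNN.
have SE : S - c = b * v `^ S / (1 - v).
  rewrite /S (addrC c) addrK.
  have -> : v `^ (W / L + c) = v `^ c / expR W.
    rewrite !vc -expRN -expRD; congr expR; field; exact: lt0r_neq0.
  have -> : W / L = W * expR W / (expR W * L).
    by field; rewrite !gt_eqF// expR_gt0.
  rewrite W1; field; rewrite subr_eq0 gt_eqF//= ?gt_eqF ?expR_gt0//.
have mc : m - c <= b * v `^ m / (1 - v).
  rewrite (le_trans (y := S - c))// ?lerB// SE ler_wpM2r ?invr_ge0 ?subr_ge0//.
  rewrite ler_wpM2l ?(ltW b0)//; apply: ger_powR => //.
  by rewrite vp ltW.
have cv : tail_cond a b m v.
  rewrite /tail_cond; move: mc; rewrite /c; move: (v `^ m) => V.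
  rewrite ler_pdivlMr ?subr_gt0// => h.
  have E : b * (v / (1 - v)) * (1 - v) = b * v by field; rewrite subr_eq0 gt_eqF.
  lra.
have ma : m <= a.
  have [m1|m1] := leP m 1; first by rewrite (le_trans m1)// ltW.
  have : v `^ m <= v by apply: ge1r_powR => //; [rewrite vp ltW|exact: ltW].
  rewrite -subr_ge0 -(pmulr_rge0 _ b0) => h.
  by move: (le_trans h cv); rewrite pmulr_lge0 ?subr_gt0// subr_ge0.
by split => // x xv x1; exact: tail_cond_le cv.
Qed.

End SCondition.

(** * The sign of a combination of two gamma variables *)

Section TwoGammas.
Context {R : realType}.
Local Notation mu := (@lebesgue_measure R).
Implicit Types (a b c m t x w y : R).

Definition step x : \bar R := (0 <= x)%R%:R%:E.

Lemma nneg_meas_step : nneg_meas step.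
Proof.
split => [|x]; last by rewrite lee_fin.
apply/measurable_EFinP.
rewrite (_ : (fun x => _) = \1_(`[0, +oo[%classic : set R)).
  exact: measurable_indic.
apply/funext => x; rewrite indicE.
by congr ((nat_of_bool _)%:R); apply/idP/idP; rewrite inE/= in_itv/= andbT.
Qed.

Lemma step_nd : {homo step : x y / (x <= y)%R >-> (x <= y)%E}.
Proof.
move=> x y xy; rewrite lee_fin ler_nat.
by case: (leP 0 x) => //= x0; rewrite (le_trans x0).
Qed.

Lemma step_le1 x : (step x <= 1)%E.
Proof. by rewrite lee_fin -[leRHS]/(true%:R) ler_nat; case: (0 <= x). Qed.

Lemma gamma_mean_step t a : 0 < a -> gamma_mean t a step 0 = step t.
Proof.
move=> a0; rewrite (gamma_meanE _ _ a0).
transitivity (\int[mu]_z ((gamma_density a z)%:E * step t))%E.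
  apply: eq_integral => z _; rewrite /gamma_density; case: ifPn => z0; last by rewrite !mul0e.
  by rewrite /step add0r pmulr_lge0.
rewrite ge0_integralZr; last 4 first.
- exact: measurableT.
- by apply: measurable_EFinS; exact: measurable_gamma_density.
- by move=> z _; rewrite lee_fin gamma_density_ge0.
- exact: nneg_meas_step.2.
by rewrite integral_gamma_density// mul1e.
Qed.

(** t1 G1 + t2 G2 >= 0 means that G2 / G1 is at most t1 / - t2. *)
Lemma gamma_mean2_step a b t1 t2 : 0 < a -> 0 < b -> 0 < t1 -> t2 < 0 ->
  gamma_mean t1 a (gamma_mean t2 b step) 0 = (beta_prime_cdf a b (t1 / - t2))%:E.
Proof.
move=> a0 b0 t10 t20; rewrite gamma_mean_merge//; last exact: nneg_meas_step.
rewrite -EFin_beta_prime_cdf// [RHS]integral_mkcond/=; apply: eq_integral => w _.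
rewrite patchE gamma_mean_step ?addr_gt0//.
have -> : (w \in `[0%R, t1 / - t2]%classic) = (0 <= w <= t1 / - t2).
  by apply/idP/idP; rewrite inE/= in_itv/=.
have [w0|w0] := ltP 0 w; last first.
  by rewrite /beta_prime_density ltNge w0/= mul0e; case: ifPn.
have w1 : 0 < 1 + w by rewrite addr_gt0.
rewrite (ltW w0)/= /step pmulr_lge0 ?invr_gt0// ler_pdivlMr ?oppr_gt0//.
have -> : (0 <= t1 + t2 * w) = (w * - t2 <= t1) by apply/idP/idP; lra.
by case: ifPn; rewrite ?mule1 ?mule0.
Qed.

(** The exponent - (a - m), where Chernoff's inequality has - a, is what the condition
    on m buys. For t2 >= 0 the right-hand side is at least 1. *)
Lemma gamma_mean2_step_le a b m c t1 t2 : 0 < a -> 0 < b -> 0 <= m <= a ->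
  0 < t1 -> 0 <= c -> c * t1 < 1 -> c * t2 < 1 ->
  (t2 < 0 -> forall v, 0 < v <= - t2 / (t1 - t2) -> tail_cond a b m v) ->
  (gamma_mean t1 a (gamma_mean t2 b step) 0 <=
   ((1 - c * t1) `^ (- (a - m)) * (1 - c * t2) `^ (- b))%:E)%E.
Proof.
move=> a0 b0 ma t10 c0 ct1 ct2 H.
have [t20|t20] := ltP t2 0; last first.
  have nb := nneg_meas_gamma_mean t2 b nneg_meas_step.
  rewrite (le_trans (y := 1%E))//.
    apply: gamma_mean_le1 => // y; apply: gamma_mean_le1 => //; [exact: nneg_meas_step|exact: step_le1].
  have ge1 x s : 0 < x <= 1 -> 0 <= s -> 1 <= x `^ (- s).
    move=> x01 s0; have := ger_powR x01 (_ : - s <= 0); rewrite powRr0; apply.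
    by rewrite oppr_le0.
  rewrite lee_fin -[leLHS]mulr1 ler_pM// ge1//.
  - by rewrite subr_gt0 ct1 gerBl mulr_ge0// ltW.
  - by rewrite subr_ge0; case/andP: ma.
  - by rewrite subr_gt0 ct2 gerBl mulr_ge0.
  - exact: ltW.
rewrite gamma_mean2_step// lee_fin; apply: beta_prime_cdf_le => //.
- by rewrite divr_gt0// oppr_gt0.
- move=> v; have -> : (1 + t1 / - t2)^-1 = - t2 / (t1 - t2).
    field; rewrite subr_eq0 gt_eqF ?(lt_trans t20)//= lt_eqF//=.
  exact: H.
- by rewrite subr_gt0.
- rewrite lerB// ler_wpM2l// ltW// (lt_trans t20)//.
- by field; rewrite lt_eqF.
Qed.

End TwoGammas.

(** * The sign of a combination of three groups of gamma variables *)

Section WeightedGammaSums.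
Context {R : realType}.
Local Notation mu := (@lebesgue_measure R).

Definition weights {I : Type} (s : seq I) (th x : I -> R) := [seq (th i, x i) | i <- s].

Lemma gamma_means_split (I : Type) (s : seq I) (th x y : I -> R) F : nneg_meas F ->
  (forall i, 0 <= x i) -> (forall i, 0 <= y i) ->
  gamma_means (weights s th (fun i => x i + y i)) F =
  gamma_means (weights s th x) (gamma_means (weights s th y) F).
Proof.
move=> nF x0 y0; elim: s => //= i s ->.
have nG := nneg_meas_gamma_means (weights s th y) nF.
rewrite -gamma_mean_split//; last exact: nneg_meas_gamma_means.
by rewrite [in RHS]/= gamma_mean_gamma_meansC.
Qed.

Lemma gamma_means_cst_scale (I : Type) (s : seq I) T (x : I -> R) F : nneg_meas F ->
  (forall i, 0 <= x i) ->
  gamma_means (weights s (fun=> T) x) F = gamma_mean T (\sum_(i <- s) x i) F.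
Proof.
move=> nF x0; elim: s => [|i s ih]; first by rewrite big_nil gamma_mean0.
rewrite big_cons -gamma_mean_split//; last exact: sumr_ge0.
by rewrite -ih.
Qed.

Lemma gamma_means_nd l (F : R -> \bar R) : nneg_meas F -> {homo F : x y / (x <= y)%R >-> (x <= y)%E} ->
  {homo gamma_means l F : x y / (x <= y)%R >-> (x <= y)%E}.
Proof.
by move=> nF ndF; elim: l => //= p l ih; apply: gamma_mean_nd => //; exact: nneg_meas_gamma_means.
Qed.

Lemma le_gamma_means_scale (I : Type) (s : seq I) (th : I -> R) T (x : I -> R) F y : nneg_meas F ->
  {homo F : x y / (x <= y)%R >-> (x <= y)%E} ->
  (forall i, 0 <= x i) -> (forall i, 0 < x i -> th i <= T) ->
  (gamma_means (weights s th x) F y <= gamma_mean T (\sum_(i <- s) x i) F y)%E.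
Proof.
move=> nF ndF x0 xT; rewrite -gamma_means_cst_scale//.
elim: s y => //= i s ih y.
have [xi|xi] := boolP (0 < x i); last by rewrite !(gamma_mean_id _ _ xi).
apply: (@le_trans _ _ (gamma_mean (th i) (x i) (gamma_means (weights s (fun=> T) x) F) y)).
  by apply: le_gamma_mean => //; exact: nneg_meas_gamma_means.
apply: le_gamma_mean_scale; [exact: nneg_meas_gamma_means|exact: gamma_means_nd|exact: xT].
Qed.

Lemma gamma_means_weights0 (I : Type) (s : seq I) (th x : I -> R) F : (forall i, x i = 0) ->
  gamma_means (weights s th x) F = F.
Proof. by move=> x0; elim: s => //= i s ->; rewrite x0 gamma_mean0. Qed.

(** Variables of shape 0 contribute to neither side, so merging needs bounds on the
    weights of the others only. *)
Lemma gamma_means_weights_merge_le k (th x : 'I_k -> R) lo hi c K F y : nneg_meas F -> 0 <= K ->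
  (forall t, lo <= t <= hi -> c * t < 1) -> (forall i, 0 <= x i) ->
  (forall i, 0 < x i -> lo <= th i <= hi) -> 0 < \sum_i x i ->
  (forall t, lo <= t <= hi ->
     (gamma_mean t (\sum_i x i) F y <= (K * (1 - c * t) `^ (- \sum_i x i))%:E)%E) ->
  (gamma_means (weights (enum 'I_k) th x) F y <= (K * \prod_i (1 - c * th i) `^ (- x i))%:E)%E.
Proof.
move=> nF K0 hc x0 xlh S0 H.
pose l := [seq p <- weights (enum 'I_k) th x | 0 < p.2].
have lS : \sum_(p <- l) p.2 = \sum_i x i.
  rewrite big_filter /weights big_map big_enum_cond/= [RHS](bigID (fun i => 0 < x i))/=.
  rewrite [X in _ = _ + X]big1 ?addr0// => i; rewrite -leNgt => xi.
  by apply/eqP; rewrite eq_le xi x0.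
have lP : \prod_(p <- l) (1 - c * p.1) `^ (- p.2) = \prod_i (1 - c * th i) `^ (- x i).
  rewrite big_filter /weights big_map big_enum_cond/= [RHS](bigID (fun i => 0 < x i))/=.
  rewrite [X in _ = _ * X]big1 ?mulr1// => i; rewrite -leNgt => xi.
  by have /eqP -> : x i == 0 by [rewrite eq_le xi x0]; rewrite oppr0 powRr0.
rewrite -gamma_means_filter_pos -/l -lP; apply: (@gamma_means_merge_le _ lo hi) => //.
- move=> p; rewrite mem_filter => /andP[p0 /mapP[i _ pE]]; split => //.
  by move: p0; rewrite pE/=; exact: xlh.
- by apply/eqP => l0; move: S0; rewrite -lS l0 big_nil ltxx.
- by rewrite lS.
Qed.

Variables (k : nat) (th e c b : 'I_k -> R) (lo hi tau la : R).
Let m := \sum_i e i.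
Let C := \sum_i c i.
Let B := \sum_i b i.
Hypotheses (e0 : forall i, 0 <= e i) (c0 : forall i, 0 <= c i) (b0 : forall i, 0 <= b i).
Hypothesis thlh : forall i, lo <= th i <= hi.
Hypotheses (la0 : 0 <= la) (lahi : la * hi < 1).
Hypothesis (B0 : 0 < B) (tau0 : 0 <= tau).
Hypothesis ecth : forall i, 0 < e i \/ 0 < c i -> 0 < th i /\ tau <= th i.
Hypothesis ec : forall i j, 0 < e i -> 0 < c j -> th i <= th j.
(* v ranges up to - lo / (tau - lo), the largest value of - t2 / (t1 - t2) for
   t1 >= tau and t2 >= lo; the product form covers tau = lo too *)
Hypothesis SH : forall v, 0 < v -> v * (tau - lo) <= - lo -> v < 1 -> tail_cond (m + C) B m v.

Let hc t : lo <= t <= hi -> la * t < 1.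
Proof. by move=> /andP[_ thi]; rewrite (le_lt_trans _ lahi)// ler_wpM2l. Qed.

(** The two variables left after merging: one of weight t1 made of the groups e and c,
    one of weight t2 made of the group b. *)
Let two a t1 t2 : (a = m + C) -> 0 < a -> 0 < t1 -> tau <= t1 -> t1 <= hi -> lo <= t2 <= hi ->
  (gamma_mean t1 a (gamma_mean t2 B step) 0 <=
   ((1 - la * t1) `^ (- C) * (1 - la * t2) `^ (- B))%:E)%E.
Proof.
move=> aE a0 t10 taut1 t1hi t2lh.
have C0 : 0 <= C by apply: sumr_ge0.
have m0 : 0 <= m by apply: sumr_ge0.
have -> : C = a - m by rewrite aE addrC addKr.
apply: gamma_mean2_step_le => //.
- by rewrite m0 aE lerDl.
- by rewrite (le_lt_trans _ lahi)// ler_wpM2l.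
- exact: hc.
- move=> t20 v /andP[v0 vle]; rewrite aE; case/andP: t2lh => lo2 _.
  have d0 : 0 < t1 - t2 by rewrite subr_gt0 (lt_trans t20).
  move: vle; rewrite ler_pdivlMr// => vle.
  have v1 : v < 1.
    rewrite -(ltr_pM2r d0) mul1r (le_lt_trans vle)//; lra.
  apply: SH => //.
  have : v * (t1 - t2) <= - t2 by [].
  nra.
Qed.

(** The e group is collected at a single weight: the smallest weight T of the c group
    or, if that group is empty, its own largest weight. Merging then reduces the b group
    to one weight t2 and the c group to one weight t1 >= T; the collected e group is
    raised from T to t1, and the two-variable bound gives back the factors of c and b
    and none for e. *)
Lemma gamma_means_step_le :
  (gamma_means (weights (enum 'I_k) th (fun i => b i + (c i + e i))%R) step 0 <=
   (\prod_i (1 - la * th i) `^ (- (c i + b i)))%:E)%E.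
Proof.
have nS := @nneg_meas_step R.
have C0 : 0 <= C by apply: sumr_ge0.
have m0 : 0 <= m by apply: sumr_ge0.
rewrite gamma_means_split//; last by move=> i; rewrite addr_ge0.
rewrite gamma_means_split//.
have -> : \prod_i (1 - la * th i) `^ (- (c i + b i)) =
    \prod_i (1 - la * th i) `^ (- c i) * \prod_i (1 - la * th i) `^ (- b i).
  rewrite -big_split/=; apply: eq_bigr => i _; rewrite opprD powRD//.
  by rewrite (lt0r_neq0 (_ : 0 < 1 - la * th i)) ?implybT// subr_gt0 hc.
have P0 x : 0 <= \prod_i (1 - la * th i) `^ (- x i).
  by apply: prodr_ge0 => i _; exact: powR_ge0.
(* an empty c group: the e group is raised to its own largest weight *)
have [C1|C1] := ltP 0 C; last first.
  have cz i : c i = 0.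
    have : \sum_i c i == 0 by rewrite eq_le C1 C0.
    by rewrite psumr_eq0// => /allP/(_ i (mem_index_enum _))/eqP.
  have CE : C = 0 by apply/eqP; rewrite eq_le C1.
  rewrite (gamma_means_weights0 _ _ _ cz) [X in (X * _)%R]big1 ?mul1r; last first.
    by move=> i _; rewrite cz oppr0 powRr0.
  have [m1|m1] := ltP 0 m; last first.
    have ez i : e i = 0.
      have : \sum_i e i == 0 by rewrite eq_le m1 m0.
      by rewrite psumr_eq0// => /allP/(_ i (mem_index_enum _))/eqP.
    rewrite (gamma_means_weights0 _ _ _ ez) -[X in (_ <= X%:E)%E]mul1r.
    apply: (@gamma_means_weights_merge_le _ _ _ lo hi) => // t tlh; rewrite -/B mul1r.
    rewrite gamma_mean_step// /step lee_fin.
    have [t0|t0] := leP 0 t; last exact: powR_ge0.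
    rewrite -[leLHS](powRr0 (1 - la * t)) ger_powR//.
      by rewrite subr_gt0 hc//= gerBl mulr_ge0.
    by rewrite oppr_le0 ltW.
  have [i0 i0P] : exists i, 0 < e i.
    apply/existsP; move: m1; apply: contraTT; rewrite negb_exists => /forallP H.
    rewrite -leNgt /m big1// => i _; apply/eqP; rewrite eq_le e0 andbT leNgt; exact: H.
  case: (@arg_maxP _ _ _ i0 (fun i => 0 < e i) th i0P) => T eT Tmax.
  have [T0 tauT] := ecth (or_introl eT).
  apply: (@le_trans _ _ (gamma_means (weights (enum 'I_k) th b) (gamma_mean (th T) m step) 0)).
    apply: le_gamma_means; [exact: nneg_meas_gamma_means|exact: nneg_meas_gamma_mean|] => y.
    rewrite /m -(big_enum _ _ xpredT)/=.
    by apply: le_gamma_means_scale; [|exact: step_nd| |exact: Tmax].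
  rewrite -[X in (_ <= X%:E)%E]mul1r.
  apply: (@gamma_means_weights_merge_le _ _ _ lo hi) => //; first exact: nneg_meas_gamma_mean.
  move=> t tlh; rewrite -/B mul1r gamma_mean_comm//.
  have := @two m (th T) t; rewrite CE addr0 oppr0 powRr0 mul1r; apply => //.
  by case/andP: (thlh T).
have [i0 i0P] : exists i, 0 < c i.
  apply/existsP; move: C1; apply: contraTT; rewrite negb_exists => /forallP H.
  rewrite -leNgt /C big1// => i _; apply/eqP; rewrite eq_le c0 andbT leNgt; exact: H.
case: (@arg_minP _ _ _ i0 (fun i => 0 < c i) th i0P) => j cT Tmin.
pose T := th j.
have [T0 tauT] := ecth (or_intror cT).
have nm := nneg_meas_gamma_mean T m nS.
apply: (@le_trans _ _ (gamma_means (weights (enum 'I_k) th b)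
    (gamma_means (weights (enum 'I_k) th c) (gamma_mean T m step)) 0)).
  apply: le_gamma_means; [exact/nneg_meas_gamma_means/nneg_meas_gamma_means|
    exact: nneg_meas_gamma_means|] => y.
  apply: le_gamma_means; [exact: nneg_meas_gamma_means|exact: nm|] => z.
  rewrite /m -(big_enum _ _ xpredT)/=.
  by apply: le_gamma_means_scale; [|exact: step_nd| |move=> i ei; exact: ec].
apply: (@gamma_means_weights_merge_le _ _ _ lo hi) => //; first exact: nneg_meas_gamma_means.
move=> t2 t2lh; rewrite -/B gamma_mean_gamma_meansC// mulrC.
apply: (@gamma_means_weights_merge_le _ _ _ T hi) => //.
- exact: nneg_meas_gamma_mean.
- exact: powR_ge0.
- by move=> t /andP[Tt thi]; apply: hc; rewrite thi (le_trans _ Tt)//; case/andP: (thlh j).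
- by move=> i ci; rewrite Tmin//=; case/andP: (thlh i).
- move=> t1 /andP[Tt1 t1hi]; rewrite -/C mulrC.
  have nB := nneg_meas_gamma_mean t2 B nS.
  apply: (@le_trans _ _ (gamma_mean t1 C (gamma_mean t2 B (gamma_mean t1 m step)) 0)).
    apply: le_gamma_mean; [exact: nneg_meas_gamma_mean|
      exact/nneg_meas_gamma_mean/nneg_meas_gamma_mean|] => y.
    apply: le_gamma_mean; [exact: nm|exact/nneg_meas_gamma_mean|] => z.
    by apply: le_gamma_mean_scale => //; exact: step_nd.
  rewrite (gamma_mean_comm t2 B t1 m nS).
  rewrite gamma_mean_split//.
  apply: two => //; [exact: addrC|exact: ltr_wpDr|exact: lt_le_trans Tt1|].
  exact: le_trans Tt1.
Qed.

End WeightedGammaSums.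

(** * Sums of independent gamma variables *)

Section Density.
Context d (T : measurableType d) (R : realType).

(** A density is almost everywhere the Radon-Nikodym derivative. *)
Lemma ge0_integral_density (nu : {finite_measure set T -> \bar R})
    (mu : {sigma_finite_measure set T -> \bar R}) (p : T -> R) (h : T -> \bar R) :
  measurable_fun setT p -> (forall x, 0 <= p x) ->
  (forall A, measurable A -> nu A = \int[mu]_(x in A) (p x)%:E)%E ->
  measurable_fun setT h -> (forall x, 0 <= h x)%E ->
  (\int[nu]_x h x = \int[mu]_x (h x * (p x)%:E))%E.
Proof.
move=> mp p0 nuE mh h0.
have mpE D : measurable_fun D (fun x => (p x)%:E).
  by apply: measurable_funTS; apply/measurable_EFinP.
have numu : nu `<< mu.
  apply/null_content_dominatesP => A mA muA0; rewrite nuE//.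
  exact: null_set_integral.
rewrite -(Radon_Nikodym_SigmaFinite.change_of_variables numu)//.
have mf := measurable_int _ (Radon_Nikodym_SigmaFinite.f_integrable numu).
have f0 := Radon_Nikodym_SigmaFinite.f_ge0 numu.
apply: ge0_ae_eq_integral => //.
- exact: emeasurable_funM.
- exact: emeasurable_funM.
- by move=> x _; rewrite mule_ge0.
- by move=> x _; rewrite mule_ge0// lee_fin.
apply: ae_eqe_mul2l; apply: integral_ae_eq => //.
- exact: Radon_Nikodym_SigmaFinite.f_integrable.
- by move=> A _ mA; rewrite -Radon_Nikodym_SigmaFinite.f_integral// nuE.
Qed.

End Density.

Section GammaVariables.
Context d (V : measurableType d) (R : realType) (Q : probability V R).
Local Notation mu := (@lebesgue_measure R).
Local Notation RT := (measurableTypeR R).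

(** The real line is given the structure that carries Lebesgue measure, for use in
    product measures. *)
Definition mfun_of (X : V -> R) (mX : measurable_fun [set: V] X) : {mfun V >-> RT} :=
  HB.pack (X : V -> RT) (@isMeasurableFun.Build _ _ V RT X mX).

(** The operators are expectations under [gamma_law], including at shape 0. *)
Lemma integral_gamma_law (X : V -> R) (mX : measurable_fun [set: V] X) a t x
    (F : R -> \bar R) : nneg_meas F ->
  (forall B : set R, measurable B -> Q (X @^-1` B) = gamma_law a B) ->
  (\int[distribution Q (mfun_of mX)]_z F (x + t * z)%R = gamma_mean t a F x)%E.
Proof.
move=> nF HX; have [a0|a0] := boolP (0 < a); last first.
  rewrite gamma_mean_id//.
  transitivity (\int[\d_ (0%R : RT)]_z F (x + t * z)%R)%E.
    apply: eq_measure_integral => A mA _; rewrite -[LHS]/(Q (X @^-1` A)).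
    by rewrite HX// /gamma_law (negbTE a0).
  rewrite integral_dirac//; last exact: measurable_affine_comp.
  by rewrite diracE in_setT mul1e mulr0 addr0.
rewrite gamma_meanE//.
rewrite (@ge0_integral_density _ _ _ (distribution Q (mfun_of mX)) mu (gamma_density a)).
- by apply: eq_integral => z _; rewrite muleC.
- exact: measurable_gamma_density.
- exact: gamma_density_ge0.
- move=> A mA; rewrite integral_gamma_density_set// -[LHS]/(Q (X @^-1` A)) HX//.
  by rewrite /gamma_law a0.
- exact: measurable_affine_comp.
- by move=> z; exact: nF.2.
Qed.

Variables (k : nat) (Z : 'I_k -> {RV Q >-> R}) (th al : 'I_k -> R).
Hypothesis indZ : independent_RVs Z.
Hypothesis lawZ : forall i (B : set R), measurable B ->
  Q (Z i @^-1` B) = gamma_law (al i) B.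

Let psum j v : R := \sum_(i < k | (i < j)%N) th i * Z i v.

Let mZ i : measurable_fun [set: V] (Z i : V -> R).
Proof. exact: measurable_funPT. Qed.

Let mpsum j : measurable_fun [set: V] (psum j).
Proof.
rewrite (_ : psum j =
    fun v => \sum_(i < k) (if (i < j)%N then th i * Z i v else 0)); last first.
  by apply/funext => v; rewrite /psum big_mkcond.
apply: measurable_sum.
by move=> i; case: (i < j)%N => //; exact: measurable_funM.
Qed.

(** The events on the variables of index at least j. The invariant of the induction is
    that the j-th partial sum is independent of them. *)
Let later j (B : 'I_k -> set R) := \bigcap_(i in [set i : 'I_k | (j <= i)%N]) (Z i @^-1` B i).

Let measurable_preim i (B : set R) : measurable B -> measurable (Z i @^-1` B).
Proof. by move=> mB; rewrite -[_ @^-1` _]setTI; exact: mZ. Qed.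

Let measurable_later j B : (forall i, measurable (B i)) -> measurable (later j B).
Proof.
move=> mB; apply: fin_bigcap_measurable => // i _; exact: measurable_preim.
Qed.

Let later_prod j B : (forall i, measurable (B i)) ->
  Q (later j B) = (\prod_(i < k | (j <= i)%N) Q (Z i @^-1` B i))%E.
Proof.
move=> mB; pose B' (i : 'I_k) : set R := if (j <= i)%N then B i else setT.
have mB' i : measurable (B' i) by rewrite /B'; case: ifPn.
have E := indZ mB'.
have -> : later j B = \bigcap_i (Z i @^-1` B' i).
  apply/seteqP; split => v H i.
    by move=> _; rewrite /preimage/= /B'; case: ifPn => // ji; exact: H.
  by move=> /= ji; have := H i Logic.I; rewrite /preimage/= /B' ji.
rewrite E [RHS]big_mkcond/=; apply: eq_bigr => i _; rewrite /B'; case: ifPn => // _.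
by rewrite preimage_setT probability_setT.
Qed.

Let laterS j (jk : (j < k)%N) B :
  later j B = Z (Ordinal jk) @^-1` B (Ordinal jk) `&` later j.+1 B.
Proof.
apply/seteqP; split => [v H|v [H1 H2] i /= ji].
  split; first exact: (H (Ordinal jk) (leqnn _)).
  by move=> i /= ji; apply: H; exact: ltnW.
move: ji; rewrite leq_eqVlt => /predU1P[ji|]; last exact: H2.
by rewrite (_ : i = Ordinal jk)//; exact: val_inj.
Qed.

Let later_prodS j (jk : (j < k)%N) B : (forall i, measurable (B i)) ->
  Q (later j B) = (Q (Z (Ordinal jk) @^-1` B (Ordinal jk)) * Q (later j.+1 B))%E.
Proof.
move=> mB; rewrite !later_prod// (bigD1 (Ordinal jk))/=; last exact: leqnn.
by congr (_ * _)%E; apply: eq_bigl => i; rewrite andbC ltn_neqAle eq_sym.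
Qed.

Let psumS j (jk : (j < k)%N) v :
  psum j.+1 v = psum j v + th (Ordinal jk) * Z (Ordinal jk) v.
Proof.
rewrite /psum (bigD1 (Ordinal jk))/= ?ltnSn// addrC; congr (_ + _).
by apply: eq_bigl => i; rewrite ltnS [in RHS]ltn_neqAle andbC.
Qed.

(** Conditionally on the later variables, the law of (partial sum, next variable)
    agrees with the product measure on rectangles, hence on all measurable sets. *)
Let pair_law j (jk : (j < k)%N) (B : 'I_k -> set R) (C : set (RT * RT)) :
  (forall A (B : 'I_k -> set R), measurable A -> (forall i, measurable (B i)) ->
    Q (psum j @^-1` A `&` later j B) = (Q (psum j @^-1` A) * Q (later j B))%E) ->
  (forall i, measurable (B i)) -> measurable C ->
  Q ((fun v => (psum j v, Z (Ordinal jk) v)) @^-1` C `&` later j.+1 B) =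
  ((distribution Q (mfun_of (mpsum j)) \x distribution Q (mfun_of (mZ (Ordinal jk))))%E C *
   Q (later j.+1 B))%E.
Proof.
move=> ih mB mC; set jj := Ordinal jk; set E := later j.+1 B.
have mE : measurable E by exact: measurable_later.
pose g v : RT * RT := (psum j v, Z jj v).
have mg : measurable_fun [set: V] g.
  by apply/measurable_fun_pairP; split; [exact: mpsum|exact: mZ].
have mgC D : measurable D -> measurable (g @^-1` D).
  by move=> mD; rewrite -[_ @^-1` _]setTI; exact: mg.
have [QE0|QE0] := eqVneq (Q E) 0%E.
  rewrite QE0 mule0; apply/eqP; rewrite eq_le measure_ge0 andbT -QE0.
  by rewrite le_measure ?inE//; apply: measurableI => //; exact: mgC.
have QEfin : Q E \is a fin_num by exact: fin_num_measure.
pose q := fine (Q E).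
have q0 : 0 < q by rewrite fine_gt0// lt0e QE0 measure_ge0/= -ge0_fin_numE.
have qV0 : 0 < q^-1 by rewrite invr_gt0.
pose m'' : {measure set (RT * RT) -> \bar R} :=
  mscale (NngNum (ltW qV0)) (pushforward (mrestr Q mE) g).
pose m' := m'' mg.
have m'E D : m' D = (q^-1%:E * Q (g @^-1` D `&` E))%E by [].
have H := @product_measure_unique _ _ RT RT R
  (distribution Q (mfun_of (mpsum j))) (distribution Q (mfun_of (mZ jj))) m' _ C mC.
rewrite H; last first.
  move=> X Y mX mY; rewrite m'E.
  pose B' (i : 'I_k) : set R := if i == jj then (Y : set R) else B i.
  have mB' i : measurable (B' i) by rewrite /B'; case: ifPn => _; [exact: mY|exact: mB].
  have -> : g @^-1` (X `*` Y) `&` E = psum j @^-1` X `&` later j B'.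
    rewrite (laterS jk) /B' eqxx -setIA; congr (_ `&` (_ `&` _)).
    by apply: eq_bigcapr => i /= ji; rewrite ifN// -val_eqE/= gtn_eqF.
  rewrite ih// (later_prodS jk)// /B' eqxx.
  have -> : later j.+1 B' = E.
    by apply: eq_bigcapr => i /= ji; rewrite /B' ifN// -val_eqE/= gtn_eqF.
  rewrite -[RHS]/(Q (psum j @^-1` X) * Q (Z jj @^-1` Y))%E.
  rewrite -/jj -(fineK QEfin) -/q muleC -!muleA -EFinM.
  by rewrite mulfV ?gt_eqF// mule1.
rewrite m'E muleAC -[X in (_ * X * _)%E](fineK QEfin) -EFinM.
by rewrite mulVf ?mul1e// gt_eqF.
Qed.

Let psum_indep j : (j <= k)%N -> forall (A : set R) (B : 'I_k -> set R),
  measurable A -> (forall i, measurable (B i)) ->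
  Q (psum j @^-1` A `&` later j B) = (Q (psum j @^-1` A) * Q (later j B))%E.
Proof.
elim: j => [_|j ih jk] A B mA mB.
  have [A0|A0] := pselect (A 0).
    rewrite (_ : psum 0 @^-1` A = setT) ?setTI ?probability_setT ?mul1e//.
    by apply/seteqP; split => // v _; rewrite /preimage/= /psum big_pred0.
  rewrite (_ : psum 0 @^-1` A = set0) ?set0I ?measure0 ?mul0e//.
  by apply/seteqP; split => // v; rewrite /preimage/= /psum big_pred0.
pose C : set (RT * RT) := (fun p => p.1 + th (Ordinal jk) * p.2) @^-1` A.
have mC : measurable C.
  rewrite -[C]setTI; have : measurable_fun [set: RT * RT]
    (fun p => p.1 + th (Ordinal jk) * p.2 : R).
    by apply: measurable_funD => //; exact: measurable_funM.
  exact.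
have E : psum j.+1 @^-1` A = (fun v => (psum j v, Z (Ordinal jk) v)) @^-1` C.
  by apply/funext => v; rewrite /preimage/= /C (psumS jk).
have ih' := ih (ltnW jk).
have := pair_law jk ih' (fun=> measurableT) mC.
have -> : later j.+1 (fun=> setT) = setT by apply/seteqP; split.
rewrite setIT probability_setT mule1 -E => E2.
by rewrite {1}E (pair_law jk ih' mB mC) E2.
Qed.

(** The next variable is integrated out by Tonelli's theorem. *)
Let psum_gamma_mean j (jk : (j < k)%N) F : nneg_meas F ->
  (\int[Q]_v F (psum j.+1 v) =
   \int[Q]_v (gamma_mean (th (Ordinal jk)) (al (Ordinal jk)) F (psum j v)))%E.
Proof.
move=> nF; set jj := Ordinal jk.
pose g v : RT * RT := (psum j v, Z jj v).
have mg : measurable_fun [set: V] g.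
  by apply/measurable_fun_pairP; split; [exact: mpsum|exact: mZ].
pose h (p : RT * RT) := F (p.1 + th jj * p.2).
have mh : measurable_fun [set: RT * RT] h.
  apply: (measurableT_comp nF.1).
  by apply: measurable_funD => //; exact: measurable_funM.
have h0 p : (0 <= h p)%E by exact: nF.2.
transitivity (\int[pushforward Q g]_p h p)%E.
  rewrite (ge0_integral_pushforward mg)//.
  by apply: eq_integral => v _; rewrite /h/= (psumS jk).
transitivity (\int[distribution Q (mfun_of (mpsum j)) \x distribution Q (mfun_of (mZ jj))]_p h p)%E.
  apply: eq_measure_integral => A mA _.
  have := pair_law jk (psum_indep (ltnW jk)) (fun=> measurableT) mA.
  have -> : later j.+1 (fun=> setT) = setT by apply/seteqP; split.
  by rewrite setIT probability_setT mule1 => E2; exact: E2.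
rewrite fubini_tonelli1//.
rewrite (ge0_integral_distribution (mfun_of (mpsum j))); last 2 first.
- exact: measurable_fun_fubini_tonelli_F.
- by move=> x; apply: integral_ge0 => y _; exact: h0.
apply: eq_integral => v _; rewrite /fubini_F/=.
exact: (integral_gamma_law _ _ _ nF (lawZ jj)).
Qed.

Lemma integral_gamma_sum F : nneg_meas F ->
  (\int[Q]_v F (\sum_(i < k) th i * Z i v)%R = gamma_means (weights (enum 'I_k) th al) F 0)%E.
Proof.
move=> nF.
have H j : (j <= k)%N -> forall F', nneg_meas F' -> (\int[Q]_v F' (psum j v) =
    gamma_means (weights [seq i : 'I_k <- enum 'I_k | (i < j)%N] th al) F' 0)%E.
  elim: j => [_|j ih jk] F' nF'.
    rewrite (_ : [seq i : 'I_k <- enum 'I_k | (i < 0)%N] = [::])/=; last first.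
      by rewrite -(filter_pred0 (enum 'I_k)); apply: eq_filter => i.
    transitivity (\int[Q]_v (cst (F' 0%R) v))%E.
      by apply: eq_integral => v _; rewrite /psum big_pred0.
    rewrite integral_cst; last exact: measurableT.
    by rewrite [X in (_ * X)%E]probability_setT mule1.
  rewrite (psum_gamma_mean jk nF') ih ?(ltnW jk)//; last exact: nneg_meas_gamma_mean.
  have -> : [seq i : 'I_k <- enum 'I_k | (i < j.+1)%N] =
      rcons [seq i : 'I_k <- enum 'I_k | (i < j)%N] (Ordinal jk).
    apply: (inj_map val_inj); rewrite map_rcons.
    have E n : (n <= k)%N -> map val [seq i : 'I_k <- enum 'I_k | (i < n)%N] = iota 0 n.
      move=> nk; rewrite -(filter_map val (fun i : nat => i < n)%N) val_enum_ord.
      by have := @filter_iota_ltn 0 k n; rewrite !add0n => /(_ nk).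
    by rewrite (E _ jk) (E _ (ltnW jk)) -cats1 -(iotaD 0 j 1) addn1.
  by rewrite /weights map_rcons -cats1 gamma_means_cat.
have := H k (leqnn k) F nF.
have -> : [seq i : 'I_k <- enum 'I_k | (i < k)%N] = enum 'I_k.
  by apply/all_filterP/allP => i _; exact: ltn_ord.
move=> <-; apply: eq_integral => v _; congr F; rewrite /psum.
by apply: eq_bigl => i; rewrite ltn_ord.
Qed.
End GammaVariables.

(** * Tails of linear functions of a Dirichlet vector *)

Section DirichletTail.
Context d (W : measurableType d) (R : realType) (P : probability W R).
Local Notation RT := (measurableTypeR R).

Lemma gamma_law_neg (a : R) : gamma_law a `]-oo, 0[%classic = 0%E.
Proof.
rewrite /gamma_law; case: ifPn => _.
  rewrite (_ : _ `&` _ = set0) ?integral_set0//.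
  apply/seteqP; split => // x [] /=; rewrite !in_itv/= andbT => x0.
  by rewrite ltNge (ltW x0).
by rewrite diracE memNset//= in_itv/= ltxx.
Qed.

(** The normalising sum S of the gamma variables is positive wherever the normalised
    coordinates sum to 1, so normalisation does not change the sign of the sum of
    (f_i - u) Z_i. The event N where some gamma variable is negative is null. *)
Lemma Dirichlet_tail_le k (Y : 'I_k -> W -> R) (al f : 'I_k -> R) u :
  is_Dirichlet P Y al -> (forall w, \sum_i Y i w = 1) ->
  (P [set w | (u <= \sum_i f i * Y i w)%R] <=
   gamma_means (weights (enum 'I_k) (fun i => f i - u)%R al) step 0)%E.
Proof.
move=> [d' [V [Q [Z [indZ lawZ YZ]]]]] Y1.
pose B : set (k.-tuple RT) :=
  [set t | \sum_i tnth t i = 1 :> R /\ u <= \sum_i f i * tnth t i].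
have mB : measurable B.
  have m1 : measurable_fun [set: k.-tuple RT] (fun t => \sum_i tnth t i : R).
    by apply: measurable_sum => i; exact: measurable_tnth.
  have m2 : measurable_fun [set: k.-tuple RT] (fun t => \sum_i f i * tnth t i : R).
    apply: measurable_sum => i; apply: measurable_funM => //; exact: measurable_tnth.
  have -> : B = (fun t => \sum_i tnth t i : R) @^-1` [set 1] `&`
     (fun t => \sum_i f i * tnth t i : R) @^-1` `[u, +oo[.
    by apply/seteqP; split => t []; rewrite /B/= /preimage/= in_itv/= andbT.
  apply: measurableI.
    by rewrite -[X in measurable X]setTI; apply: m1.
  by rewrite -[X in measurable X]setTI; apply: m2.
have -> : [set w | (u <= \sum_i f i * Y i w)%R] = [set w | B [tuple Y i w | i < k]].
  apply/seteqP; split => w; rewrite /B/=.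
    move=> H; split; first by rewrite -[RHS](Y1 w); apply: eq_bigr => i _; rewrite tnth_mktuple.
    by rewrite (le_trans H)//; apply: ler_sum => i _; rewrite tnth_mktuple.
  by move=> [_ H]; rewrite (le_trans H)//; apply: ler_sum => i _; rewrite tnth_mktuple.
rewrite YZ//.
pose th i := f i - u.
have mZ i : measurable_fun [set: V] (Z i : V -> R) by exact: measurable_funPT.
have mS : measurable_fun [set: V] (fun v => \sum_i th i * Z i v).
  by apply: measurable_sum => i; exact: measurable_funM.
pose N := \big[setU/set0]_i (Z i @^-1` `]-oo, 0[).
have mN i : measurable (Z i @^-1` `]-oo, 0[%classic).
  by rewrite -[X in measurable X]setTI; exact: mZ.
pose E := [set v | 0 <= \sum_i th i * Z i v].
have mE : measurable E.
  have -> : E = (fun v => \sum_i th i * Z i v) @^-1` `[0, +oo[.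
    by apply/seteqP; split => v; rewrite /E/= /preimage/= in_itv/= andbT.
  by rewrite -[X in measurable X]setTI; exact: mS.
have QN : Q N = 0%E.
  suff : measurable N /\ Q N = 0%E by case.
  apply: (big_ind (fun A => measurable A /\ Q A = 0%E)) => //.
    move=> A1 A2 [m1 Q1] [m2 Q2]; split; first exact: measurableU.
    apply/eqP; rewrite eq_le measure_ge0 andbT.
    apply: (le_trans (measureU2 _ m1 m2)).
    by rewrite [X in (X + _)%E]Q1 [X in (_ + X)%E]Q2 adde0.
  by move=> i _; split; [exact: mN|rewrite lawZ// gamma_law_neg].
rewrite -(integral_gamma_sum th indZ lawZ (@nneg_meas_step R)).
have -> : (\int[Q]_v step (\sum_i th i * Z i v)%R = Q E)%E.
  rewrite -[in RHS](setIT E) -integral_indic//.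
  apply: eq_integral => v _; rewrite /step indicE; congr ((nat_of_bool _)%:R%:E).
  by apply/idP/idP; rewrite inE.
have -> : Q E = (Q E + Q N)%E by rewrite QN adde0.
apply: (@le_trans _ _ (Q (E `|` N))); last first.
  apply: measureU2 => //; exact: bigsetU_measurable.
apply: le_measure; rewrite ?inE//.
- have mr : measurable_fun [set: V]
      (fun v => [tuple Z i v / \sum_(j < k) Z j v | i < k] : k.-tuple RT).
    apply/measurable_fun_tnthP => i.
    rewrite (_ : _ \o _ = fun v => Z i v / \sum_(j < k) Z j v); last first.
      by apply/funext => v /=; rewrite tnth_mktuple.
    apply: measurable_funM => //; apply: (measurableT_comp measurable_invr).
    exact: measurable_sum.
  by rewrite -[X in measurable X]setTI; exact: mr.
- by apply: measurableU => //; exact: bigsetU_measurable.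
move=> v [S1 Su]; have [vN|vN] := pselect (N v); [by right|left].
have Z0 i : 0 <= Z i v.
  rewrite leNgt; apply/negP => Zi; apply: vN; rewrite /N (bigD1 i)//=; left.
  by rewrite /preimage/= in_itv.
set S := \sum_(j < k) Z j v in S1 Su.
have S0 : 0 < S.
  rewrite lt_neqAle sumr_ge0// andbT eq_sym; apply/eqP => S0.
  move: S1; under eq_bigr do rewrite tnth_mktuple S0 invr0 mulr0.
  by rewrite big1// => /eqP; rewrite eq_sym oner_eq0.
rewrite /E/= /th; under eq_bigr do rewrite mulrBl.
rewrite big_split/= sumrN -mulr_sumr -/S subr_ge0 -ler_pdivlMr//.
rewrite (le_trans Su)// mulr_suml; apply: ler_sum => i _.
by rewrite tnth_mktuple mulrA.
Qed.

End DirichletTail.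

(** * Finite measures and minimizers under an upper bound *)

Section FiniteMeasures.
Context d (T : measurableType d) (R : realType).
Implicit Types (m : {measure set T -> \bar R}) (mu nu : {finite_measure set T -> \bar R}).

Lemma finite_measure_of m : (m setT < +oo)%E ->
  exists nu, forall A, nu A = m A.
Proof.
move=> moo; exists (mfrestr measurableT moo) => A.
by rewrite -[LHS]/(m (A `&` setT)) setIT.
Qed.

Lemma probability_of m : m setT = 1%E ->
  exists P : probability T R, forall A, P A = m A.
Proof.
move=> m1; exists (mnormalize m (dirac (point : T))) => A.
by rewrite -[LHS]/(mnormalize m (dirac (point : T)) A) /mnormalize m1 onee_eq0/= invr1 mule1.
Qed.

(** The difference is formed as a charge, which the assumption makes nonnegative. *)
Lemma finite_measure_sub mu nu : mle nu mu ->
  exists rho : {finite_measure set T -> \bar R},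
    forall A, measurable A -> rho A = (mu A - nu A)%E.
Proof.
move=> numu.
pose c := cadd (charge_of_finite_measure mu) (copp (charge_of_finite_measure nu)).
pose c0 := crestr0 c measurableT.
have c0E A : measurable A -> c0 A = (mu A - nu A)%E.
  by move=> mA; rewrite /c0/= /crestr0 mem_set// /crestr setIT.
have c0_ge0 A : (0 <= c0 A)%E.
  have [mA|mA] := pselect (measurable A).
    by rewrite c0E// sube_ge0 ?numu// fin_num_measure.
  by rewrite /c0/= /crestr0 memNset.
have [|rho rhoE] := @finite_measure_of (measure_of_charge c0 c0_ge0).
  by rewrite -[X in (X < _)%E]/(c0 setT) c0E// ltey_eq fin_numB !fin_num_measure.
by exists rho => A mA; rewrite rhoE -[LHS]/(c0 A) c0E.
Qed.

Lemma finite_measure_comb (a b : R) mu nu : 0 <= a -> 0 <= b ->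
  exists rho : {finite_measure set T -> \bar R},
    (forall A, rho A = a%:E * mu A + b%:E * nu A)%E /\
    (forall h : T -> \bar R, measurable_fun setT h -> (forall x, 0 <= h x)%E ->
      \int[rho]_x h x = a%:E * \int[mu]_x h x + b%:E * \int[nu]_x h x)%E.
Proof.
move=> a0 b0.
pose m := measure_add (mscale (NngNum a0) mu) (mscale (NngNum b0) nu).
have mE A : m A = (a%:E * mu A + b%:E * nu A)%E by rewrite /m measure_addE.
have [|rho rhoE] := @finite_measure_of m.
  by rewrite -[X in (X < _)%E]/(m setT) mE ltey_eq fin_numD !fin_numM ?fin_num_measure.
exists rho; split => [A|h mh h0]; first by rewrite -mE; exact: rhoE.
transitivity (\int[m]_x h x)%E.
  by apply: eq_measure_integral => A mA _; exact: rhoE.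
rewrite ge0_integral_measure_add//.
by rewrite !ge0_integral_mscale.
Qed.

Lemma finite_measure_restr (D : set T) mu : measurable D ->
  exists rho : {finite_measure set T -> \bar R},
    (forall A, rho A = mu (A `&` D)) /\
    (forall h : T -> \bar R, measurable_fun setT h -> (forall x, 0 <= h x)%E ->
      \int[rho]_x h x = \int[mu]_(x in D) h x)%E.
Proof.
move=> mD; have muD : (mu D < +oo)%E by rewrite ltey_eq fin_num_measure.
exists (mfrestr mD muD); split => // h mh h0.
rewrite (@ge0_integral_density _ _ _ (mfrestr mD muD) mu (\1_D : T -> R))//.
- rewrite -[in RHS](setTI D) integral_mkcondr; apply: eq_integral => x _.
  by rewrite patchE indicE; case: ifPn => _; rewrite ?mule1 ?mule0.
- by move=> A mA; rewrite integral_indic// setIC.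
Qed.

Lemma integral_lt_cst mu D (g : T -> R) s : measurable D -> measurable_fun setT g ->
  (forall x, 0 <= g x) -> (forall x, D x -> g x < s) -> (0 < mu D)%E ->
  (\int[mu]_(x in D) (g x)%:E < s%:E * mu D)%E.
Proof.
move=> mD mg g0 gs muD.
have mgD : measurable_fun D (fun x => (g x)%:E).
  by apply: measurable_funTS; apply/measurable_EFinP.
have msg : measurable_fun D (fun x => (s - g x)%:E).
  by apply: measurable_funTS; apply/measurable_EFinP; exact: measurable_funB.
have sg0 x : D x -> (0 <= (s - g x)%:E)%E.
  by move=> Dx; rewrite lee_fin subr_ge0 ltW// gs.
have E : (s%:E * mu D = \int[mu]_(x in D) (g x)%:E + \int[mu]_(x in D) (s - g x)%:E)%E.
  rewrite -ge0_integralD//; last by move=> x _; rewrite lee_fin.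
  rewrite -integral_cst//; apply: eq_integral => x _.
  by rewrite -EFinD addrC subrK.
have fin : (s%:E * mu D)%E \is a fin_num by rewrite fin_numM// fin_num_measure.
have [g_fin sg_fin] : (\int[mu]_(x in D) (g x)%:E)%E \is a fin_num /\
    (\int[mu]_(x in D) (s - g x)%:E)%E \is a fin_num.
  by move: fin; rewrite E fin_numD => /andP.
rewrite E lteDl// lt0e integral_ge0// andbT; apply/eqP => I0.
have : ae_eq mu D (fun x => (s - g x)%:E) (cst 0%E).
  apply/(ae_eq_integral_abs mu mD msg); rewrite -[RHS]I0.
  by apply: eq_integral => x /[!inE] Dx; rewrite gee0_abs// sg0.
move=> [N [mN N0 sub]].
have DN : D `<=` N.
  move=> x Dx; apply: sub => /= /(_ Dx) /eqP; rewrite eqe subr_eq0 => /eqP h.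
  by have := gs x Dx; rewrite h ltxx.
have : (mu D <= mu N)%E by rewrite le_measure ?inE.
by rewrite N0 leNgt muD.
Qed.

(** Otherwise mu - nu has mass below the level s and nu has mass above it. Moving a
    fraction c2 of the latter to a fraction c1 of the former, with equal masses
    c2 d2 = c1 d1, gives an admissible measure r with a smaller integral. *)
Lemma bathtub_minimizer_level mu nu (g : T -> R) M s : mle nu mu ->
  measurable_fun setT g -> (forall x, 0 <= g x <= M) ->
  (forall rho : {finite_measure set T -> \bar R}, mle rho mu -> rho setT = nu setT ->
     (\int[nu]_x (g x)%:E <= \int[rho]_x (g x)%:E)%E) ->
  mu [set x | g x < s] = nu [set x | g x < s] \/ nu [set x | s <= g x] = 0%E.
Proof.
move=> numu mg gM nmin.
set D := [set x | g x < s].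
have mD : measurable D.
  by rewrite (_ : D = g @^-1` `]-oo, s[) -1?[X in measurable X]setTI; [exact: mg|
    apply/seteqP; split => x; rewrite /D/= in_itv].
have DC : [set x | s <= g x] = ~` D.
  by apply/seteqP; split => x; rewrite /D/= leNgt => /negP.
rewrite DC; have mDC : measurable (~` D) by exact: measurableC.
have [rho rhoE] := finite_measure_sub numu.
have fin (r : {finite_measure set T -> \bar R}) A : measurable A -> r A \is a fin_num.
  by move=> mA; exact: fin_num_measure.
have [|rD] := leP (rho D) 0%E.
  rewrite rhoE// sube_le0 => h; left; apply/eqP; rewrite eq_le h numu//.
have [|nD] := leP (nu (~` D)) 0%E.
  by move=> h; right; apply/eqP; rewrite eq_le h measure_ge0.
exfalso.
have g0 x : 0 <= g x by case/andP: (gM x).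
have mgE A : measurable_fun A (fun x => (g x)%:E).
  by apply: measurable_funTS; apply/measurable_EFinP.
have ge0 A x : A x -> (0 <= (g x)%:E)%E by rewrite lee_fin.
pose d1 := fine (rho D); pose d2 := fine (nu (~` D)).
have d1E : rho D = d1%:E by rewrite fineK// fin.
have d2E : nu (~` D) = d2%:E by rewrite fineK// fin.
have d10 : 0 < d1 by rewrite -lte_fin -d1E.
have d20 : 0 < d2 by rewrite -lte_fin -d2E.
pose c1 := Num.min 1 (d2 / d1).
have c10 : 0 < c1 by rewrite lt_min ltr01 divr_gt0.
have c11 : c1 <= 1 by rewrite ge_min lexx.
pose c2 := c1 * d1 / d2.
have c20 : 0 <= c2 by rewrite divr_ge0// ?mulr_ge0// ltW.
have c21 : c2 <= 1.
  by rewrite /c2 ler_pdivrMr// mul1r -ler_pdivlMr// ge_min lexx orbT.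
have [nuD [nuDE inuD]] := finite_measure_restr nu mD.
have [muD [muDE imuD]] := finite_measure_restr mu mD.
have [nuC [nuCE inuC]] := finite_measure_restr nu mDC.
have [r1 [r1E ir1]] := @finite_measure_comb (1 - c1) c1 nuD muD
  (ltac:(by rewrite subr_ge0)) (ltW c10).
have [r [rE ir]] := @finite_measure_comb 1 (1 - c2) r1 nuC ler01
  (ltac:(by rewrite subr_ge0)).
have nusplit A : measurable A -> nu A = (nu (A `&` D) + nu (A `&` ~` D))%E.
  by move=> mA; rewrite -{1}(setIT A) -(setUv D) setIUr measureU//;
    [exact: measurableI|exact: measurableI|
     rewrite setIACA setICr setI0].
have musplit A : measurable A -> mu A = (mu (A `&` D) + mu (A `&` ~` D))%E.
  by move=> mA; rewrite -{1}(setIT A) -(setUv D) setIUr measureU//;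
    [exact: measurableI|exact: measurableI|
     rewrite setIACA setICr setI0].
have fing (q : {finite_measure set T -> \bar R}) A : measurable A ->
    (\int[q]_(x in A) (g x)%:E)%E \is a fin_num.
  move=> mA; rewrite ge0_fin_numE; last by apply: integral_ge0 => x _; rewrite lee_fin.
  have MA : (\int[q]_(x in A) (g x)%:E <= M%:E * q A)%E.
    rewrite -integral_cst//; apply: ge0_le_integral => //.
    + by move=> x _; rewrite lee_fin.
    + by move=> x _; rewrite lee_fin; case/andP: (gM x).
  by rewrite (le_lt_trans MA)// ltey_eq fin_numM// fin.
have mle_r : mle r mu.
  move=> A mA; rewrite rE mul1e r1E nuDE muDE nuCE (musplit _ mA).
  have mAD := measurableI _ _ mA mD; have mAC := measurableI _ _ mA mDC.
  apply: leeD.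
    rewrite (@le_trans _ _ ((1 - c1)%:E * mu (A `&` D) + c1%:E * mu (A `&` D))%E)//.
      by rewrite leeD2r// lee_wpmul2l ?lee_fin ?subr_ge0// numu.
    by rewrite -muleDl ?fin// -?EFinD ?subrK ?mul1e.
  apply: (@le_trans _ _ (1%:E * nu (A `&` ~` D))%E); last by rewrite mul1e numu.
  by rewrite lee_wpmul2r// lee_fin gerBl.
have muDd : mu D = (nu D + d1%:E)%E.
  by rewrite -d1E rhoE// addeC subeK// fin.
have rmass : r setT = nu setT.
  rewrite rE mul1e r1E nuDE muDE nuCE !setTI (nusplit _ measurableT) !setTI.
  rewrite muDd d2E.
  have [y ->] : exists y, nu D = y%:E by exists (fine (nu D)); rewrite fineK// fin.
  rewrite -[LHS]/(((1 - c1) * y + c1 * (y + d1) + (1 - c2) * d2)%:E).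
  rewrite -EFinD; congr EFin.
  have : c2 * d2 = c1 * d1 by rewrite /c2 divfK// gt_eqF.
  lra.
have := nmin _ mle_r rmass.
have mg' : measurable_fun setT (fun x => (g x)%:E) by exact: mgE.
have g0' x : (0 <= (g x)%:E)%E by rewrite lee_fin.
rewrite (ir _ mg' g0') (ir1 _ mg' g0') (inuD _ mg' g0') (imuD _ mg' g0') (inuC _ mg' g0').
have -> : (\int[mu]_(x in D) (g x)%:E =
    \int[nu]_(x in D) (g x)%:E + \int[rho]_(x in D) (g x)%:E)%E.
  rewrite -ge0_integral_measure_add//; apply: eq_measure_integral => A mA _.
  by rewrite -[RHS]/(measure_add nu rho A) measure_addE [X in (_ + X)%E]rhoE// addeC subeK// fin.
have -> : (\int[nu]_x (g x)%:E =
    \int[nu]_(x in D) (g x)%:E + \int[nu]_(x in ~` D) (g x)%:E)%E.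
  rewrite -(setUv D) ge0_integral_setU//.
  by apply/disj_set2P; rewrite setICr.
have s0 : 0 < s.
  rewrite ltNge; apply/negP => s0; move: rD.
  rewrite (_ : D = set0) ?measure0 ?ltxx//; apply/seteqP; split => // x.
  by rewrite /D/= => /lt_le_trans/(_ s0); rewrite ltNge g0.
have := integral_lt_cst mD mg g0 (fun x (Dx : D x) => Dx) rD.
have : (s%:E * nu (~` D) <= \int[nu]_(x in ~` D) (g x)%:E)%E.
  rewrite -integral_cst//; apply: ge0_le_integral => //.
  + by move=> x _; rewrite lee_fin ltW.
  + by move=> x; rewrite /D/= lee_fin => /negP; rewrite -leNgt.
rewrite d1E d2E.
rewrite -(fineK (fing nu D mD)) -(fineK (fing rho D mD)) -(fineK (fing nu _ mDC)).
move: (fine _) (fine _) (fine _) => x y z.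
rewrite mul1e.
rewrite -[(_%:E + _ + _)%E]/(((1 - c1) * x + c1 * (x + y) + (1 - c2) * z)%:E).
rewrite -!EFinM -!EFinD !lee_fin lte_fin => h1 h2 h3.
have h4 : c2 * d2 = c1 * d1 by rewrite /c2 divfK// gt_eqF.
have h5 : c1 * y < c1 * (s * d1) by rewrite ltr_pM2l.
have h6 : c2 * (s * d2) <= c2 * z by rewrite ler_wpM2l.
have h7 : s * (c2 * d2) = s * (c1 * d1) by rewrite h4.
move: h3 h5 h6 h7; clear; lra.
Qed.

End FiniteMeasures.

(** * Extrema and supports on a compact metric space *)

Section CompactSpace.
Context {R : realType} {Omega : pmetricType R}.
Hypothesis Omega_compact : compact [set: Omega].
Variables (f : Omega -> R) (f_cont : continuous f).
Local Notation T := (borelType Omega).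

Lemma open_measurable_borel (A : set Omega) : open A -> measurable (A : set T).
Proof. by move=> oA; exact: sub_sigma_algebra. Qed.

Lemma continuous_measurable_borel : measurable_fun [set: T] (f : T -> R).
Proof.
apply: (measurability _ (RGenOpens.measurableE R)) => _ [_ [a [b ->] <-]].
rewrite setTI; apply: open_measurable_borel.
by move/continuousP: f_cont; apply; exact: interval_open.
Qed.

Lemma fmax_attained : exists2 x, f x = fmax f & forall y, f y <= f x.
Proof.
have [|x _ xM] := @compact_EVT_max Omega R f setT _ Omega_compact (continuous_subspaceT f_cont).
  by exists point.
exists x => [|y]; last by apply: xM; rewrite inE.
apply/eqP; rewrite eq_le; apply/andP; split.
  by apply: ub_le_sup; [exists (f x) => _ [y _ <-]; apply: xM; rewrite inE|exists x].
by apply: ge_sup; [exists (f x); exists x|move=> _ [y _ <-]; apply: xM; rewrite inE].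
Qed.

Lemma fmin_attained : exists2 x, f x = fmin f & forall y, f x <= f y.
Proof.
have [|x _ xM] := @compact_EVT_min Omega R f setT _ Omega_compact (continuous_subspaceT f_cont).
  by exists point.
exists x => [|y]; last by apply: xM; rewrite inE.
apply/eqP; rewrite eq_le; apply/andP; split.
  by apply: lb_le_inf; [exists (f x); exists x|move=> _ [y _ <-]; apply: xM; rewrite inE].
by apply: ge_inf; [exists (f x) => _ [y _ <-]; apply: xM; rewrite inE|exists x].
Qed.

Lemma le_fmax x : f x <= fmax f.
Proof. by have [y <- h] := fmax_attained; exact: h. Qed.

Lemma fmin_le x : fmin f <= f x.
Proof. by have [y <- h] := fmin_attained; exact: h. Qed.

Variable eta0 : {finite_measure set T -> \bar R}.

(** By compactness, K is covered by finitely many null open sets. *)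
Lemma measure0_disjoint_support (K : set Omega) : closed K -> measurable (K : set T) ->
  K `&` msupport eta0 = set0 -> eta0 K = 0%E.
Proof.
move=> cK mK K0.
have Kcpt : compact K by apply: (subclosed_compact cK Omega_compact).
pose D := [set U : set Omega | open U /\ eta0 U = 0%E].
move: Kcpt; rewrite compact_cover => /(_ (set Omega) D id).
case.
- by move=> U [].
- move=> x Kx; have : ~ msupport eta0 x.
    by move=> sx; have : (K `&` msupport eta0) x by []; rewrite K0.
  rewrite /msupport/= => /existsNP[U /not_implyP[oU]].
  move=> /negP; rewrite -leNgt => h.
  exists U; last exact: oU.2.
  by split; [exact: oU.1|apply/eqP; rewrite eq_le h measure_ge0].
move=> D' D'D KD'.
have H (s : seq (set Omega)) : {subset s <= D} ->
    measurable (\big[setU/set0]_(U <- s) U : set T) /\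
    eta0 (\big[setU/set0]_(U <- s) U) = 0%E.
  elim: s => [_|U s ih sD]; first by rewrite big_nil.
  have [mU eU] : measurable (U : set T) /\ eta0 U = 0%E.
    have := sD U (mem_head _ _); rewrite inE => -[oU ->]; split => //.
    exact: open_measurable_borel.
  have [ms es] : measurable (\big[setU/set0]_(U <- s) U : set T) /\
      eta0 (\big[setU/set0]_(U <- s) U) = 0%E.
    by apply: ih => V Vs; apply: sD; rewrite inE Vs orbT.
  rewrite big_cons; split; first exact: measurableU.
  apply/eqP; rewrite eq_le measure_ge0 andbT.
  apply: (le_trans (measureU2 _ mU ms)).
  by rewrite [X in (X + _)%E]eU [X in (_ + X)%E]es adde0.
have [mH eH] := H (finmap.enum_fset D') D'D.
apply/eqP; rewrite eq_le measure_ge0 andbT -eH le_measure ?inE//.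
by move=> x /KD' [U UD Ux]; rewrite -bigcup_seq; exists U.
Qed.

(** The set is a countable union of closed sets that do not meet the support. *)
Lemma measure0_below_support : eta0 [set x | f x < min_on (msupport eta0) f] = 0%E.
Proof.
set f1 := min_on _ _.
have mcl s : measurable ([set x | f x <= s] : set T).
  rewrite (_ : [set x | f x <= s] = f @^-1` `]-oo, s]).
    by rewrite -[X in measurable X]setTI; exact: continuous_measurable_borel.
  by apply/seteqP; split => x; rewrite /= in_itv.
have -> : [set x | f x < f1] = \bigcup_n [set x | f x <= f1 - n.+1%:R^-1].
  apply/seteqP; split => x /=.
    rewrite -subr_gt0 => h.
    have [N _ /(_ N (leqnn N)) hN] := near_infty_natSinv_lt (PosNum h).
    by exists N => //=; rewrite lerBrDr -lerBrDl ltW.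
  by move=> [n _ /= h]; rewrite (le_lt_trans h)// ltrBlDr ltrDl.
apply/eqP; rewrite eq_le measure_ge0 andbT.
pose F n := [set x | f x <= f1 - n.+1%:R^-1] : set T.
apply: (@le_trans _ _ (\sum_(0 <= n <oo) eta0 (F n))%E).
  apply: measure_sigma_subadditive => //.
  - by move=> n; exact: mcl.
  - by apply: bigcup_measurable => n _; exact: mcl.
rewrite eseries0// => n _ _; apply: measure0_disjoint_support.
- apply: (@closed_comp _ _ f [set y | y <= f1 - n.+1%:R^-1]); last exact: closed_le.
  by move=> x _; exact: f_cont.
- exact: mcl.
apply/seteqP; split => // x [/= h sx].
have : f1 <= f x.
  rewrite /f1 /min_on; case: ifPn => [/eqP s0|_]; first by move: sx; rewrite s0.
  apply: ge_inf; last by exists x.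
  by exists (fmin f) => _ [y _ <-]; exact: fmin_le.
by move=> /le_trans/(_ h); rewrite leNgt ltrBlDr ltrDl invr_gt0 ltr0n.
Qed.

(** An open set {f < u} of measure 0 contains no point of the support. *)
Lemma le_min_on_support u : u <= fmax f -> eta0 [set x | f x <= u] = 0%E ->
  u <= min_on (msupport eta0) f.
Proof.
move=> uM eu; rewrite /min_on; case: ifPn => // /set0P[x sx].
apply: lb_le_inf; first by exists (f x); exists x.
move=> _ [y sy <-]; rewrite leNgt; apply/negP => fyu.
have oU : open [set z | f z < u].
  by move/continuousP: f_cont => /(_ [set r | r < u]); apply; exact: open_lt.
have := sy [set z | f z < u] (conj oU fyu).
rewrite ltNge -eu => /negP; apply; apply: le_measure; rewrite ?inE.
- exact: open_measurable_borel.
- rewrite (_ : [set z | f z <= u] = f @^-1` `]-oo, u]).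
    by rewrite -[X in measurable X]setTI; exact: continuous_measurable_borel.
  by apply/seteqP; split => z; rewrite /= in_itv.
- by move=> z /= /ltW.
Qed.

End CompactSpace.

(** * Partitions into level sets and random measures *)

Section Cells.
Context d (T : measurableType d) (R : realType).

Lemma bounded_integrable (mu : {finite_measure set T -> \bar R}) (h : T -> R) (M : R) :
  measurable_fun setT h -> (forall x, `|h x| <= M) -> mu.-integrable setT (EFin \o h).
Proof.
move=> mh hM; apply: measurable_bounded_integrable => //.
  by rewrite ltey_eq fin_num_measure.
by exists M; split; [exact: num_real|move=> N MN x _; apply: (le_trans (hM x)); exact: ltW].
Qed.

Section Partition.
Variables (mu : {finite_measure set T -> \bar R}) (k : nat) (A : 'I_k -> set T).
Hypotheses (mA : forall i, measurable (A i)) (tA : trivIset setT A)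
  (cA : \bigcup_i A i = setT).

Let cell_fun (c : 'I_k -> R) x := (\sum_i (c i)%:E * (\1_(A i) x)%:E)%E.

Let cell_funE c i x : A i x -> cell_fun c x = (c i)%:E.
Proof.
move=> Aix; rewrite /cell_fun (bigD1 i)//= big1 ?adde0; first by rewrite indicE mem_set// mule1.
move=> j ji; rewrite indicE memNset ?mule0// => Ajx.
by move/eqP: ji; apply; apply: (tA (i:=j) (j:=i)) => //; exists x.
Qed.

Let integrable_cell (c : 'I_k -> R) i :
  mu.-integrable setT (fun x => ((c i)%:E * (\1_(A i) x)%:E)%E).
Proof. by apply: integrableZl => //; apply: integrable_indic. Qed.

Let integral_cell_fun c :
  (\int[mu]_x cell_fun c x = (\sum_i c i * fine (mu (A i)))%:E)%E.
Proof.
rewrite (integral_sum measurableT (integrable_cell c)).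
rewrite -sumEFin; apply: eq_bigr => i _.
rewrite integralZl//; last exact: integrable_indic.
by rewrite integral_indic// setIT EFinM fineK// fin_num_measure.
Qed.

Lemma integral_le_cells (h : T -> R) (c : 'I_k -> R) (M : R) :
  measurable_fun setT h -> (forall x, `|h x| <= M) ->
  (forall i x, A i x -> h x <= c i) ->
  (\int[mu]_x (h x)%:E <= (\sum_i c i * fine (mu (A i)))%:E)%E.
Proof.
move=> mh hM hc; rewrite -integral_cell_fun; apply: le_integral => //.
- exact: bounded_integrable mh hM.
- by apply: integrable_sum => // i _; exact: integrable_cell.
move=> x _; have [i _ Aix] : (\bigcup_i A i) x by rewrite cA.
by rewrite (cell_funE _ Aix) lee_fin hc.
Qed.

Lemma sum_measure_cells : \sum_i fine (mu (A i)) = fine (mu setT).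
Proof.
have /(congr1 fine)/= := integral_cell_fun (fun=> 1).
under [in RHS]eq_bigr do rewrite mul1r.
move=> <-; congr fine.
rewrite -[RHS]mul1e -integral_cst//; apply: eq_integral => x _.
have [i _ Aix] : (\bigcup_i A i) x by rewrite cA.
by rewrite (cell_funE _ Aix).
Qed.

End Partition.

Lemma sum_probability_cells (P : probability T R) k (A : 'I_k -> set T) :
  (forall i, measurable (A i)) -> trivIset setT A -> \bigcup_i A i = setT ->
  \sum_i fine (P (A i)) = 1.
Proof.
move=> mA tA cA; rewrite (sum_measure_cells P mA tA cA).
by have /(congr1 fine) := probability_setT P.
Qed.

End Cells.

Section RandomMeasure.
Context d (W : measurableType d) d' (T : measurableType d') (R : realType).
Context (P : probability W R) (X : {RV P >-> pprobability T R}).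

Lemma measurable_random_measure (A : set T) : measurable A ->
  measurable_fun setT (fun w => (X w : probability T R) A).
Proof.
move=> mA; have mX : measurable_fun [set: W] (X : W -> pprobability T R).
  exact: measurable_funPT.
exact: (measurable_kernel (kprobability mX) A mA).
Qed.

(** The random probability measure is a kernel. *)
Lemma measurable_random_integral (h : T -> R) : measurable_fun setT h ->
  (forall x, 0 <= h x) ->
  measurable_fun setT (fun w => \int[(X w : probability T R)]_x (h x)%:E)%E.
Proof.
move=> mh h0; apply: measurable_fun_integral_kernel.
- exact: measurable_random_measure.
- by move=> z; rewrite lee_fin.
- exact/measurable_EFinP.
Qed.

End RandomMeasure.

Section LevelCells.
Context d (T : measurableType d) (R : realType).
Variables (f : T -> R) (lo hi : R) (n : nat).
Hypotheses (mf : measurable_fun setT f) (lof : forall x, lo <= f x)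
  (fhi : forall x, f x <= hi).

Definition ncells := (Num.truncn ((hi - lo) * n.+1%:R)).+1.
Definition level_cell (i : 'I_ncells) : set T :=
  [set x | Num.truncn ((f x - lo) * n.+1%:R) = i].

Lemma level_cellE i : level_cell i =
  [set x | lo + i%:R / n.+1%:R <= f x < lo + i.+1%:R / n.+1%:R].
Proof.
apply/seteqP; split => x; rewrite /level_cell/=.
  move/eqP; rewrite truncn_eq ?mulr_ge0 ?subr_ge0// => /andP[h1 h2].
  by rewrite -lerBrDl ler_pdivrMr// h1 -ltrBlDl ltr_pdivlMr.
rewrite -lerBrDl ler_pdivrMr// -ltrBlDl ltr_pdivlMr// => h.
by apply/eqP; rewrite truncn_eq ?mulr_ge0 ?subr_ge0.
Qed.

Lemma measurable_level_cell i : measurable (level_cell i).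
Proof.
rewrite level_cellE -[X in measurable X]setTI.
rewrite (_ : [set x | _] = f @^-1` `[lo + i%:R / n.+1%:R, lo + i.+1%:R / n.+1%:R[).
  exact: mf.
by apply/seteqP; split => x; rewrite /= in_itv.
Qed.

Lemma trivIset_level_cell : trivIset setT level_cell.
Proof.
move=> i j _ _ [x [/= xi xj]]; apply/val_inj => /=.
by move: xi xj; rewrite /level_cell/= => -> ->.
Qed.

Lemma bigcup_level_cell : \bigcup_i level_cell i = setT.
Proof.
apply/seteqP; split => // x _.
have h : (Num.truncn ((f x - lo) * n.+1%:R) < ncells)%N.
  by rewrite ltnS le_truncn// ler_wpM2r// lerB.
by exists (Ordinal h).
Qed.

(** An upper bound of f on the cell, capped so that it remains below hi. *)
Definition cell_top (i : 'I_ncells) : R := Num.min (lo + i.+1%:R / n.+1%:R) hi.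

Lemma cell_topP i x : level_cell i x -> f x <= cell_top i <= f x + n.+1%:R^-1.
Proof.
rewrite level_cellE/= => /andP[h1 h2]; rewrite le_min (ltW h2) fhi/=.
rewrite ge_min; apply/orP; left.
by rewrite -(natr1 i) mulrDl mul1r addrA lerD2r.
Qed.

Lemma cell_top_itv i : lo <= hi -> lo <= cell_top i <= hi.
Proof. by move=> lh; rewrite le_min lh lerDl divr_ge0//= ge_min lexx orbT. Qed.

Lemma cell_top_lt i j : cell_top j < cell_top i -> (j < i)%N.
Proof.
rewrite ltnNge; apply: contraTN => ij; rewrite -leNgt.
rewrite le_min [X in _ && X]ge_min lexx orbT andbT ge_min; apply/orP; left.
by rewrite lerD2l ler_pM2r ?invr_gt0// ler_nat.
Qed.

End LevelCells.

(** * The exponential bound for the Dirichlet process *)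

Lemma ln_prod (R : realType) (I : finType) (F : I -> R) : (forall i, 0 < F i) ->
  ln (\prod_i F i) = \sum_i ln (F i).
Proof.
move=> F0; suff [] : 0 < \prod_i F i /\ ln (\prod_i F i) = \sum_i ln (F i) by [].
elim/big_rec2 : _ => [|i x y _ [y0 yE]]; first by rewrite ltr01 ln1.
by rewrite mulr_gt0// lnM ?posrE// yE.
Qed.

Lemma norm_le_bounds (R : realType) (a b x : R) : a <= x -> x <= b -> `|x| <= `|a| + `|b|.
Proof.
move=> ax xb; rewrite ler_norml; move: (ler_norm b) (ler_norm (- a)); rewrite normrN.
move: (normr_ge0 a) (normr_ge0 b) => *; apply/andP; split; lra.
Qed.

Section RandomIntegralTail.
Context {R : realType} {Omega : pmetricType R}.
Local Notation T := (borelType Omega).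
Hypothesis Omega_compact : compact [set: Omega].
Variables (alpha : R) (nu0 : probability T R) (f : Omega -> R) (u : R).
Hypotheses (alpha_gt0 : 0 < alpha) (nu0_support : msupport nu0 = [set: Omega])
  (f_cont : continuous f) (u_ge : fmin f <= u) (u_lt : u < fmax f).
Variable eta0 : {finite_measure set T -> \bar R}.
Hypotheses (eta0_concentrated : eta0 [set x | f x <= u] = 0%E)
  (eta0_le : mle eta0 (fun A => alpha%:E * nu0 A)%E).
Local Notation f1 := (min_on (msupport eta0) f).
Hypothesis gap_gt0 : 0 < f1 - fmin f.
Local Notation a := (fine (eta0 setT)).

Let mf : measurable_fun [set: T] (f : T -> R) := continuous_measurable_borel f_cont.
Let lof := fmin_le Omega_compact f_cont.
Let fhi := le_fmax Omega_compact f_cont.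

Let fin (mu : {finite_measure set T -> \bar R}) A : measurable A -> mu A \is a fin_num.
Proof. exact: fin_num_measure. Qed.

(** eta0 vanishes on a nonempty open set, {f < u} if u > fmin f and {f < f1} otherwise,
    to which nu0 gives mass by the assumption on its support. *)
Lemma dominated_mass_lt : a < alpha.
Proof.
have [U [mU U0 nuU]] : exists U : set T, [/\ measurable U, eta0 U = 0%E & (0 < nu0 U)%E].
  have [x fx _] := fmin_attained Omega_compact f_cont.
  have oU s : open [set y | f y < s].
    by move/continuousP: f_cont => /(_ [set r | r < s]); apply; exact: open_lt.
  have nU s : fmin f < s -> (0 < nu0 [set y | (f y < s)%R])%E.
    move=> us; have : msupport nu0 x by rewrite nu0_support.
    by apply; split; [exact: (oU s)|rewrite /= fx].
  have mU s : measurable ([set y | f y < s] : set T) by apply: open_measurable_borel; exact: (oU s).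
  have [fu|fu] := ltP (fmin f) u.
    exists [set y | f y < u]; split; [exact: mU| |exact: nU].
    apply/eqP; rewrite eq_le measure_ge0 andbT -eta0_concentrated le_measure ?inE//.
    + by rewrite -[X in measurable X]setTI (_ : [set x | _] = f @^-1` `]-oo, u]);
        [exact: mf|apply/seteqP; split => y; rewrite /= in_itv].
    + by move=> y /= /ltW.
  exists [set y | f y < f1]; split; [exact: mU| |].
  + exact: measure0_below_support.
  + by apply: nU; rewrite -subr_gt0.
have mCU : measurable (~` U) by exact: measurableC.
have : (eta0 setT <= alpha%:E * nu0 (~` U))%E.
  rewrite -(setUv U) measureU//; last exact: setICr.
  by rewrite [X in (X + _)%E]U0 add0e eta0_le.
rewrite probability_setC// -(fineK (fin nu0 mU)) -EFinB -EFinM.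
rewrite -(fineK (fin eta0 measurableT)) lee_fin => /le_lt_trans; apply.
rewrite gtr_pMr// gtrBl -lte_fin fineK//; exact: fin.
Qed.

Variable m : R.
Hypotheses (m_ge0 : 0 <= m)
  (m_le : m <= Sfun a (alpha - a) ((u - fmin f) / (f1 - fmin f))).

Let f1u : u <= f1.
Proof. by apply: le_min_on_support => //; exact: ltW. Qed.

Let m_leP : m <= a /\
  (forall x, 0 < x <= (u - fmin f) / (f1 - fmin f) -> x < 1 -> tail_cond a (alpha - a) m x).
Proof.
apply: Sfun_tail_cond => //; first by rewrite subr_gt0 dominated_mass_lt.
rewrite divr_ge0 ?subr_ge0//=; last by rewrite -subr_ge0 ltW.
by rewrite ler_pdivrMr// mul1r lerB.
Qed.

Lemma removed_mass_lt : m < alpha.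
Proof. by apply: le_lt_trans dominated_mass_lt; case: m_leP. Qed.

Variable eta : {finite_measure set T -> \bar R}.
Hypotheses (eta_le : mle eta eta0) (eta_mass : eta setT = m%:E)
  (eta_min : forall mu : {finite_measure set T -> \bar R},
       mle mu eta0 -> mu setT = m%:E ->
       (\int[eta]_x (f x)%:E <= \int[mu]_x (f x)%:E)%E).

(** The minimality of eta is stated for f, which differs from f - fmin f >= 0 by a
    multiple of the common total mass. *)
Lemma removed_below (s : R) :
  eta0 [set x | f x < s] = eta [set x | f x < s] \/ eta [set x | s <= f x] = 0%E.
Proof.
have mg : measurable_fun [set: T] (fun x : T => f x - fmin f).
  by apply: measurable_funB => //; exact: measurable_cst.
have gM (x : T) : 0 <= f x - fmin f <= fmax f - fmin f.
  by rewrite subr_ge0 lof lerD2r fhi.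
have fb x : `|f x| <= `|fmin f| + `|fmax f|.
  by apply: norm_le_bounds.
have intg (rho : {finite_measure set T -> \bar R}) :
    (\int[rho]_x (f x - fmin f)%:E = \int[rho]_x (f x)%:E - (fmin f)%:E * rho setT)%E.
  have i1 : rho.-integrable [set: T] (EFin \o (f : T -> R)) by exact: bounded_integrable mf fb.
  have i2 : rho.-integrable [set: T] (EFin \o (fun=> fmin f : R) : T -> \bar R).
    by apply: (@bounded_integrable _ _ _ _ _ `|fmin f|).
  by rewrite -integral_cst// -(integralB_EFin measurableT i1 i2).
have h : forall rho : {finite_measure set T -> \bar R},
    mle rho eta0 -> rho setT = eta setT ->
    (\int[eta]_x (f x - fmin f)%:E <= \int[rho]_x (f x - fmin f)%:E)%E.
  move=> rho rhole rhoT; rewrite !intg rhoT leeB// eta_min//.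
  by rewrite rhoT.
have := @bathtub_minimizer_level _ _ _ _ _ _ _ (s - fmin f) eta_le mg gM h.
rewrite (_ : [set x | f x - fmin f < s - fmin f] = [set x | f x < s]); last first.
  by apply/seteqP; split => x /=; rewrite ltrD2r.
rewrite (_ : [set x | s - fmin f <= f x - fmin f] = [set x | s <= f x])//.
by apply/seteqP; split => x /=; rewrite lerD2r.
Qed.

Context d (W : measurableType d) (P : probability W R).
Variable X : {RV P >-> pprobability T R}.
Hypothesis X_DP : is_DirichletProcess X alpha nu0.

Local Notation tail :=
  [set w | (u%:E <= \int[(X w : probability T R)]_x (f x)%:E)%E].

Section FixedMesh.
Variable n : nat.
Local Notation cell := (@level_cell _ T R f (fmin f) (fmax f) n).
Local Notation top := (@cell_top R (fmin f) (fmax f) n).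

Let mcell i : measurable (cell i) := measurable_level_cell mf lof i.
Let tcell : trivIset setT cell := @trivIset_level_cell _ T R f _ _ n.
Let ccell : \bigcup_i cell i = setT := @bigcup_level_cell _ T R f (fmin f) (fmax f) n fhi.

Let topP i (x : T) : cell i x -> f x <= top i <= f x + n.+1%:R^-1.
Proof. exact: (@cell_topP _ T R f _ _ n lof fhi). Qed.

Let fb (x : T) : `|f x| <= `|fmin f| + `|fmax f|.
Proof. exact: norm_le_bounds. Qed.

Let mtail : measurable tail.
Proof.
pose h (x : T) := f x - fmin f.
have mh : measurable_fun [set: T] h.
  by apply: measurable_funB => //; exact: measurable_cst.
have h0 x : 0 <= h x by rewrite subr_ge0.
have mI := measurable_random_integral X mh h0.
rewrite (_ : tail = setT `&`
   [set w | ((u - fmin f)%:E <= \int[(X w : probability T R)]_x (h x)%:E)%E]).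
  exact: emeasurable_fun_c_infty.
rewrite setTI; apply/seteqP.
have E w : (\int[(X w : probability T R)]_x (h x)%:E =
    \int[(X w : probability T R)]_x (f x)%:E - (fmin f)%:E)%E.
  have i1 : (X w : probability T R).-integrable [set: T] (EFin \o (f : T -> R)).
    exact: bounded_integrable mf fb.
  have i2 : (X w : probability T R).-integrable [set: T] (EFin \o (fun=> fmin f : R) : T -> \bar R).
    by apply: (@bounded_integrable _ _ _ _ _ `|fmin f|).
  rewrite -[X in (_ - X)%E]mule1 -(@probability_setT _ _ _ (X w)) -integral_cst//.
  by rewrite -(integralB_EFin measurableT i1 i2).
split => w /=; rewrite E EFinB.
  by move=> ?; rewrite leeD2r.
by rewrite leeD2rE.
Qed.

Let tail_sub : tail `<=`
  [set w | (u <= \sum_i top i * fine ((X w : probability T R) (cell i)))%R].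
Proof.
move=> w /= uw; rewrite -lee_fin (le_trans uw)//.
apply: (@integral_le_cells _ T R (X w : probability T R) _ _ mcell tcell ccell f _ _ mf fb) => i x /topP.
by case/andP.
Qed.

Let finP (A : set T) : measurable A -> (alpha%:E * nu0 A = (alpha * fine (nu0 A))%:E)%E.
Proof. by move=> mA; rewrite EFinM fineK//; exact: fin. Qed.

Let fine_le A : measurable A -> fine (eta A) <= fine (eta0 A) <= alpha * fine (nu0 A).
Proof.
move=> mA; apply/andP; split; first by rewrite fine_le ?fin ?eta_le.
by rewrite -lee_fin fineK ?fin// -finP// eta0_le.
Qed.

(** A cell charged by eta0 contains a point of f > u above the minimum of f on the
    support. *)
Let above_support i : 0 < fine (eta0 (cell i)) -> 0 < top i - u /\ f1 - u <= top i - u.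
Proof.
move=> ei; have [x [xi ux fx]] : exists x, [/\ cell i x, u < f x & f1 <= f x].
  apply: contrapT => H.
  suff : fine (eta0 (cell i)) <= 0 by rewrite leNgt ei.
  rewrite -lee_fin fineK ?fin//.
  pose N := [set x | f x <= u] `|` [set x | f x < f1].
  have m1 : measurable ([set x | f x <= u] : set T).
    by rewrite -[X in measurable X]setTI (_ : [set x | _] = f @^-1` `]-oo, u]);
        [exact: mf|apply/seteqP; split => y; rewrite /= in_itv].
  have m2 : measurable ([set x | f x < f1] : set T).
    by rewrite -[X in measurable X]setTI (_ : [set x | _] = f @^-1` `]-oo, f1[);
        [exact: mf|apply/seteqP; split => y; rewrite /= in_itv].
  apply: (@le_trans _ _ (eta0 N)).
    apply: le_measure; rewrite ?inE//; first exact: measurableU.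
    move=> x xi; have [|ux] := leP (f x) u; [by left|].
    have [|fx] := ltP (f x) f1; [by right|].
    by exfalso; apply: H; exists x.
  apply: (le_trans (measureU2 _ m1 m2)).
  by rewrite [X in (X + _)%E]eta0_concentrated [X in (_ + X)%E]measure0_below_support// adde0.
have /andP[h _] := topP xi.
by rewrite subr_gt0 lerD2r (lt_le_trans ux)//; split => //; exact: le_trans h.
Qed.

(** The levels cut between the cells j < i separate eta from eta0 - eta. *)
Let removed_first i j : 0 < fine (eta (cell i)) ->
  0 < fine (eta0 (cell j)) - fine (eta (cell j)) -> top i <= top j.
Proof.
move=> ei cj; rewrite leNgt; apply/negP => /cell_top_lt ji.
pose s := fmin f + j.+1%:R / n.+1%:R.
have ms1 : measurable ([set x | f x < s] : set T).
  by rewrite -[X in measurable X]setTI (_ : [set x | _] = f @^-1` `]-oo, s[);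
      [exact: mf|apply/seteqP; split => y; rewrite /= in_itv].
have ms2 : measurable ([set x | s <= f x] : set T).
  by rewrite -[X in measurable X]setTI (_ : [set x | _] = f @^-1` `[s, +oo[);
      [exact: mf|apply/seteqP; split => y; rewrite /= in_itv/= andbT].
case: (removed_below s) => [h|h].
  have [rho rhoE] := finite_measure_sub eta_le.
  have : (rho (cell j) <= rho [set x | (f x < s)%R])%E.
    rewrite le_measure ?inE// => x; rewrite level_cellE//= => /andP[_ ?].
    by [].
  rewrite !rhoE// [X in (_ <= X - _)%E]h subee ?fin// leNgt => /negP; apply.
  by rewrite -(fineK (fin eta0 (mcell j))) -(fineK (fin eta (mcell j))) lte_fin.
have : (eta (cell i) <= eta [set x | (s <= f x)%R])%E.
  rewrite le_measure ?inE// => x; rewrite level_cellE//= => /andP[+ _].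
  by apply: le_trans; rewrite lerD2l ler_pM2r ?invr_gt0// ler_nat.
by rewrite h -(fineK (fin eta (mcell i))) lee_fin leNgt ei.
Qed.

(** Replacing f by its upper bounds on the cells makes the integral a linear function
    of a Dirichlet vector; the three groups of gamma variables come from
    alpha nu0 = eta + (eta0 - eta) + (alpha nu0 - eta0). *)
Lemma random_integral_cells_tail_le (la : R) : 0 <= la -> la * (fmax f - u) < 1 ->
  (P tail <= (\prod_i (1 - la * (top i - u)) `^
     (- (alpha * fine (nu0 (cell i)) - fine (eta (cell i)))))%:E)%E.
Proof.
move=> la0 la1.
pose Y i w := fine ((X w : probability T R) (cell i)).
have Y1 w : \sum_i Y i w = 1.
  exact: (sum_probability_cells (X w : probability T R) mcell tcell ccell).
have mY i : measurable_fun setT (Y i).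
  by apply: measurableT_comp => //; exact: measurable_random_measure.
apply: (@le_trans _ _ (P [set w | (u <= \sum_i top i * Y i w)%R])).
  apply: le_measure; rewrite ?inE//.
  rewrite -[X in measurable X]setTI.
  rewrite (_ : [set w | _] = (fun w => \sum_i top i * Y i w) @^-1` `[u, +oo[).
    have mS : measurable_fun setT (fun w => \sum_i top i * Y i w).
      by apply: measurable_sum => i; exact: measurable_funM.
    exact: mS.
  by apply/seteqP; split => w; rewrite /= in_itv/= andbT.
apply: (le_trans (Dirichlet_tail_le top u (X_DP mcell tcell ccell) Y1)).
pose e i := fine (eta (cell i)).
pose c i := fine (eta0 (cell i)) - fine (eta (cell i)).
pose b i := alpha * fine (nu0 (cell i)) - fine (eta0 (cell i)).
have sume : \sum_i e i = m.
  by rewrite /e (sum_measure_cells _ mcell tcell ccell) eta_mass.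
have sumec : \sum_i e i + \sum_i c i = a.
  rewrite -big_split/= -(sum_measure_cells eta0 mcell tcell ccell).
  by apply: eq_bigr => i _; rewrite /e /c addrC subrK.
have sumb : \sum_i b i = alpha - a.
  rewrite /b sumrB -mulr_sumr (sum_probability_cells nu0 mcell tcell ccell) mulr1.
  by rewrite (sum_measure_cells _ mcell tcell ccell).
rewrite (_ : (fun i => alpha * fine (nu0 (cell i))) = fun i => b i + (c i + e i)); last first.
  by apply/funext => i; rewrite /b /c /e subrK subrK.
under eq_bigr => i _.
  rewrite (_ : alpha * fine (nu0 (cell i)) - fine (eta (cell i)) = c i + b i); last first.
    by rewrite /b /c [RHS]addrC addrA subrK.
  over.
have lohi : fmin f <= fmax f by exact: le_trans u_ge (ltW u_lt).
apply: (@gamma_means_step_le _ _ (fun i => top i - u) e c b (fmin f - u) (fmax f - u) (f1 - u) la) => //.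
- by move=> i; rewrite fine_ge0.
- by move=> i; rewrite subr_ge0; case/andP: (fine_le (mcell i)).
- by move=> i; rewrite subr_ge0; case/andP: (fine_le (mcell i)).
- by move=> i; rewrite !lerD2r; exact: cell_top_itv.
- by rewrite sumb subr_gt0 dominated_mass_lt.
- move=> i ec; apply: above_support; case/andP: (fine_le (mcell i)) => h _.
  have e0 : 0 <= fine (eta (cell i)) by exact: fine_ge0.
  case: ec => [/lt_le_trans|]; first exact.
  by rewrite subr_gt0; apply: le_lt_trans.
- by move=> i j ei cj; rewrite lerD2r removed_first.
move=> v v0 v1 v2; rewrite sumec sumb sume; apply: (proj2 m_leP) => //.
rewrite v0/= ler_pdivlMr//; move: v1.
by rewrite !opprB addrA subrK.
Qed.

End FixedMesh.

Variable nu : probability T R.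
Hypothesis nuE : forall A, measurable A ->
  nu A = ((alpha%:E * nu0 A - eta A) * ((alpha - m)^-1)%:E)%E.

Let fine_nuE A : measurable A ->
  alpha * fine (nu0 A) - fine (eta A) = (alpha - m) * fine (nu A).
Proof.
move=> mA; rewrite nuE// -(fineK (fin nu0 mA)) -(fineK (fin eta mA)).
rewrite -[X in _ = _ * fine X]/(((alpha * fine (nu0 A) - fine (eta A)) / (alpha - m))%:E).
by rewrite /= mulrCA divff ?mulr1// subr_eq0 gt_eqF// removed_mass_lt.
Qed.

(** The mesh of the partition tends to 0: as a function of f, ln (1 - la (f - u)) is
    Lipschitz with constant la / D. *)
Lemma lne_random_integral_tail_le (la : R) : 0 <= la -> la * (fmax f - u) < 1 ->
  (lne (P tail) <= - ((alpha - m)%:E * \int[nu]_x (ln (1 - la * (f x - u)))%:E))%E.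
Proof.
move=> la0 la1.
pose h (x : T) := ln (1 - la * (f x - u)).
pose D := 1 - la * (fmax f - u).
have D0 : 0 < D by rewrite subr_gt0.
have qD y : y <= fmax f -> D <= 1 - la * (y - u).
  by move=> yf; rewrite lerD2l lerN2 ler_wpM2l// lerD2r.
have mh : measurable_fun [set: T] h.
  apply: measurableT_comp; first exact: measurable_ln.
  apply: measurable_funB; first exact: measurable_cst.
  by apply: measurable_funM; [exact: measurable_cst|apply: measurable_funB => //; exact: measurable_cst].
have hb (x : T) : `|h x| <= `|ln D| + `|ln (1 - la * (fmin f - u))|.
  have q0 : 0 < 1 - la * (f x - u) by rewrite (lt_le_trans D0)// qD.
  apply: norm_le_bounds; rewrite ler_ln ?posrE ?qD//.
  + by rewrite lerD2l lerN2 ler_wpM2l// lerD2r.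
  + by rewrite (lt_le_trans q0)// lerD2l lerN2 ler_wpM2l// lerD2r.
have ih : nu.-integrable [set: T] (EFin \o h) by exact: bounded_integrable mh hb.
have Ifin : (\int[nu]_x (h x)%:E)%E \is a fin_num by exact: integrable_fin_num ih.
rewrite -/(h _) -(fineK Ifin) -EFinM -EFinN; set I := fine _.
have am : 0 < alpha - m by rewrite subr_gt0 removed_mass_lt.
have [P0|P0] := leP (P tail) 0%E; first by rewrite le0_lneNy// leNye.
have [p pE] : exists p, P tail = p%:E.
  exists (fine (P tail)); rewrite fineK// ge0_fin_numE ?measure_ge0//.
  exact: le_lt_trans (random_integral_cells_tail_le 0 la0 la1) (ltry _).
rewrite pE lte_fin in P0 *; rewrite lne_EFin// lee_fin.
apply/ler_addgt0Pr => eps eps0.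
pose C := la / D * (alpha - m).
have C0 : 0 <= C by rewrite mulr_ge0 ?divr_ge0 ?(ltW D0) ?(ltW am).
have eC : 0 < eps / (C + 1) by rewrite divr_gt0// ltr_wpDl.
(* a mesh for which the error C / (n + 1) is at most eps *)
have [n _ /(_ n (leqnn n)) hn] := near_infty_natSinv_lt (PosNum eC).
have := @random_integral_cells_tail_le n la la0 la1.
rewrite pE lee_fin; set Pi := \prod_i _ => pPi.
pose cell := @level_cell _ T R f (fmin f) (fmax f) n.
pose top := @cell_top R (fmin f) (fmax f) n.
have mcell i : measurable (cell i) := measurable_level_cell mf lof i.
have tcell : trivIset setT cell := @trivIset_level_cell _ T R f _ _ n.
have ccell : \bigcup_i cell i = setT := @bigcup_level_cell _ T R f (fmin f) (fmax f) n fhi.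
have topD i : D <= 1 - la * (top i - u).
  by apply: qD; rewrite /top /cell_top ge_min lexx orbT.
have topD0 i : 0 < 1 - la * (top i - u) by exact: lt_le_trans (topD i).
have lnPi : ln Pi = - ((alpha - m) * \sum_i ln (1 - la * (top i - u)) * fine (nu (cell i))).
  rewrite /Pi ln_prod; last by move=> i; rewrite powR_gt0.
  rewrite mulr_sumr -sumrN; apply: eq_bigr => i _.
  by rewrite ln_powR fine_nuE//; ring.
have Ile : I <= \sum_i (ln (1 - la * (top i - u)) + la / D / n.+1%:R) * fine (nu (cell i)).
  rewrite -lee_fin fineK//.
  apply: (@integral_le_cells _ T R nu _ _ mcell tcell ccell h _ _ mh hb) => i x.
  move=> /(@cell_topP _ T R f _ _ n lof fhi) /andP[h1 h2].
  have q0 : 0 < 1 - la * (f x - u) by rewrite (lt_le_trans D0)// qD.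
  have n0 : 0 <= la * (top i - f x) by rewrite mulr_ge0// subr_ge0.
  rewrite -lerBlDl -ln_div ?posrE//.
  have -> : (1 - la * (f x - u)) / (1 - la * (top i - u)) =
      1 + la * (top i - f x) / (1 - la * (top i - u)).
    by rewrite -[X in _ = X + _](divff (lt0r_neq0 (topD0 i))) -mulrDl; congr (_ / _); ring.
  apply: (le_trans (le_ln1Dx _)).
    by apply: (lt_le_trans (ltrN10 R)); apply: divr_ge0 => //; exact: ltW.
  rewrite [leRHS]mulrAC; apply: ler_pM => //; first by rewrite invr_ge0 ltW.
  + by rewrite ler_wpM2l// lerBlDl.
  + by rewrite lef_pV2 ?posrE.
move: Ile; under eq_bigr do rewrite mulrDl.
rewrite big_split/= -mulr_sumr (sum_probability_cells nu mcell tcell ccell) mulr1 => Ile.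
have : ln p <= ln Pi by rewrite ler_ln ?posrE// (lt_le_trans P0).
rewrite lnPi; set S := \sum_i _ in Ile * => pS.
apply: (le_trans pS).
have h1 : (alpha - m) * I <= (alpha - m) * (S + la / D / n.+1%:R) by rewrite ler_pM2l.
have h2 : (alpha - m) * (la / D / n.+1%:R) = C / n.+1%:R by rewrite /C; ring.
have h3 : C / n.+1%:R <= eps.
  apply: (@le_trans _ _ (C * (eps / (C + 1)))); first by rewrite ler_wpM2l// ltW.
  rewrite mulrCA ger_pMr// ler_pdivrMr ?ltr_wpDl// mul1r lerDl//.
move: h1 h2 h3; rewrite mulrDr; move: ((alpha - m) * I) ((alpha - m) * S) => A1 A2.
move: (_ * (la / D / _)) (C / _) => A3 A4 h1 h2 h3; rewrite lerNl opprD; lra.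
Qed.

End RandomIntegralTail.

(** * A bound on the Kullback-Leibler divergence *)

Section KullbackLeiblerBound.
Context d (T : measurableType d) (R : realType).
Local Open Scope charge_scope.

Lemma le_integral_measurable (mu : {measure set T -> \bar R}) (h k : T -> \bar R) :
  measurable_fun setT h -> measurable_fun setT k -> (forall x, h x <= k x)%E ->
  (\int[mu]_x h x <= \int[mu]_x k x)%E.
Proof.
move=> mh mk hk; rewrite integralE [leRHS]integralE; apply: leeB.
- apply: ge0_le_integral => //; [exact: measurable_funepos|exact: measurable_funepos|].
  by move=> x _; apply: funepos_le => //; rewrite inE.
- apply: ge0_le_integral => //; [exact: measurable_funeneg|exact: measurable_funeneg|].
  by move=> x _; apply: funeneg_le => //; rewrite inE.
Qed.

(** The assumption says that w bounds the density of mu with respect to nu from below.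
    With r the density of nu with respect to mu, ln r <= - ln w + (r w - 1), and the
    integral of r w against nu is at most that of r against mu, which is 1. *)
Lemma KL_le_density (nu mu : probability T R) (w : T -> R) (c C : R) :
  measurable_fun setT w -> 0 < c -> (forall x, c <= w x) -> (forall x, w x <= C) ->
  (forall phi : T -> \bar R, measurable_fun setT phi -> (forall x, 0 <= phi x)%E ->
    \int[nu]_x (phi x * (w x)%:E) <= \int[mu]_x phi x)%E ->
  (KL nu mu <= - \int[nu]_x (ln (w x))%:E)%E.
Proof.
move=> mw c0 cw wC H.
have w0 x : 0 < w x by exact: lt_le_trans (cw x).
have numu : nu `<< mu.
  apply/null_content_dominatesP => A mA muA.
  have mA1 : measurable_fun setT (fun x => (\1_A x)%:E : \bar R) by exact/measurable_EFinP.
  have A1 x : (0 <= (\1_A x)%:E :> \bar R)%E by rewrite lee_fin.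
  have := H _ mA1 A1; rewrite integral_indic// setIT muA => h.
  have : (c%:E * nu A <= 0)%E.
    apply: le_trans h.
    rewrite -[X in nu X](setIT A) -integral_indic// -ge0_integralZl//; last exact: ltW.
    apply: ge0_le_integral => //.
    + by move=> x _; rewrite mule_ge0// lee_fin ltW.
    + exact: measurable_funeM.
    + by apply: emeasurable_funM => //; exact/measurable_EFinP.
    + by move=> x _; rewrite muleC lee_wpmul2l// lee_fin.
  rewrite pmule_rle0 ?lte_fin// => nuA.
  by apply/eqP; rewrite eq_le nuA measure_ge0.
rewrite /KL; have -> : `[< nu `<< mu >] by exact/asboolP.
have numu' : charge_of_finite_measure nu `<< mu.
  exact: numu.
set D := 'd _ '/d mu.
pose r x := fine (D x).
have rE x : D x = (r x)%:E by rewrite /r fineK// Radon_Nikodym_fin_num.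
have mr : measurable_fun setT r.
  apply: measurableT_comp => //.
  by have /integrableP[] := Radon_Nikodym_integrable numu'.
pose rp x := Num.max (r x) 0.
have mrp : measurable_fun setT rp by apply: measurable_maxr.
have rp0 x : 0 <= rp x by rewrite /rp le_max lexx orbT.
have J1 : (\int[nu]_x ((rp x)%:E * (w x)%:E) <= 1)%E.
  apply: le_trans (H _ _ _) _; [exact/measurable_EFinP|by move=> x; rewrite lee_fin|].
  pose Dp := [set x | 0 <= r x].
  have mDp : measurable Dp.
    rewrite -[X in measurable X]setTI (_ : Dp = r @^-1` `[0, +oo[); first exact: mr.
    by apply/seteqP; split => x; rewrite /Dp/= in_itv/= andbT.
  have -> : (\int[mu]_x (rp x)%:E = \int[mu]_(x in Dp) D x)%E.
    rewrite -[in RHS](setTI Dp) integral_mkcondr; apply: eq_integral => x _.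
    rewrite patchE rE /rp; case: ifPn; rewrite ?inE ?notin_setE /Dp/= => h.
      by rewrite max_l.
    by rewrite max_r// leNgt; apply/negP => /ltW.
  rewrite -(Radon_Nikodym_integral numu' mDp).
  exact: probability_le1.
pose k x := - ln (w x) + (rp x * w x - 1).
have mlnw : measurable_fun setT (fun x => ln (w x)).
  by apply: measurableT_comp => //; exact: measurable_ln.
have mk : measurable_fun setT (fun x => (k x)%:E : \bar R).
  apply/measurable_EFinP; apply: measurable_funD; first exact: measurableT_comp.
  by apply: measurable_funB; [exact: measurable_funM|exact: measurable_cst].
have Dk x : (lne (D x) <= (k x)%:E)%E.
  rewrite rE /lne; case: ifPn => [_|]; first exact: leNye.
  rewrite -ltNge => r0; rewrite lee_fin /k /rp max_l ?(ltW r0)//.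
  rewrite addrC -lerBlDr opprK -lnM ?posrE//.
  have := @le_ln1Dx _ (r x * w x - 1); rewrite [1 + _]addrC subrK; apply.
  by rewrite ltrBrDr addNr mulr_gt0.
have mD : measurable_fun setT (fun x => lne (D x)).
  rewrite (_ : (fun x => _) = fun x => if r x <= 0 then -oo%E else (ln (r x))%:E).
    apply: measurable_fun_ifT.
    + apply: measurable_fun_ler => //; exact: measurable_cst.
    + exact: measurable_cst.
    + by apply/measurable_EFinP; apply: measurableT_comp => //; exact: measurable_ln.
  by apply/funext => x; rewrite rE.
apply: (le_trans (le_integral_measurable nu mD mk Dk)).
have ilnw : nu.-integrable setT (EFin \o (fun x => ln (w x))).
  apply: (@bounded_integrable _ _ _ _ _ (`|ln c| + `|ln C|)) => // x.
  by apply: norm_le_bounds; rewrite ler_ln ?posrE// (lt_le_trans (w0 x)).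
have mrw : measurable_fun setT (fun x => rp x * w x) by exact: measurable_funM.
have irw : nu.-integrable setT (EFin \o (fun x => rp x * w x)).
  apply/integrableP; split; first exact/measurable_EFinP.
  apply: (@le_lt_trans _ _ 1%E); last exact: ltry.
  apply: le_trans J1; rewrite le_eqVlt; apply/orP; left; apply/eqP.
  apply: eq_integral => x _; rewrite gee0_abs ?EFinM//.
  by rewrite lee_fin mulr_ge0// ltW.
have i1 : nu.-integrable setT (EFin \o (fun=> 1 : R)).
  by apply: (@bounded_integrable _ _ _ _ _ 1) => // x; rewrite normr1.
have irw1 : nu.-integrable setT (EFin \o (fun x => rp x * w x - 1)).
  by have := integrableB measurableT irw i1.
have fl : (\int[nu]_x (ln (w x))%:E)%E \is a fin_num by exact: integrable_fin_num ilnw.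
have -> : (\int[nu]_x (k x)%:E =
    (\int[nu]_x (rp x * w x)%:E - 1) - \int[nu]_x (ln (w x))%:E)%E.
  have -> : (1 = \int[nu]_x (1 : R)%:E)%E.
    by rewrite integral_cst// mul1e; exact/esym/probability_setT.
  rewrite -(integralB_EFin measurableT irw i1) -(integralB_EFin measurableT irw1 ilnw).
  by apply: eq_integral => x _; rewrite /k addrC.
rewrite -[leRHS]add0e; apply: leeD2r.
rewrite sube_le0; apply: le_trans J1.
by rewrite le_eqVlt; apply/orP; left; apply/eqP; apply: eq_integral => x _; rewrite EFinM.
Qed.

End KullbackLeiblerBound.

(** * Near-optimal dual parameters *)

Section DualPoint.
Context d (T : measurableType d) (R : realType) (nu : probability T R).
Variables (g : T -> R) (M gm : R).
Hypotheses (mg : measurable_fun setT g) (gM : forall x, `|g x| <= M)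
  (ggm : forall x, g x <= gm) (gm_gt0 : 0 < gm).
Implicit Types la : R.

(** Minus the derivative of ln (1 - la * g x) in la. *)
Definition tilt la x := g x / (1 - la * g x).

Definition tilt_mean la : R := \int[nu]_x tilt la x.

Lemma tilt_den_ge la x : 0 <= la -> 1 - la * gm <= 1 - la * g x.
Proof. by move=> la0; rewrite lerD2l lerN2 ler_wpM2l. Qed.

Lemma measurable_tilt_inv la : measurable_fun setT (fun x => (1 - la * g x)^-1).
Proof.
apply: (measurableT_comp measurable_invr); apply: measurable_funB => //.
exact: measurable_funM.
Qed.

Lemma measurable_tilt la : measurable_fun setT (tilt la).
Proof. by apply: measurable_funM => //; exact: measurable_tilt_inv. Qed.

Lemma tilt_bound la x : 0 <= la -> la * gm < 1 -> `|tilt la x| <= M / (1 - la * gm).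
Proof.
move=> la0 la1; have D0 : 0 < 1 - la * gm by rewrite subr_gt0.
have q0 : 0 < 1 - la * g x by exact: lt_le_trans (tilt_den_ge x la0).
rewrite normrM (gtr0_norm (_ : 0 < (1 - la * g x)^-1)) ?invr_gt0//.
by rewrite ler_pM ?invr_ge0 ?(ltW q0)// lef_pV2 ?posrE// tilt_den_ge.
Qed.

Lemma integrable_tilt la : 0 <= la -> la * gm < 1 -> nu.-integrable setT (EFin \o tilt la).
Proof.
move=> la0 la1; apply: (@bounded_integrable _ _ _ _ _ (M / (1 - la * gm))).
  exact: measurable_tilt.
by move=> x; exact: tilt_bound.
Qed.

(** tilt la' - tilt la = (la' - la) tilt la tilt la', a nonnegative product. *)
Lemma tilt_mean_step la la' l : 0 <= la -> la <= la' -> la' <= l -> l * gm < 1 ->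
  tilt_mean la <= tilt_mean la' <= tilt_mean la + (la' - la) * (M / (1 - l * gm)) ^+ 2.
Proof.
move=> la0 lala' la'l l1.
have la'0 : 0 <= la' by exact: le_trans lala'.
have la'1 : la' * gm < 1 by apply: le_lt_trans l1; rewrite ler_pM2r.
have la1 : la * gm < 1 by apply: le_lt_trans la'1; rewrite ler_pM2r.
have M0 : 0 <= M by exact: le_trans (normr_ge0 _) (gM point).
have B k x : 0 <= k -> k <= l -> `|tilt k x| <= M / (1 - l * gm).
  move=> k0 kl; have k1 : k * gm < 1 by apply: le_lt_trans l1; rewrite ler_pM2r.
  apply: (le_trans (tilt_bound x k0 k1)); rewrite ler_wpM2l// lef_pV2 ?posrE ?subr_gt0//.
  by rewrite lerD2l lerN2 ler_pM2r.
have q0 k x : 0 <= k -> k * gm < 1 -> 0 < 1 - k * g x.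
  by move=> k0 k1; apply: lt_le_trans (tilt_den_ge x k0); rewrite subr_gt0.
have E x : tilt la' x - tilt la x = (la' - la) * (tilt la x * tilt la' x).
  have h1 := lt0r_neq0 (q0 la x la0 la1); have h2 := lt0r_neq0 (q0 la' x la'0 la'1).
  by rewrite /tilt; field; rewrite h1 h2.
have P x : 0 <= tilt la x * tilt la' x.
  rewrite /tilt mulrACA mulr_ge0 ?sqr_ge0 -?expr2//.
  by rewrite mulr_ge0// invr_ge0 ltW// q0.
have i1 := integrable_tilt la0 la1; have i2 := integrable_tilt la'0 la'1.
apply/andP; split.
  apply: le_Rintegral => // x _.
  by rewrite -subr_ge0 E mulr_ge0// subr_ge0.
set K := (la' - la) * _.
have iK : nu.-integrable setT (EFin \o (fun=> K)).
  by apply: (@bounded_integrable _ _ _ _ _ `|K|).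
have KE : \int[nu]_x K = K.
  rewrite Rintegral_cst// -[RHS]mulr1; congr (_ * _).
  by have /(congr1 fine) := probability_setT nu.
rewrite -[in leRHS]KE -RintegralD//; apply: le_Rintegral => //.
  by have := integrableD measurableT i1 iK.
move=> x _; rewrite -lerBlDl E ler_wpM2l ?subr_ge0//.
rewrite (le_trans (ler_norm _))// normrM expr2 ler_pM// B//.
exact: le_trans la'l.
Qed.

(** An almost stationary point of the dual function. If tilt_mean is positive at some l,
    the last point of a fine subdivision of [0, l] where it is not positive will do, by
    the Lipschitz estimate; otherwise tilt_mean stays between tilt_mean 0 and 0,
    and la is taken so near to 1 / gm that the factor 1 - la gm is small. *)
Lemma exists_dual_point (eps : R) : 0 < eps -> tilt_mean 0 <= 0 ->
  exists la, [/\ 0 <= la, la * gm < 1, tilt_mean la <= 0 &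
    - tilt_mean la * (1 - la * gm) <= eps].
Proof.
move=> eps0 E0.
have [[l [l0 l1 El]]|noroot] := pselect (exists l, [/\ 0 <= l, l * gm < 1 & 0 < tilt_mean l]).
  pose K := (M / (1 - l * gm)) ^+ 2.
  have K0 : 0 <= l * K by rewrite mulr_ge0// sqr_ge0.
  have eK : 0 < eps / (l * K + 1) by rewrite divr_gt0// ltr_wpDl.
  have [N _ /(_ N (leqnn N)) hN] := near_infty_natSinv_lt (PosNum eK).
  have hN' : l / N.+1%:R * K <= eps.
    rewrite mulrAC (@le_trans _ _ (l * K * (eps / (l * K + 1))))// ?ler_wpM2l// ?(ltW hN)//.
    by rewrite mulrCA ger_pMr// ler_pdivrMr ?ltr_wpDl// mul1r lerDl.
  pose p j := (j <= N.+1)%N && (tilt_mean (l * (j%:R / N.+1%:R)) <= 0).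
  have p0 : exists j, p j by exists 0%N; rewrite /p/= mul0r mulr0.
  have pN j : p j -> (j <= N.+1)%N by case/andP.
  case: (ex_maxnP p0 pN) => j /andP[jN Ej] jmax.
  have jN' : (j < N.+1)%N.
    rewrite ltn_neqAle jN andbT; apply/eqP => jE; move: Ej.
    by rewrite jE divff ?pnatr_eq0// mulr1 leNgt El.
  have jl k : (k <= N.+1)%N -> 0 <= l * (k%:R / N.+1%:R) <= l.
    move=> kN; rewrite mulr_ge0 ?divr_ge0//= ler_piMr// ler_pdivrMr// mul1r ler_nat//.
  have /andP[a0 al] := jl _ jN; have /andP[b0 bl] := jl _ jN'.
  have a1 : l * (j%:R / N.+1%:R) * gm < 1 by apply: le_lt_trans l1; rewrite ler_pM2r.
  exists (l * (j%:R / N.+1%:R)); split => //.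
  have Ej1 : 0 < tilt_mean (l * (j.+1%:R / N.+1%:R)).
    rewrite ltNge; apply/negP => h; have := jmax j.+1.
    by rewrite /p jN' h ltnn => /(_ isT).
  have ab : l * (j%:R / N.+1%:R) <= l * (j.+1%:R / N.+1%:R).
    by rewrite ler_wpM2l// ler_pM2r ?invr_gt0// ler_nat.
  have e1 : j.+1%:R - j%:R = 1 :> R by rewrite -natr1 addrAC subrr add0r.
  have /andP[_] := tilt_mean_step a0 ab bl l1.
  rewrite -mulrBr -mulrBl e1 mul1r -/K => h.
  apply: (@le_trans _ _ (- tilt_mean (l * (j%:R / N.+1%:R)))).
    by rewrite ler_piMr ?oppr_ge0// gerBl mulr_ge0// ltW.
  move: (lt_le_trans Ej1 h) hN'; move: (_ * K) (tilt_mean _) => A B h1 h2.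
  by rewrite (le_trans _ h2)// -subr_ge0 opprK addrC ltW.
pose t := eps / (eps - tilt_mean 0).
have d0 : 0 < eps - tilt_mean 0 by rewrite subr_gt0 (le_lt_trans E0).
have t0 : 0 < t by rewrite divr_gt0.
have t1 : t <= 1 by rewrite ler_pdivrMr// mul1r lerBrDl gerDr.
have E : (1 - t) / gm * gm = 1 - t by rewrite divfK// lt0r_neq0.
have la0 : 0 <= (1 - t) / gm by rewrite divr_ge0 ?subr_ge0// ltW.
have la1 : (1 - t) / gm * gm < 1 by rewrite E gtrBl.
have /andP[m0 _] := tilt_mean_step (lexx 0) la0 (lexx _) la1.
exists ((1 - t) / gm); split => //.
  by rewrite leNgt; apply/negP => h; apply: noroot; exists ((1 - t) / gm).
rewrite E subKr (@le_trans _ _ (- tilt_mean 0 * t))//.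
  by rewrite ler_pM2r// lerN2.
by rewrite /t mulrCA ger_pMr// ler_pdivrMr// mul1r lerDr ltW.
Qed.

End DualPoint.

(** * The dual bound on Kinf *)

Section KinfDuality.
Context d (T : measurableType d) (R : realType).

Lemma finite_measure_density (nu : {finite_measure set T -> \bar R}) (w : T -> R) (C : R) :
  measurable_fun setT w -> (forall x, 0 <= w x <= C) ->
  exists rho : {finite_measure set T -> \bar R},
    forall h : T -> \bar R, measurable_fun setT h -> (forall x, 0 <= h x)%E ->
      (\int[rho]_x h x = \int[nu]_x (h x * (w x)%:E))%E.
Proof.
move=> mw wC; have w0 x : 0 <= w x by case/andP: (wC x).
have iw : nu.-integrable setT (EFin \o w).
  apply: (@bounded_integrable _ _ _ _ _ C) => // x.
  by rewrite ger0_norm//; case/andP: (wC x).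
have c0 A : (0 <= induced_charge iw A)%E.
  by apply: integral_ge0 => x _; rewrite lee_fin.
have [|rho rhoE] := @finite_measure_of _ _ _ (measure_of_charge (induced_charge iw) c0).
  rewrite -[X in (X < _)%E]/(\int[nu]_x (w x)%:E)%E ltey_eq.
  by rewrite (integrable_fin_num measurableT iw).
exists rho => h mh h0; apply: (@ge0_integral_density _ _ _ rho nu w h) => //.
Qed.

Lemma EFin_Rintegral (mu : {measure set T -> \bar R}) (h : T -> R) :
  mu.-integrable setT (EFin \o h) -> ((\int[mu]_x h x)%R%:E = \int[mu]_x (h x)%:E)%E.
Proof. by move=> ih; rewrite /Rintegral fineK//; exact: integrable_fin_num ih. Qed.

Variables (nu : probability T R) (f : T -> R) (u lo hi : R) (x0 : T).
Hypotheses (mf : measurable_fun setT f) (lof : forall x, lo <= f x)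
  (fhi : forall x, f x <= hi) (fx0 : f x0 = hi) (uhi : u < hi).

Local Notation g := (fun x => f x - u).
Let gm := hi - u.
Let M := `|lo - u| + `|hi - u|.

Let mg : measurable_fun setT g.
Proof. by apply: measurable_funB => //; exact: measurable_cst. Qed.

Let gM x : `|g x| <= M.
Proof. by apply: norm_le_bounds; rewrite lerD2r. Qed.

Let ggm x : g x <= gm. Proof. by rewrite lerD2r. Qed.

Let gm0 : 0 < gm. Proof. by rewrite subr_gt0. Qed.

Let integral_f (mu : probability T R) :
  (\int[mu]_x (f x)%:E = hi%:E - \int[mu]_x (hi - f x)%:E)%E.
Proof.
have b1 x : `|f x| <= `|lo| + `|hi| by exact: norm_le_bounds.
have i1 : mu.-integrable setT (EFin \o f) by exact: bounded_integrable mf b1.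
have i2 : mu.-integrable setT (EFin \o (fun=> hi : R)).
  by apply: (@bounded_integrable _ _ _ _ _ `|hi|).
have i3 : mu.-integrable setT (EFin \o (fun x => hi - f x)).
  by have := integrableB measurableT i2 i1.
have hiE : (hi%:E = \int[mu]_x hi%:E)%E.
  by rewrite integral_cst// -[LHS]mule1; congr (_ * _)%E; exact/esym/probability_setT.
rewrite hiE -(integralB_EFin measurableT i2 i3); apply: eq_integral => x _.
by rewrite -EFinB subKr.
Qed.

Lemma Kinf_le_KL (mu : probability T R) : (u%:E <= \int[mu]_x (f x)%:E)%E ->
  (Kinf nu u f <= KL nu mu)%E.
Proof. by move=> uf; apply: ereal_inf_lbound; exists mu. Qed.

(** The competitor is mu = s nu / (1 - la g) + r delta_x0. With
    psi = tilt_mean nu g la and N = - psi (1 - la gm), the choice s = gm / (gm + N) makes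
    int f dmu equal to u, and r >= 0 is the missing mass. The price over the integral
    of ln (1 - la g) is - ln s = ln (1 + N / gm) <= N / gm. *)
Lemma Kinf_le_tilt (la eps : R) : 0 < eps -> 0 <= la -> la * gm < 1 ->
  tilt_mean nu g la <= 0 -> - tilt_mean nu g la * (1 - la * gm) <= gm * eps ->
  (Kinf nu u f <= \int[nu]_x (ln (1 - la * (f x - u)))%:E + eps%:E)%E.
Proof.
move=> eps0 la0 la1; set psi := tilt_mean nu g la => psi0.
set N := - psi * _ => Neps.
have D0 : 0 < 1 - la * gm by rewrite subr_gt0.
have qD x : 1 - la * gm <= 1 - la * g x by exact: (tilt_den_ge ggm).
have q0 x : 0 < 1 - la * g x by exact: lt_le_trans (qD x).
have N0 : 0 <= N by rewrite mulr_ge0 ?oppr_ge0// ltW.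
pose s := gm / (gm + N).
have gN : 0 < gm + N by rewrite ltr_wpDr.
have s0 : 0 < s by rewrite divr_gt0.
have s1 : s <= 1 by rewrite ler_pdivrMr// mul1r lerDl.
pose w x := s / (1 - la * g x).
have mi := measurable_tilt_inv mg la.
have mw : measurable_fun setT w by exact: measurable_funM.
have M0 : 0 <= M by rewrite addr_ge0.
have qM x : 1 - la * g x <= 1 + la * M.
  rewrite lerD2l -mulrN ler_wpM2l// (le_trans (ler_norm _))// normrN; exact: gM.
have wC x : w x <= s / (1 - la * gm).
  by rewrite ler_pM2l// lef_pV2 ?posrE.
have wc x : s / (1 + la * M) <= w x.
  by rewrite ler_pM2l// lef_pV2 ?posrE// (lt_le_trans (q0 x)).
have c0 : 0 < s / (1 + la * M) by rewrite divr_gt0// (lt_le_trans (q0 x0)).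
have w0 x : 0 <= w x by rewrite (le_trans _ (wc x))// ltW.
have [|nuw nuwE] := @finite_measure_density nu w (s / (1 - la * gm)) mw.
  by move=> x; rewrite w0 wC.
have it := integrable_tilt nu mg gM ggm la0 la1.
have i1 : nu.-integrable setT (EFin \o (fun=> 1 : R)).
  by apply: (@bounded_integrable _ _ _ _ _ 1) => // x; rewrite normr1.
have wE x : w x = s * (1 + la * tilt g la x).
  rewrite /w /tilt; congr (_ * _).
  by field; rewrite lt0r_neq0.
have hwE x : (hi - f x) * w x = s * gm + s * (la * gm - 1) * tilt g la x.
  by rewrite wE /tilt /gm; field; rewrite lt0r_neq0.
have intl (a b : R) : (\int[nu]_x (a + b * tilt g la x)%:E = (a + b * psi)%:E)%E.
  have ia : nu.-integrable setT (EFin \o (fun=> a)).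
    by apply: (@bounded_integrable _ _ _ _ _ `|a|).
  have ib : nu.-integrable setT (EFin \o (fun x => b * tilt g la x)).
    by have := integrableZl measurableT b it.
  rewrite -EFin_Rintegral; last by have := integrableD measurableT ia ib.
  rewrite RintegralD// RintegralZl// Rintegral_cst// -/psi.
  congr ((_ + _)%:E); rewrite -[RHS]mulr1; congr (_ * _).
  by have /(congr1 fine) := probability_setT nu.
have massw : (\int[nu]_x (w x)%:E = (s * (1 + la * psi))%:E)%E.
  rewrite mulrDr mulr1 mulrA -intl; apply: eq_integral => x _.
  by rewrite wE; congr EFin; ring.
have r0 : 0 <= 1 - s * (1 + la * psi).
  rewrite subr_ge0; apply: le_trans s1.
  by rewrite ger_pMr// gerDl mulr_ge0_le0.
have [mu0 [mu0E imu0]] := @finite_measure_comb _ T R 1 _ nuw (dirac x0) ler01 r0.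
have [|mu muE] := @probability_of _ T R mu0.
  apply: (etrans (mu0E setT)); rewrite mul1e.
  rewrite [X in (_ + _ * X)%E](_ : _ = 1%E) ?mule1; last exact: diracT.
  have nuwT : (nuw setT = \int[nu]_x (w x)%:E)%E.
    transitivity (\int[nuw]_x (1 : R)%:E)%E; first by rewrite integral_cst// mul1e.
    by rewrite nuwE//; apply: eq_integral => x _; rewrite mul1e.
  by rewrite [X in (X + _)%E]nuwT massw -EFinD addrC subrK.
have imu h : measurable_fun setT h -> (forall x, 0 <= h x)%E ->
  (\int[mu]_x h x = \int[nu]_x (h x * (w x)%:E) + (1 - s * (1 + la * psi))%:E * h x0)%E.
  move=> mh h0; transitivity (\int[mu0]_x h x)%E.
    by apply: eq_measure_integral => A mA _; exact: muE.
  by rewrite imu0// mul1e nuwE// integral_dirac// diracT mul1e.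
apply: (@le_trans _ _ (KL nu mu)).
  apply: Kinf_le_KL; rewrite integral_f imu; last 2 first.
  - by apply/measurable_EFinP; apply: measurable_funB => //; exact: measurable_cst.
  - by move=> x; rewrite lee_fin subr_ge0.
  rewrite fx0 subrr mule0 adde0.
  under eq_integral do rewrite -EFinM hwE.
  rewrite intl -EFinB lee_fin.
  rewrite (_ : s * gm + s * (la * gm - 1) * psi = gm); first by rewrite /gm subKr.
  by rewrite /s /N; field; rewrite -/N lt0r_neq0.
apply: (@le_trans _ _ (- \int[nu]_x (ln (w x))%:E)%E).
  apply: (KL_le_density mw c0 wc wC) => phi mphi phi0.
  by rewrite imu// leeDl// mule_ge0// lee_fin.
have ilnq : nu.-integrable setT (EFin \o (fun x => ln (1 - la * g x))).
  apply: (@bounded_integrable _ _ _ _ _ (`|ln (1 - la * gm)| + `|ln (1 + la * M)|)).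
    apply: measurableT_comp; first exact: measurable_ln.
    by apply: measurable_funB => //; exact: measurable_funM.
  by move=> x; apply: norm_le_bounds; rewrite ler_ln ?posrE// (lt_le_trans (q0 x)).
have is_ : nu.-integrable setT (EFin \o (fun=> ln s)).
  by apply: (@bounded_integrable _ _ _ _ _ `|ln s|).
have -> : (\int[nu]_x (ln (w x))%:E = (ln s)%:E - \int[nu]_x (ln (1 - la * g x))%:E)%E.
  have -> : ((ln s)%:E = \int[nu]_x (ln s)%:E)%E.
    by rewrite integral_cst// -[LHS]mule1; congr (_ * _)%E; exact/esym/probability_setT.
  rewrite -(integralB_EFin measurableT is_ ilnq); apply: eq_integral => x _.
  by rewrite /w ln_div ?posrE.
rewrite oppeB ?fin_num_adde_defr// [leLHS]addeC; apply: leeD2l; rewrite -EFinN lee_fin.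
rewrite /s -lnV ?posrE// invf_div mulrDl divff ?lt0r_neq0//.
apply: (le_trans (le_ln1Dx _)).
  by rewrite (lt_le_trans (ltrN10 R))// divr_ge0// ltW.
by rewrite ler_pdivrMr// mulrC.
Qed.

(** If int f dnu > u, then la = 0 and the competitor nu itself will do. *)
Lemma Kinf_le_dual (eps : R) : 0 < eps ->
  exists la, [/\ 0 <= la, la * (hi - u) < 1 &
    (Kinf nu u f <= \int[nu]_x (ln (1 - la * (f x - u)))%:E + eps%:E)%E].
Proof.
move=> eps0; have [E0|E0] := leP (tilt_mean nu g 0) 0.
  have [la [la0 la1 psi0 h]] := exists_dual_point mg gM ggm gm0 (mulr_gt0 gm0 eps0) E0.
  by exists la; split => //; exact: Kinf_le_tilt.
exists 0; split; [by []|by rewrite mul0r|].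
apply: (@le_trans _ _ (KL nu nu)).
  apply: Kinf_le_KL.
  have b1 x : `|f x| <= `|lo| + `|hi| by exact: norm_le_bounds.
  have i1 : nu.-integrable setT (EFin \o f) by exact: bounded_integrable mf b1.
  have i2 : nu.-integrable setT (EFin \o (fun=> u)).
    by apply: (@bounded_integrable _ _ _ _ _ `|u|).
  move: E0; rewrite /tilt_mean /tilt.
  under eq_Rintegral do rewrite mul0r subr0 divr1.
  rewrite RintegralB// Rintegral_cst//.
  rewrite (_ : fine _ = 1) ?mulr1; last by have /(congr1 fine) := probability_setT nu.
  by rewrite subr_gt0 -lte_fin EFin_Rintegral// => /ltW.
apply: (@le_trans _ _ (- \int[nu]_x (ln (1 : R))%:E)%E).
  apply: (@KL_le_density _ _ _ nu nu (fun=> 1) 1 1) => // phi mphi phi0.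
  by under eq_integral do rewrite mule1.
under eq_integral do rewrite ln1.
under [in leRHS]eq_integral do rewrite mul0r subr0 ln1.
by rewrite integral0 oppe0 add0e lee_fin ltW.
Qed.

End KinfDuality.

(** * The tail bound for the Dirichlet process *)

Unset Implicit Arguments.
Theorem theorem3p1 (R : realType) (Omega : pmetricType R)
    (Omega_compact : compact [set: Omega])
    (alpha : R) (alpha_gt0 : 0 < alpha)
    (nu0 : probability (borelType Omega) R)
    (nu0_support : msupport nu0 = [set: Omega])
    (f : Omega -> R) (f_cont : continuous f)
    (u : R) (u_ge : fmin f <= u) (u_lt : u < fmax f)
    (eta0 : {finite_measure set (borelType Omega) -> \bar R})
    (eta0_concentrated : eta0 [set x | f x <= u] = 0%E)
    (eta0_le : mle eta0 (fun A => alpha%:E * nu0 A)%E)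
    (gap_gt0 : 0 < min_on (msupport eta0) f - u + Num.max (u - fmin f) 0)
    (m : R) (m_ge0 : 0 <= m)
    (m_le : m <= Sfun (fine (eta0 setT)) (alpha - fine (eta0 setT))
              (Num.max (u - fmin f) 0
               / (min_on (msupport eta0) f - u + Num.max (u - fmin f) 0)))
    (eta : {finite_measure set (borelType Omega) -> \bar R})
    (eta_le : mle eta eta0) (eta_mass : eta setT = m%:E)
    (eta_min : forall mu : {finite_measure set (borelType Omega) -> \bar R},
       mle mu eta0 -> mu setT = m%:E ->
       (\int[eta]_x (f x)%:E <= \int[mu]_x (f x)%:E)%E)
    (d : measure_display) (W : measurableType d) (P : probability W R)
    (X : {RV P >-> pprobability (borelType Omega) R})
    (X_DP : is_DirichletProcess X alpha nu0) :
  exists nu : probability (borelType Omega) R,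
    (forall A, measurable A ->
       nu A = ((alpha%:E * nu0 A - eta A) * ((alpha - m)^-1)%:E)%E) /\
    (lne (P [set w | u%:E <= \int[(X w : probability (borelType Omega) R)]_x (f x)%:E])
     <= - ((alpha - m)%:E * Kinf nu u f))%E.
Proof.
have max_u : Num.max (u - fmin f) 0 = u - fmin f by rewrite max_l// subr_ge0.
move: gap_gt0 m_le; rewrite max_u addrA subrK => gap m_le'.
have m_lt : m < alpha.
  exact: (removed_mass_lt Omega_compact alpha_gt0 nu0_support f_cont u_ge u_lt
    eta0_concentrated eta0_le gap m_ge0 m_le').
have am : 0 < alpha - m by rewrite subr_gt0.
have [anu0 [anu0E _]] := finite_measure_comb nu0 nu0 (ltW alpha_gt0) (lexx 0).
have eta_anu0 : mle eta anu0.
  move=> A mA; rewrite anu0E mul0e adde0.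
  by apply: le_trans (eta_le A mA) (eta0_le A mA).
have [rho rhoE] := finite_measure_sub eta_anu0.
have iam : 0 <= (alpha - m)^-1 by rewrite invr_ge0 ltW.
have [nrho [nrhoE _]] := finite_measure_comb rho rho iam (lexx 0).
have nrhoE' A : measurable A ->
    nrho A = ((alpha%:E * nu0 A - eta A) * ((alpha - m)^-1)%:E)%E.
  move=> mA; rewrite nrhoE mul0e adde0 muleC; congr (_ * _)%E.
  by rewrite [LHS]rhoE//; congr (_ - _)%E; rewrite anu0E mul0e adde0.
have [|nu nuE] := @probability_of _ _ _ nrho.
  rewrite [LHS]nrhoE'//.
  have -> : nu0 setT = 1%E by exact: probability_setT.
  by rewrite mule1 [X in (_ - X)%E]eta_mass -EFinB -EFinM divff// lt0r_neq0.
have nuE' A : measurable A ->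
    nu A = ((alpha%:E * nu0 A - eta A) * ((alpha - m)^-1)%:E)%E.
  by move=> mA; rewrite nuE; exact: nrhoE'.
exists nu; split; first exact: nuE'.
rewrite leeNr; apply/lee_addgt0Pr => eps eps0.
have [x0 fx0 _] := fmax_attained Omega_compact f_cont.
have e0 : 0 < eps / (alpha - m) by rewrite divr_gt0.
have [la [la0 la1 K_le]] := @Kinf_le_dual _ (borelType Omega) R nu f u (fmin f) (fmax f) x0
  (continuous_measurable_borel f_cont) (fmin_le Omega_compact f_cont)
  (le_fmax Omega_compact f_cont) fx0 u_lt _ e0.
have := lne_random_integral_tail_le Omega_compact alpha_gt0 nu0_support f_cont u_ge u_lt
  eta0_concentrated eta0_le gap m_ge0 m_le' eta_le eta_mass eta_min X_DP nuE' la0 la1.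
rewrite leeNr => tail_le.
apply: (@le_trans _ _ ((alpha - m)%:E *
    (\int[nu]_x (ln (1 - la * (f x - u)))%:E + (eps / (alpha - m))%:E))%E).
  by rewrite lee_wpmul2l// lee_fin ltW.
rewrite muleDr ?fin_num_adde_defl// -EFinM mulrCA divff ?mulr1 ?lt0r_neq0//.
exact: leeD2r.
Qed.
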